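(* Let $(X,d)$ be a proper metric space, consider the Lipschitz triple $(C_0(X),C_0(X),L_d)$ where $L_d$ is the usual Lipschitz seminorm, and let $\rho:C_0(X)\to\mathbb{B}(H)$ be a faithful nondegenerate representation. Then the generalized Higson compactification $\overline{C_0(X)}^{h}$ of $(C_0(X),C_0(X),L_d)$ coincides with $\rho(C_h(X))$, where $C_h(X)$ is the classical algebra of the Higson compactification: $$\overline{C_0(X)}^{h}=\rho(C_h(X)).$$
   Context: $L_d(f)=\sup_{x\ne y}|f(x)-f(y)|/d(x,y)$. The representation $\rho$ is extended to $C_b(X)=\mathcal{M}(C_0(X))$, which is thereby identified with a subalgebra of $\mathbb{B}(H)$. Spectral propagation: $T\in\mathbb{B}(H)$ has spectral propagation $\le R$ if $\chi_{(-\infty,0]}(\rho(f))\,T\,\chi_{(R,+\infty)}(\rho(f))=0$ for all self-adjoint $f$ in the unitization of $C_0(X)$ with $L_d(f)\le1$. Let $\mathcal{V}_R$ be the set of operators of spectral propagation $\le R$. Generalized Higson compactification: fix an approximate unit $(f_\alpha)$ of $C_0(X)$. $\overline{C_0(X)}^h$ is the set of $S\in\rho(C_b(X))=\mathcal{M}(C_0(X))$ such that for all $R>0$, $\varepsilon>0$ there is $\alpha_0$ such that for all $\alpha\ge\alpha_0$ and all $T\in\mathcal{V}_R$ with $\|T\|\le1$: $\|(1-\rho(f_\alpha))[T,S]\|\le\varepsilon$ and $\|[T,S](1-\rho(f_\alpha))\|\le\varepsilon$. Classical Higson compactification: for $f\in C_b(X)$ and $R>0$ let $\Delta_Rf(x)=\sup\{|f(x)-f(y)|:d(x,y)\le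 R\}$. $f$ is slowly oscillating if for all $R>0$, $\Delta_Rf(x)\to0$ as $x\to\infty$. $C_h(X)$ is the unital C*-subalgebra of $C_b(X)$ generated by the slowly oscillating functions. *)

(* Defs.v *)
(* Scalars are R[i] with R : realType.  B(H) and the algebras of functions on X are sets
   of plain functions H -> H and X -> R[i]; a map defined on such an algebra is a total
   function whose values outside it are irrelevant. *)
From HB Require Import structures.
From mathcomp Require Import all_boot all_order all_algebra.
From mathcomp Require Import sesquilinear complex.
From mathcomp Require Import all_classical all_reals all_analysis.

Set Implicit Arguments.
Unset Strict Implicit.
Unset Printing Implicit Defensive.

Import Order.TTheory GRing.Theory Num.Theory.
Import numFieldTopology.Exports numFieldNormedType.Exports.

Local Open Scope classical_set_scope.
Local Open Scope complex_scope.
Local Open Scope ring_scope.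

(* Norms of R[i] and of an R[i]-normed space take values in R[i]. *)
Notation normR v := (complex.Re `|v|).

Section FunctionAlgebras.
Context {R : realType} {X : metricType R}.
Implicit Types f g : X -> R[i].

Definition proper_metric : Prop :=
  forall (x : X) (r : R), compact [set y | mdist x y <= r].

(* For compact X this filter contains set0, and every limit along it holds. *)
Definition at_infinity : set_system X := filter_from compact (@setC X).

Definition C_b : set (X -> R[i]) :=
  [set f | continuous (f : X -> R[i]^o) /\ exists M : R, forall x, normR (f x) <= M].

Definition C_0 : set (X -> R[i]) :=
  [set f | continuous (f : X -> R[i]^o) /\ f x @[x --> at_infinity] --> (0 : R[i]^o)].

(* The unitization C_0(X) + C 1, inside C_b(X) = M(C_0(X)). *)
Definition unitization_C_0 : set (X -> R[i]) :=
  [set g | exists2 f, C_0 f & exists c : R[i], g = f \+ cst c].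

Definition self_adjoint_fun f : Prop := forall x, Num.conj (f x) = f x.

(* The supremum is taken in [0, +oo], whence the max with 0 when X has no two
   distinct points. *)
Definition lip_seminorm f : \bar R :=
  maxe 0%E (ereal_sup
    [set (normR (f p.1 - f p.2) / mdist p.1 p.2)%:E | p in [set p | p.1 <> p.2]]).

Definition oscillation (r : R) f (x : X) : R :=
  sup [set normR (f x - f y) | y in [set y | mdist x y <= r]].

Definition slowly_oscillating : set (X -> R[i]) :=
  [set f | C_b f /\
    forall r : R, 0 < r -> oscillation r f x @[x --> at_infinity] --> (0 : R)].

Record unital_Cstar_subalgebra (A : set (X -> R[i])) : Prop := {
  ucs_sub : A `<=` C_b;
  ucs_one : A (cst 1);
  ucs_add : forall f g, A f -> A g -> A (f \+ g);
  ucs_scale : forall (c : R[i]) f, A f -> A (fun x => c * f x);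
  ucs_mul : forall f g, A f -> A g -> A (f \* g);
  ucs_star : forall f, A f -> A (fun x => Num.conj (f x));
  ucs_closed : forall f, C_b f ->
    (forall e : R, 0 < e -> exists2 g, A g & forall x, normR (f x - g x) <= e) ->
    A f }.

Definition C_h : set (X -> R[i]) :=
  smallest unital_Cstar_subalgebra slowly_oscillating.

Record directed_preorder (I : Type) (le : I -> I -> Prop) : Prop := {
  directed_inhabited : exists i : I, True;
  directed_refl : forall i, le i i;
  directed_trans : forall i j k, le i j -> le j k -> le i k;
  directed_ub : forall i j, exists2 k, le i k & le j k }.

(* A net of positive elements of norm at most 1, not assumed to be increasing;
   the order of R[i] makes its nonnegative elements real. *)
Record approximate_unit (I : Type) (le : I -> I -> Prop) (u : I -> X -> R[i])
    : Prop := {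
  au_directed : directed_preorder le;
  au_C_0 : forall i, C_0 (u i);
  au_ge0 : forall i x, 0 <= u i x;
  au_le1 : forall i x, u i x <= 1;
  au_cvg : forall g, C_0 g -> forall e : R, 0 < e ->
    exists i0, forall i, le i0 i -> forall x, normR (u i x * g x - g x) <= e }.

End FunctionAlgebras.

Section Operators.
Context {R : realType} {H : completeNormedModType R[i]}.
Variable dot : {dot H for (@Num.conj R[i])}.
Implicit Types T S : H -> H.

Definition is_hilbert : Prop := forall u : H, `|u| ^+ 2 = dot u u.

Definition bounded_op : set (H -> H) :=
  [set T | linear T /\ exists M : R, forall u, normR (T u) <= M * normR u].

Definition opnorm T : R := sup [set normR (T u) | u in [set u : H | normR u <= 1]].

Definition op_commutator T S : H -> H := (T \o S) \- (S \o T).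

(* E is the projection-valued Borel measure of A: A is the integral of t dE(t), that
   is, <A u, u> is the integral of t against the measure B |-> <E(B) u, u>. *)
Record is_spectral_measure (A : H -> H) (E : set R -> H -> H) : Prop := {
  sm_bounded : forall B, measurable B -> bounded_op (E B);
  sm_self_adjoint : forall B u v, measurable B -> dot (E B u) v = dot u (E B v);
  sm_setT : E setT = id;
  sm_setI : forall B B', measurable B -> measurable B' ->
    E (B `&` B') = E B \o E B';
  sm_sigma_additive : forall F : nat -> set R, (forall n, measurable (F n)) ->
    trivIset setT F -> forall u : H,
    series (fun n => E (F n) u) @ \oo --> E (\bigcup_n F n) u;
  sm_integral : forall u : H, exists mu : {measure set (measurableTypeR R) -> \bar R},
    [/\ forall B, measurable B -> mu B = (complex.Re (dot (E B u) u))%:E,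
        mu.-integrable setT (fun t : R => t%:E) &
        dot (A u) u = (\int[mu]_(t in setT) (t : R))%:C] }.

(* chi_B(A) for a self-adjoint bounded A. *)
Definition spectral_projection (A : H -> H) (B : set R) : H -> H :=
  get (is_spectral_measure A) B.

End Operators.

Section Higson.
Context {R : realType} {X : metricType R} {H : completeNormedModType R[i]}.
Variable dot : {dot H for (@Num.conj R[i])}.
Variable rho : (X -> R[i]) -> H -> H.
Implicit Types f g : X -> R[i].

Record is_representation : Prop := {
  rep_bounded : forall f, C_0 f -> bounded_op (rho f);
  rep_add : forall f g, C_0 f -> C_0 g -> rho (f \+ g) = rho f \+ rho g;
  rep_scale : forall (c : R[i]) f, C_0 f ->
    rho (fun x => c * f x) = (fun u => c *: rho f u);
  rep_mul : forall f g, C_0 f -> C_0 g -> rho (f \* g) = rho f \o rho g;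
  rep_star : forall f, C_0 f -> forall u v,
    dot (rho (fun x => Num.conj (f x)) u) v = dot u (rho f v) }.

Definition faithful_rep : Prop :=
  forall f g, C_0 f -> C_0 g -> rho f = rho g -> f = g.

(* The linear span of rho(C_0(X)) H is dense in H. *)
Definition nondegenerate_rep : Prop :=
  closure [set v : H | exists (n : nat) (f : 'I_n -> X -> R[i]) (u : 'I_n -> H),
    (forall i, C_0 (f i)) /\ v = \sum_(i < n) rho (f i) (u i)] = setT.

(* The extension of rho to C_b(X) = M(C_0(X)): rho_ext g is the bounded operator S
   such that S rho(f) = rho(g f) for all f in C_0(X). *)
Definition rho_ext g : H -> H :=
  get [set S : H -> H | bounded_op S /\
    forall f, C_0 f -> S \o rho f = rho (g \* f)].

Definition spectral_propagation_le (r : R) : set (H -> H) :=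
  [set T | bounded_op T /\
    forall f, unitization_C_0 f -> self_adjoint_fun f -> (lip_seminorm f <= 1)%E ->
    spectral_projection dot (rho_ext f) `]-oo, 0] \o T \o
      spectral_projection dot (rho_ext f) `]r, +oo[ = cst 0].

Definition generalized_higson (I : Type) (le : I -> I -> Prop)
    (u : I -> X -> R[i]) : set (H -> H) :=
  [set S | (rho_ext @` C_b) S /\
    forall r e : R, 0 < r -> 0 < e -> exists i0 : I, forall i, le i0 i ->
    forall T, spectral_propagation_le r T -> opnorm T <= 1 ->
      opnorm ((id \- rho (u i)) \o op_commutator T S) <= e /\
      opnorm (op_commutator T S \o (id \- rho (u i))) <= e].

End Higson.

(* Main.v *)
(* The spectral projections of a real function h are strong limits of the continuous
   functional calculus of ramps.  They fix or annihilate vectors of the form [p u]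
   according to the values of h on the support of p.  Applied to the truncated distance
   to the support of p, this gives [p T q = 0] for T of propagation at most r, as soon
   as the supports of p and q are at distance at least r + 1.

   If g varies by at most d at scale r + 1 off a compact set, the tent functions of
   [g / d] form a partition of unity in which T is band-diagonal, so that the commutator
   [T, g] is of order d there.  The remaining compact part is absorbed by the approximate
   unit.  Conversely, if |g x - g y| > e with d(x, y) <= r and x far away, the
   rank-one operator from a bump at y to a bump at x has propagation at most r + 3, and
   its commutator with g is close to (g y - g x) times itself. *)

(* Write [Phi] for [rho_ext rho]. Propagation is stated through [spectral_projection], a choice
   among spectral measures, so it carries information only once [Phi h] is known to have one. As the
   functional calculus of [Phi h] is composition with [h], ramps of [h] give the projections of the
   half-lines []t, +oo[]; each vector then gets a Stieltjes measure, and a Dynkin argument extends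
   the projections to all Borel sets. All later facts use only the axioms of a spectral measure,
   whichever one was chosen.

   Supports are compared with spectral subspaces through growth rates, [alpha ^ n] against
   [beta ^ n], and this requires a strict gap. Gaps of one half on either side turn [r] into [r + 1]
   in the first direction; together with two bumps of radius 1 they turn it into [r + 3] in the
   converse.

   The band-diagonal estimate is a Schur test: row sums 6, halved by the inequality between
   arithmetic and geometric means, doubled by two vectors of norm at most 1, doubled again by real
   and imaginary parts. Hence the factor 12. *)
Require Import Defs.
From HB Require Import structures.
From mathcomp Require Import all_boot all_order all_algebra.
From mathcomp Require Import sesquilinear complex.
From mathcomp Require Import all_classical all_reals all_analysis.
From mathcomp Require Import measurable_realfun.
From mathcomp Require Import zify ring lra.

Set Implicit Arguments.
Unset Strict Implicit.
Unset Printing Implicit Defensive.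

Import Order.TTheory GRing.Theory Num.Theory.
Import numFieldTopology.Exports numFieldNormedType.Exports.

Local Open Scope classical_set_scope.
Local Open Scope complex_scope.
Local Open Scope ring_scope.

(** * Norms, operators and inner products *)

Section RealNorm.
Context {R : realType}.

Section Normed.
Context {V : normedZmodType R[i]}.
Implicit Types u v w : V.

Lemma normRE u : `|u| = (normR u)%:C.
Proof. by rewrite RRe_real// normr_real. Qed.

Lemma normR_ge0 u : 0 <= normR u.
Proof. by rewrite -ler0c -normRE normr_ge0. Qed.

Lemma normR0 : normR (0 : V) = 0.
Proof. by rewrite normr0. Qed.

Lemma normR0_eq0 u : normR u = 0 -> u = 0.
Proof. by move=> h; apply/eqP; rewrite -normr_eq0 normRE h. Qed.

Lemma normRN u : normR (- u) = normR u.
Proof. by rewrite normrN. Qed.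

Lemma normRD u v : normR (u + v) <= normR u + normR v.
Proof. by rewrite -lecR rmorphD/= -!normRE ler_normD. Qed.

Lemma normRB u v : normR (u - v) <= normR u + normR v.
Proof. by rewrite -(normRN v) normRD. Qed.

Lemma normRBC u v : normR (u - v) = normR (v - u).
Proof. by rewrite distrC. Qed.

Lemma normR_triangle v u w : normR (u - w) <= normR (u - v) + normR (v - w).
Proof. by rewrite -(subrKA v u (- w)) normRD. Qed.

Lemma normR_sub_ge u v : normR u - normR v <= normR (u - v).
Proof. by rewrite lerBlDr -{1}(subrK v u) normRD. Qed.

End Normed.

Lemma normRM (a b : R[i]) : normR (a * b) = normR a * normR b.
Proof. by apply: complexI; rewrite rmorphM -!normRE normrM. Qed.

Lemma normRC (r : R) : normR (r%:C) = `|r|.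
Proof.
have [r0|r0] := leP 0 r.
  by rewrite [`|r%:C|]ger0_norm ?ler0c// ger0_norm.
by rewrite [`|r%:C|]ltr0_norm ?ltcR// ltr0_norm.
Qed.

Lemma normR_conj (a : R[i]) : normR (Num.conj a) = normR a.
Proof. by rewrite norm_conjC. Qed.

Lemma normR1 : normR (1 : R[i]) = 1.
Proof. by rewrite normr1. Qed.

Lemma normRZ (V : normedModType R[i]) (c : R[i]) (u : V) :
  normR (c *: u) = normR c * normR u.
Proof. by rewrite normrZ (normRE c) (normRE u) -rmorphM. Qed.

Lemma Re_le_normR (a : R[i]) : `|complex.Re a| <= normR a.
Proof. by rewrite -lecR -normRE normc_ge_Re. Qed.

Lemma conj_mul_normR (a : R[i]) : a * Num.conj a = (normR a ^+ 2)%:C.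
Proof. by rewrite -normCK normRE rmorphXn. Qed.

(** Convergence quantifies over positive elements of [R[i]]; these are real, so real tolerances
    suffice. *)
Lemma normR_cvgP (V : normedModType R[i]) (F : set_system nat) {FF : Filter F}
    (s : nat -> V) (l : V) :
  (s @ F --> l) <-> forall e : R, 0 < e -> \forall n \near F, normR (l - s n) <= e.
Proof.
split=> [/cvgrPdist_le h e e0|h].
  by have := h e%:C; rewrite ltcR => /(_ e0); apply: filterS => n;
    rewrite normRE lecR.
apply/cvgrPdist_le => e e0.
have eE : e = (complex.Re e)%:C by rewrite RRe_real// gtr0_real.
move: e0; rewrite eE ltcR => /h; apply: filterS => n.
by rewrite [in X in _ -> X]normRE lecR.
Qed.

Lemma normR_cauchy_cvg (V : completeNormedModType R[i]) (s : nat -> V) :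
  (forall e : R, 0 < e -> exists N, forall n m, (N <= n)%N -> (N <= m)%N ->
     normR (s n - s m) <= e) -> cvg (s @ \oo).
Proof.
move=> h; apply/cauchy_cvgP/cauchy_ballP => e e0.
have eE : e = (complex.Re e)%:C by rewrite RRe_real// gtr0_real.
have e'0 : 0 < complex.Re e / 2 by rewrite divr_gt0// -ltcR -eE.
have [N hN] := h _ e'0.
exists ([set s n | n in [set n | (N <= n)%N]],
        [set s n | n in [set n | (N <= n)%N]]).
  by split; exists N => // k /= Nk; exists k.
move=> [_ _] /= [[n nN <-] [m mN <-]]; rewrite -ball_normE/= eE normRE ltcR.
by rewrite (le_lt_trans (hN _ _ nN mN))// ltr_pdivrMr// mulr2n mulrDr mulr1 ltrDl
  -ltcR -eE.
Qed.

End RealNorm.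

Section LinearOperators.
Context {R : realType} {H : completeNormedModType R[i]}.
Implicit Types (T S : H -> H) (u v w : H).

Lemma linear_opD T u v : linear T -> T (u + v) = T u + T v.
Proof. by move=> lT; rewrite -(scale1r u) lT !scale1r. Qed.

Lemma linear_op0 T : linear T -> T 0 = 0.
Proof.
move=> lT; have := linear_opD 0 0 lT.
by rewrite addr0 => /eqP; rewrite -{1}(addr0 (T 0)) (inj_eq (addrI _)) => /eqP.
Qed.

Lemma linear_opZ T c u : linear T -> T (c *: u) = c *: T u.
Proof. by move=> lT; rewrite -(addr0 (c *: u)) lT linear_op0// addr0. Qed.

Lemma linear_opN T u : linear T -> T (- u) = - T u.
Proof. by move=> lT; rewrite -scaleN1r linear_opZ// scaleN1r. Qed.

Lemma linear_opB T u v : linear T -> T (u - v) = T u - T v.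
Proof. by move=> lT; rewrite linear_opD// linear_opN. Qed.

Lemma linear_op_sum T (I : Type) (r : seq I) (P : pred I) (F : I -> H) :
  linear T -> T (\sum_(i <- r | P i) F i) = \sum_(i <- r | P i) T (F i).
Proof.
move=> lT; elim/big_rec2 : _ => [|i x y Pi <-]; first exact: linear_op0.
by rewrite linear_opD.
Qed.

Lemma bounded_op_bound T : bounded_op T ->
  exists2 M, 0 <= M & forall u, normR (T u) <= M * normR u.
Proof.
move=> [_ [M hM]]; exists `|M| => // u.
by rewrite (le_trans (hM u))// ler_wpM2r ?normR_ge0 ?ler_norm.
Qed.

Lemma bounded_op_id : bounded_op (id : H -> H).
Proof. by split=> // ; exists 1 => u; rewrite mul1r. Qed.

Lemma bounded_op_comp T S : bounded_op T -> bounded_op S -> bounded_op (T \o S).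
Proof.
move=> bT bS; split=> [a u v|] /=; first by rewrite bS.1 bT.1.
have [M M0 hM] := bounded_op_bound bT; have [N N0 hN] := bounded_op_bound bS.
exists (M * N) => u /=; rewrite (le_trans (hM _))// -mulrA ler_wpM2l//.
Qed.

Lemma bounded_opD T S : bounded_op T -> bounded_op S -> bounded_op (T \+ S).
Proof.
move=> bT bS; split=> [a u v|] /=.
  by rewrite bS.1 bT.1 scalerDr addrACA.
have [M M0 hM] := bounded_op_bound bT; have [N N0 hN] := bounded_op_bound bS.
exists (M + N) => u /=; rewrite (le_trans (normRD _ _))// mulrDl lerD//.
Qed.

Lemma bounded_opZ (c : R[i]) T : bounded_op T -> bounded_op (fun u => c *: T u).
Proof.
move=> bT; split=> [a u v|] /=.
  by rewrite bT.1 scalerDr !scalerA mulrC.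
have [M M0 hM] := bounded_op_bound bT.
exists (normR c * M) => u /=; rewrite normRZ -mulrA ler_wpM2l ?normR_ge0//.
Qed.

Lemma bounded_opN T : bounded_op T -> bounded_op (\- T).
Proof.
move=> bT; rewrite (_ : \- T = fun u => (-1) *: T u); first exact: bounded_opZ.
by apply/funext => u; rewrite scaleN1r.
Qed.

Lemma bounded_opB T S : bounded_op T -> bounded_op S -> bounded_op (T \- S).
Proof. by move=> bT bS; apply: bounded_opD => //; exact: bounded_opN. Qed.

Lemma opnorm_has_sup T : bounded_op T ->
  has_sup [set normR (T u) | u in [set u : H | normR u <= 1]].
Proof.
move=> bT; have [M M0 hM] := bounded_op_bound bT; split.
  by exists (normR (T 0)); exists 0 => //=; rewrite normR0.
exists M => _ [u /= u1 <-]; rewrite (le_trans (hM u))//.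
by rewrite -[leRHS]mulr1 ler_wpM2l.
Qed.

Lemma opnorm_bound T u : bounded_op T -> normR (T u) <= opnorm T * normR u.
Proof.
move=> bT; have [u0|u0] := eqVneq (normR u) 0.
  by rewrite (normR0_eq0 u0) linear_op0 ?normR0 ?mulr0//; exact: bT.1.
have u_gt0 : 0 < normR u by rewrite lt_neqAle eq_sym u0 normR_ge0.
rewrite -ler_pdivrMr//; apply: ub_le_sup; first by have [] := opnorm_has_sup bT.
exists ((normR u)^-1%:C *: u) => /=.
  by rewrite normRZ normRC ger0_norm ?invr_ge0 ?normR_ge0// mulVf.
rewrite linear_opZ; last exact: bT.1.
by rewrite normRZ normRC ger0_norm ?invr_ge0 ?normR_ge0// mulrC.
Qed.

Lemma opnorm_le T (c : R) : (forall u, normR u <= 1 -> normR (T u) <= c) ->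
  opnorm T <= c.
Proof.
move=> h; apply: ge_sup; first by exists (normR (T 0)); exists 0 => //=; rewrite normR0.
by move=> _ [u /= u1 <-]; exact: h.
Qed.

End LinearOperators.

Section InnerProduct.
Context {R : realType} {H : completeNormedModType R[i]}.
Variable dot : {dot H for (@Num.conj R[i])}.
Hypothesis dotH : is_hilbert dot.
Implicit Types (T S : H -> H) (u v w : H).

(* The real inner product, for which self-adjointness of a complex linear operator
   means the same as for the complex one. *)
Definition ip u v : R := complex.Re (dot u v).

Lemma ipC u v : ip u v = ip v u.
Proof.
rewrite /ip (hermC dot) /= expr0 mul1r.
by case: (dot v u) => a b.
Qed.

Lemma ipDl u v w : ip (u + v) w = ip u w + ip v w.
Proof. by rewrite /ip linearDl raddfD. Qed.

Lemma ipDr u v w : ip w (u + v) = ip w u + ip w v.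
Proof. by rewrite ipC ipDl !(ipC w). Qed.

Lemma ipNl u w : ip (- u) w = - ip u w.
Proof. by rewrite /ip linearNl raddfN. Qed.

Lemma ipNr u w : ip w (- u) = - ip w u.
Proof. by rewrite ipC ipNl ipC. Qed.

Lemma ipBl u v w : ip (u - v) w = ip u w - ip v w.
Proof. by rewrite ipDl ipNl. Qed.

Lemma ipBr u v w : ip w (u - v) = ip w u - ip w v.
Proof. by rewrite ipDr ipNr. Qed.

Lemma dotZl c u v : dot (c *: u) v = c * dot u v.
Proof. by rewrite linearZl_LR. Qed.

Lemma ipZl (r : R) u v : ip (r%:C *: u) v = r * ip u v.
Proof. by rewrite /ip dotZl; case: (dot u v) => a b /=; rewrite mul0r subr0. Qed.

Lemma ipZr (r : R) u v : ip u (r%:C *: v) = r * ip u v.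
Proof. by rewrite ipC ipZl ipC. Qed.

Lemma ip0l u : ip 0 u = 0.
Proof. by rewrite /ip linear0l. Qed.

Lemma ip0r u : ip u 0 = 0.
Proof. by rewrite ipC ip0l. Qed.

Lemma ip_norm u : ip u u = normR u ^+ 2.
Proof. by rewrite /ip -dotH normRE -rmorphXn. Qed.

Lemma ip_ge0 u : 0 <= ip u u.
Proof. by rewrite ip_norm sqr_ge0. Qed.

Lemma ip_eq0 u : ip u u = 0 -> u = 0.
Proof. by rewrite ip_norm => /eqP; rewrite sqrf_eq0 => /eqP; exact: normR0_eq0. Qed.

Lemma ip_ext u v : (forall w, ip u w = ip v w) -> u = v.
Proof.
move=> h; apply/eqP; rewrite -subr_eq0; apply/eqP/ip_eq0.
by rewrite ipBl h subrr.
Qed.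

Lemma ip_suml (I : Type) (r : seq I) (P : pred I) (F : I -> H) v :
  ip (\sum_(i <- r | P i) F i) v = \sum_(i <- r | P i) ip (F i) v.
Proof.
elim/big_rec2 : _ => [|i x y Pi <-]; first exact: ip0l.
by rewrite ipDl.
Qed.

Lemma ip_sumr (I : Type) (r : seq I) (P : pred I) (F : I -> H) v :
  ip v (\sum_(i <- r | P i) F i) = \sum_(i <- r | P i) ip v (F i).
Proof. by rewrite ipC ip_suml; apply: eq_bigr => i _; rewrite ipC. Qed.

Lemma sqr_normRD u v : normR (u + v) ^+ 2 = normR u ^+ 2 + 2 * ip u v + normR v ^+ 2.
Proof. by rewrite -!ip_norm !(ipDl, ipDr) (ipC v u); ring. Qed.

Lemma sqr_normRB u v : normR (u - v) ^+ 2 = normR u ^+ 2 - 2 * ip u v + normR v ^+ 2.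
Proof. by rewrite sqr_normRD ipNr normRN; ring. Qed.

Lemma ip_le_norm u v : `|ip u v| <= normR u * normR v.
Proof.
wlog : u / 0 <= ip u v => [hw|uv0].
  have [|uv0] := leP 0 (ip u v); first exact: hw.
  by rewrite -(normrN (ip u v)) -ipNl -(normRN u) hw// ipNl oppr_ge0 ltW.
rewrite ger0_norm//.
have [v0|v0] := eqVneq (normR v) 0.
  by rewrite (normR0_eq0 v0) ip0r mulr_ge0 ?normR_ge0.
have v_gt0 : 0 < normR v by rewrite lt_neqAle eq_sym v0 normR_ge0.
(* Expanded, this is [2 |u| |v| (|u| |v| - <u, v>) >= 0]. *)
have := ip_ge0 ((normR v)%:C *: u - (normR u)%:C *: v).
rewrite !(ipBl, ipBr) !ipZl !ipZr !ip_norm (ipC v u) => h.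
have [u0|u0] := eqVneq (normR u) 0.
  by rewrite (normR0_eq0 u0) ip0l mulr_ge0 ?normR_ge0.
have u_gt0 : 0 < normR u by rewrite lt_neqAle eq_sym u0 normR_ge0.
have uv_gt0 : 0 < normR u * normR v by rewrite mulr_gt0.
rewrite -(ler_pM2l uv_gt0).
by nra.
Qed.

(** Multiplying [u] by the conjugate of [dot u v] makes the inner product real, equal to
    [|dot u v| ^ 2]; the real Cauchy-Schwarz inequality then applies. *)
Lemma dot_le_norm u v : normR (dot u v) <= normR u * normR v.
Proof.
have [d0|d0] := eqVneq (normR (dot u v)) 0.
  by rewrite d0 mulr_ge0 ?normR_ge0.
have d_gt0 : 0 < normR (dot u v) by rewrite lt_neqAle eq_sym d0 normR_ge0.
have := ip_le_norm (Num.conj (dot u v) *: u) v.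
rewrite /ip dotZl mulrC conj_mul_normR/= normRZ normR_conj -mulrA.
by rewrite ger0_norm ?sqr_ge0// expr2 ler_pM2l.
Qed.

(** The imaginary part of [dot u v] is the real part of [dot (- 'i *: u) v]. Real adjointness of a
    complex linear map thus gives complex adjointness. *)
Lemma dotE u v : dot u v = (ip u v) +i* (ip (- 'i *: u) v).
Proof.
rewrite /ip dotZl; case: (dot u v) => a b.
by rewrite -complexiE mulNr /=; congr (_ +i* _); rewrite ?mul0r; ring.
Qed.

Lemma ip_adjoint T S : linear T -> (forall u v, ip (T u) v = ip u (S v)) ->
  forall u v, dot (T u) v = dot u (S v).
Proof.
by move=> lT h u v; rewrite !dotE h -linear_opZ// h.
Qed.

Lemma cvg_ip (F : set_system nat) {FF : ProperFilter F} (s : nat -> H) l v :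
  s @ F --> l -> (fun n => ip (s n) v) @ F --> ip l v.
Proof.
move/normR_cvgP => h; apply/cvgrPdist_le => e e0.
have v0 : 0 < normR v + 1 by rewrite ltr_wpDl ?normR_ge0.
have /h : 0 < e / (normR v + 1) by rewrite divr_gt0.
apply: filterS => n hn; rewrite -ipBl (le_trans (ip_le_norm _ _))//.
rewrite (le_trans (ler_wpM2r (normR_ge0 _) hn))// -mulrA ger_pMr//.
by rewrite mulrC ler_pdivrMr// mul1r lerDl.
Qed.

Lemma cvg_normR (F : set_system nat) {FF : ProperFilter F} (s : nat -> H) l :
  s @ F --> l -> (fun n => normR (s n)) @ F --> normR l.
Proof.
move/normR_cvgP => h; apply/cvgrPdist_le => e /h; apply: filterS => n hn.
rewrite ler_norml; have := normR_sub_ge l (s n); have := normR_sub_ge (s n) l.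
by rewrite (normRBC (s n)); lra.
Qed.

End InnerProduct.

(** * Functions on a proper metric space *)

Section Functions.
Context {R : realType} {X : metricType R}.
Implicit Types (f g : X -> R[i]) (h k : X -> R) (x y : X) (K : set X).

Lemma near_mdistP x (P : X -> Prop) :
  (\forall y \near x, P y) <-> exists2 d : R, 0 < d & forall y, mdist x y < d -> P y.
Proof.
split=> [/nbhs_ballP[d /= d0 hd]|[d d0 hd]].
  by exists d => // y yd; apply: hd; rewrite ballEmdist.
by apply/nbhs_ballP; exists d => //= y; rewrite ballEmdist => /hd.
Qed.

Lemma continuousCP f : continuous (f : X -> R[i]^o) <->
  forall x (e : R), 0 < e -> \forall y \near x, normR (f x - f y) <= e.
Proof.
split=> [cf x e e0|hf x].
  have /cvgrPdist_le/(_ e%:C) := cf x; rewrite ltcR => /(_ e0).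
  by apply: filterS => y; rewrite normRE lecR.
apply/cvgrPdist_le => e e0.
have eE : e = (complex.Re e)%:C by rewrite RRe_real// gtr0_real.
move: e0; rewrite eE ltcR => /(hf x); apply: filterS => y.
by rewrite [in X in _ -> X]normRE lecR.
Qed.

Lemma continuousRP h : continuous h <->
  forall x (e : R), 0 < e -> \forall y \near x, `|h x - h y| <= e.
Proof.
split=> [cf x e e0|hf x]; first by have /cvgrPdist_le/(_ e e0) := cf x.
by apply/cvgrPdist_le => e e0; exact: hf.
Qed.

Lemma continuous_lip1 h : (forall x y, `|h x - h y| <= mdist x y) -> continuous h.
Proof.
move=> hh; apply/continuousRP => x e e0; apply/near_mdistP; exists e => // y xy.
by rewrite (le_trans (hh x y))// ltW.
Qed.

Lemma continuous_C h : continuous h -> continuous ((fun x => (h x)%:C) : X -> R[i]^o).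
Proof.
move/continuousRP => ch; apply/continuousCP => x e /(ch x); apply: filterS => y.
by rewrite -rmorphB normRC.
Qed.

Lemma continuous_normR f : continuous (f : X -> R[i]^o) ->
  continuous (fun x => normR (f x)).
Proof.
move/continuousCP => cf; apply/continuousRP => x e /(cf x); apply: filterS => y.
move=> xy; rewrite ler_norml; have := normR_sub_ge (f x) (f y).
by have := normR_sub_ge (f y) (f x); rewrite (normRBC (f y)); lra.
Qed.

Lemma continuous_Re f : continuous (f : X -> R[i]^o) ->
  continuous (fun x => complex.Re (f x)).
Proof.
move/continuousCP => cf; apply/continuousRP => x e /(cf x); apply: filterS => y.
by move=> xy; rewrite -raddfB (le_trans (Re_le_normR _)).
Qed.

Lemma C_b_real h : continuous h -> (exists M, forall x, `|h x| <= M) ->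
  C_b (fun x => (h x)%:C).
Proof.
move=> ch [M hM]; split; first exact: continuous_C.
by exists M => x; rewrite normRC.
Qed.

Lemma C_b_bound f : C_b f -> exists2 M, 0 <= M & forall x, normR (f x) <= M.
Proof.
move=> [_ [M hM]]; exists `|M| => // x.
by rewrite (le_trans (hM x))// ler_norm.
Qed.

Lemma C_b_cst (c : R[i]) : C_b (cst c : X -> R[i]).
Proof. by split; [exact: cst_continuous|exists (normR c)]. Qed.

Lemma C_bD f g : C_b f -> C_b g -> C_b (f \+ g).
Proof.
move=> bf bg; split=> [x|].
  by apply: cvgD; [exact: bf.1|exact: bg.1].
have [M _ hM] := C_b_bound bf; have [N _ hN] := C_b_bound bg.
by exists (M + N) => x; rewrite (le_trans (normRD _ _))// lerD.
Qed.

Lemma C_bM f g : C_b f -> C_b g -> C_b (f \* g).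
Proof.
move=> bf bg; split=> [x|].
  by apply: cvgM; [exact: bf.1|exact: bg.1].
have [M M0 hM] := C_b_bound bf; have [N _ hN] := C_b_bound bg.
by exists (M * N) => x; rewrite (normRM (f x)) ler_pM ?normR_ge0.
Qed.

Lemma C_bZ (c : R[i]) f : C_b f -> C_b (fun x => c * f x).
Proof. by move=> bf; apply: (C_bM (C_b_cst c) bf). Qed.

Lemma C_b_conj f : C_b f -> C_b (fun x => Num.conj (f x)).
Proof.
move=> bf; split; last first.
  by have [M _ hM] := C_b_bound bf; exists M => x; rewrite normR_conj.
apply/continuousCP => x e e0; have /continuousCP/(_ x e e0) := bf.1.
by apply: filterS => y xy; rewrite -rmorphB normR_conj.
Qed.

Lemma C_bB f g : C_b f -> C_b g -> C_b (f \- g).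
Proof.
move=> bf bg; rewrite (_ : f \- g = f \+ (fun x => (-1) * g x)).
  by apply: C_bD => //; exact: C_bZ.
by apply/funext => x /=; rewrite mulN1r.
Qed.

#[global] Instance at_infinity_filter : Filter (at_infinity (R := R) (X := X)).
Proof.
apply: filter_from_filter; first by exists set0; exact: compact0.
move=> A B cA cB; exists (A `|` B); first exact: compactU.
by rewrite setCU.
Qed.

Lemma at_infinityP (P : X -> Prop) : (\forall x \near at_infinity, P x) <->
  exists2 K, compact K & forall x, ~ K x -> P x.
Proof. by split=> -[K cK hK]; exists K. Qed.

Lemma C_0P f : C_0 f <-> continuous (f : X -> R[i]^o) /\
  forall e : R, 0 < e -> exists2 K, compact K & forall x, ~ K x -> normR (f x) <= e.
Proof.
split=> -[cf hf]; split=> //.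
  move=> e e0; apply/at_infinityP.
  have /cvgrPdist_le/(_ e%:C) := hf; rewrite ltcR => /(_ e0).
  by apply: filterS => y; rewrite sub0r normrN normRE lecR.
apply/cvgrPdist_le => e e0.
have eE : e = (complex.Re e)%:C by rewrite RRe_real// gtr0_real.
move: e0; rewrite eE ltcR => /hf/at_infinityP; apply: filterS => y.
by rewrite sub0r normrN [in X in _ -> X]normRE lecR.
Qed.

Lemma compact_image_bound K h : compact K -> continuous h ->
  exists M, forall x, K x -> `|h x| <= M.
Proof.
move=> cK ch; have : compact (h @` K).
  by apply: continuous_compact => //; exact: continuous_subspaceT.
move=> /(@compact_bounded R R^o)[M [_ hM]]; exists (M + 1) => x Kx.
by apply: (hM (M + 1)); rewrite ?ltrDl//; exists x.
Qed.

Lemma C_0_C_b f : C_0 f -> C_b f.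
Proof.
move=> /C_0P[cf h0]; split=> //; have [K cK hK] := h0 1 ltr01.
have [M hM] := compact_image_bound cK (continuous_normR cf).
exists (Num.max M 1) => x; have [Kx|nKx] := pselect (K x).
  by rewrite le_max (le_trans (ler_norm _) (hM x Kx)).
by rewrite le_max hK ?orbT.
Qed.

Lemma C_0D f g : C_0 f -> C_0 g -> C_0 (f \+ g).
Proof.
move=> f0 g0; apply/C_0P; split.
  by have [] := C_bD (C_0_C_b f0) (C_0_C_b g0).
move=> e e0; have e20 : 0 < e / 2 by rewrite divr_gt0.
have /C_0P[_ /(_ _ e20)[K cK hK]] := f0.
have /C_0P[_ /(_ _ e20)[L cL hL]] := g0.
exists (K `|` L); first exact: compactU.
move=> x /not_orP[nK nL]; rewrite (le_trans (normRD _ _))//.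
by rewrite (splitr e) lerD ?hK ?hL.
Qed.

Lemma C_0Ml f g : C_b f -> C_0 g -> C_0 (f \* g).
Proof.
move=> bf g0; apply/C_0P; split; first by have [] := C_bM bf (C_0_C_b g0).
move=> e e0; have [M M0 hM] := C_b_bound bf.
have e'0 : 0 < e / (M + 1) by rewrite divr_gt0// ltr_wpDl.
have /C_0P[_ /(_ _ e'0)[K cK hK]] := g0; exists K => // x /hK xe.
rewrite (normRM (f x)) (le_trans (ler_pM (normR_ge0 _) (normR_ge0 _) (hM x) xe))//.
by rewrite mulrCA ger_pMr// ler_pdivrMr ?ltr_wpDl// mul1r lerDl.
Qed.

Lemma C_0Z (c : R[i]) f : C_0 f -> C_0 (fun x => c * f x).
Proof. by move=> f0; apply: (C_0Ml (C_b_cst c) f0). Qed.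

Lemma C_0_conj f : C_0 f -> C_0 (fun x => Num.conj (f x)).
Proof.
move=> f0; apply/C_0P; split; first by have [] := C_b_conj (C_0_C_b f0).
have /C_0P[_ h] := f0 => e /h[K cK hK].
by exists K => // x /hK; rewrite normR_conj.
Qed.

Lemma C_00 : C_0 (cst 0 : X -> R[i]).
Proof.
apply/C_0P; split; first exact: cst_continuous.
by move=> e e0; exists set0; [exact: compact0|move=> x _; rewrite normR0 ltW].
Qed.

Lemma C_0B f g : C_0 f -> C_0 g -> C_0 (f \- g).
Proof.
move=> f0 g0; rewrite (_ : f \- g = f \+ (fun x => (-1) * g x)).
  by apply: C_0D => //; exact: C_0Z.
by apply/funext => x /=; rewrite mulN1r.
Qed.

Lemma compact_supp_C_0 f K : compact K -> continuous (f : X -> R[i]^o) ->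
  (forall x, ~ K x -> f x = 0) -> C_0 f.
Proof.
move=> cK cf hf; apply/C_0P; split=> // e e0; exists K => // x /hf ->.
by rewrite normR0 ltW.
Qed.

Lemma mdist_lip x y z : `|mdist x y - mdist x z| <= mdist y z.
Proof.
rewrite ler_norml; have := metric_triangle x y z; have := metric_triangle x z y.
by rewrite (metric_sym z); lra.
Qed.

(* The case distinction is there because X may be empty. *)
Definition base_dist : X -> R :=
  match pselect (exists x : X, True) with
  | left e => mdist (projT1 (cid e))
  | right _ => cst 0
  end.

Lemma base_dist_lip x y : `|base_dist x - base_dist y| <= mdist x y.
Proof.
rewrite /base_dist; case: pselect => [e|]; first exact: mdist_lip.
by move=> _ /=; rewrite subrr normr0 mdist_ge0.
Qed.

Lemma base_dist_le_mdist x y : base_dist y <= base_dist x + mdist x y.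
Proof.
have := base_dist_lip x y; rewrite ler_norml; lra.
Qed.

Lemma continuous_base_dist : continuous base_dist.
Proof. exact: continuous_lip1 base_dist_lip. Qed.

Lemma compact_base_dist K : compact K -> exists r, forall x, K x -> base_dist x <= r.
Proof.
move=> cK; have [M hM] := compact_image_bound cK continuous_base_dist.
by exists M => x Kx; rewrite (le_trans (ler_norm _)) ?hM.
Qed.

Definition clamp (a b t : R) : R := Num.max a (Num.min b t).

Definition cutoff (r : R) x : R := clamp 0 1 (r + 1 - base_dist x).

Lemma clamp_lip (a b s t : R) : `|clamp a b s - clamp a b t| <= `|s - t|.
Proof.
have := ler_norm (s - t); have := ler_norm (- (s - t)); rewrite normrN /clamp.
have [bs|bs] := leP b s; have [bt|bt] := leP b t.
- by rewrite subrr normr0.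
- have [ab|ab] := leP a b; have [at_|at_] := leP a t; rewrite ler_norml; lra.
- have [ab|ab] := leP a b; have [as_|as_] := leP a s; rewrite ler_norml; lra.
- have [at_|at_] := leP a t; have [as_|as_] := leP a s; rewrite ler_norml; lra.
Qed.

Lemma cutoff_lip r x y : `|cutoff r x - cutoff r y| <= mdist x y.
Proof.
rewrite (le_trans (clamp_lip _ _ _ _))// (le_trans _ (base_dist_lip x y))//.
by rewrite -normrN le_eqVlt; apply/orP; left; apply/eqP; congr `|_|; ring.
Qed.

Lemma cutoff_ge0 r x : 0 <= cutoff r x. Proof. by rewrite /cutoff /clamp le_max lexx. Qed.

Lemma cutoff_le1 r x : cutoff r x <= 1.
Proof. by rewrite /cutoff /clamp ge_max ler01/= ge_min lexx. Qed.

Lemma cutoff1 r x : base_dist x <= r -> cutoff r x = 1.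
Proof.
move=> xr; rewrite /cutoff /clamp /Num.max /Num.min; do ! case: ifP => //; lra.
Qed.

Lemma cutoff0 r x : r + 1 <= base_dist x -> cutoff r x = 0.
Proof.
move=> xr; rewrite /cutoff /clamp /Num.max /Num.min; do ! case: ifP => //; lra.
Qed.

Definition cutoffC (r : R) x : R[i] := (cutoff r x)%:C.

Lemma C_b_cutoffC r : C_b (cutoffC r).
Proof.
apply: C_b_real; first exact: continuous_lip1 (cutoff_lip r).
by exists 1 => x; rewrite ger0_norm ?cutoff_ge0 ?cutoff_le1.
Qed.

Definition toC h : X -> R[i] := fun x => (h x)%:C.

Definition bounded_cont h := continuous h /\ exists M, forall x, `|h x| <= M.

Lemma bounded_cont_C_b h : bounded_cont h -> C_b (toC h).
Proof. by move=> [? ?]; exact: C_b_real. Qed.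

Lemma bounded_cont_cst (c : R) : bounded_cont (cst c).
Proof. by split; [exact: cst_continuous|exists `|c|]. Qed.

Lemma bounded_contD h k : bounded_cont h -> bounded_cont k -> bounded_cont (h \+ k).
Proof.
move=> [ch [M hM]] [ck [N kN]]; split=> [x|]; first by apply: cvgD; [exact: ch|exact: ck].
by exists (M + N) => x; rewrite (le_trans (ler_normD _ _))// lerD.
Qed.

Lemma bounded_contM h k : bounded_cont h -> bounded_cont k -> bounded_cont (h \* k).
Proof.
move=> [ch [M hM]] [ck [N kN]]; split=> [x|]; first by apply: cvgM; [exact: ch|exact: ck].
by exists (M * N) => x; rewrite normrM ler_pM.
Qed.

Lemma bounded_contB h k : bounded_cont h -> bounded_cont k -> bounded_cont (h \- k).
Proof.
move=> [ch [M hM]] [ck [N kN]]; split=> [x|]; first by apply: cvgB; [exact: ch|exact: ck].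
by exists (M + N) => x; rewrite (le_trans (ler_normB _ _))// lerD.
Qed.

Lemma bounded_cont_lip (F : R -> R) (c : R) h : 0 <= c ->
  (forall s t, `|F s - F t| <= c * `|s - t|) -> bounded_cont h ->
  bounded_cont (fun x => F (h x)).
Proof.
move=> c0 lF [ch [M hM]]; split.
  apply/continuousRP => x e e0; have e'0 : 0 < e / (c + 1) by rewrite divr_gt0// ltr_wpDl.
  have /continuousRP/(_ x _ e'0) := ch; apply: filterS => y xy.
  rewrite (le_trans (lF _ _))// (le_trans (ler_wpM2l c0 xy))//.
  by rewrite mulrCA ger_pMr// ler_pdivrMr ?ltr_wpDl// mul1r lerDl.
exists (`|F 0| + c * M) => x; rewrite -[F (h x)](subrK (F 0)) addrC.
rewrite (le_trans (ler_normD _ _))// lerD// (le_trans (lF _ _))// subr0.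
by rewrite ler_wpM2l.
Qed.

Lemma bounded_cont_sqrt h : bounded_cont h -> bounded_cont (fun x => Num.sqrt (h x)).
Proof.
move=> [ch [M hM]]; split.
  move=> x; apply: (@continuous_comp _ _ _ h Num.sqrt); first exact: ch.
  exact: sqrt_continuous.
exists (Num.sqrt M) => x; rewrite ger0_norm ?sqrtr_ge0//.
by apply: ler_wsqrtr; rewrite (le_trans (ler_norm _)).
Qed.

Lemma bounded_cont_normR f : C_b f -> bounded_cont (fun x => normR (f x)).
Proof.
move=> bf; split; first exact: continuous_normR bf.1.
by have [M M0 hM] := C_b_bound bf; exists M => x; rewrite ger0_norm ?normR_ge0.
Qed.

Lemma bounded_cont_Re f : C_b f -> bounded_cont (fun x => complex.Re (f x)).
Proof.
move=> bf; split; first exact: continuous_Re bf.1.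
by have [M M0 hM] := C_b_bound bf; exists M => x; rewrite (le_trans (Re_le_normR _)).
Qed.

Section Proper.
Hypothesis properX : proper_metric (X := X).

Lemma base_dist_compact r : compact [set x : X | base_dist x <= r].
Proof.
rewrite /base_dist; case: pselect => [e|noX] /=; first exact: properX.
rewrite (_ : [set _ | _] = set0); first exact: compact0.
by apply/seteqP; split => // x _; apply: noX; exists x.
Qed.

Lemma C_0_cutoffC r : C_0 (cutoffC r).
Proof.
have cr : compact [set x : X | base_dist x <= r + 1] by exact: base_dist_compact.
have [cb _] := C_b_cutoffC r.
apply: (compact_supp_C_0 cr cb) => x /negP; rewrite -ltNge => /ltW xr; by rewrite /cutoffC cutoff0.
Qed.

Lemma C_0_base_dist f : C_0 f -> forall e : R, 0 < e ->
  exists r, forall x, r < base_dist x -> normR (f x) <= e.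
Proof.
move=> /C_0P[_ h0] e /h0[K cK hK]; have [r hr] := compact_base_dist cK.
exists r => x rx; apply: hK => /hr; by rewrite leNgt rx.
Qed.

Lemma cutoffC_approx f : C_0 f -> forall e : R, 0 < e -> exists r0, forall r, r0 <= r ->
  forall x, normR (cutoffC r x * f x - f x) <= e.
Proof.
move=> f0 e e0; have [r0 hr0] := C_0_base_dist f0 e0; exists r0 => r r0r x.
rewrite -[X in _ - X]mul1r -mulrBl normRM.
have [xr|xr] := leP (base_dist x) r.
  by rewrite /cutoffC cutoff1// subrr normR0 mul0r ltW.
rewrite -[leRHS]mul1r ler_pM ?normR_ge0//; last by rewrite hr0// (le_lt_trans r0r).
rewrite -(rmorph1 (real_complex R)) /cutoffC -rmorphB normRC.
by rewrite ler_norml; have := cutoff_ge0 r x; have := cutoff_le1 r x; lra.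
Qed.

End Proper.
End Functions.

(** * The functional calculus of the extended representation *)

Section Representation.
Context {R : realType} {X : metricType R} {H : completeNormedModType R[i]}.
Variable dot : {dot H for (@Num.conj R[i])}.
Variable rho : (X -> R[i]) -> H -> H.
Hypothesis dotH : is_hilbert dot.
Hypothesis properX : proper_metric (X := X).
Hypothesis rho_rep : is_representation dot rho.
Hypothesis rho_nondeg : nondegenerate_rep rho.
Implicit Types (f g p q : X -> R[i]) (h k : X -> R) (u v w : H).
Local Notation ip := (ip dot).

Lemma rho_linear f : C_0 f -> linear (rho f).
Proof. by move=> /(rep_bounded rho_rep)[]. Qed.

Lemma rhoD f g u : C_0 f -> C_0 g -> rho (f \+ g) u = rho f u + rho g u.
Proof. by move=> f0 g0; rewrite (rep_add rho_rep). Qed.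

Lemma rhoZ (c : R[i]) f u : C_0 f -> rho (fun x => c * f x) u = c *: rho f u.
Proof. by move=> f0; rewrite (rep_scale rho_rep). Qed.

Lemma rhoM f g u : C_0 f -> C_0 g -> rho (f \* g) u = rho f (rho g u).
Proof. by move=> f0 g0; rewrite (rep_mul rho_rep). Qed.

Lemma rhoB f g u : C_0 f -> C_0 g -> rho (f \- g) u = rho f u - rho g u.
Proof.
move=> f0 g0; rewrite (_ : f \- g = f \+ (fun x => (-1) * g x)); last first.
  by apply/funext => x /=; rewrite mulN1r.
by rewrite rhoD ?rhoZ ?scaleN1r//; exact: C_0Z.
Qed.

Lemma rho0 u : rho (cst 0) u = 0.
Proof.
rewrite (_ : cst 0 = fun x => 0 * (cst 0 : X -> R[i]) x).
  by rewrite rhoZ ?scale0r//; exact: C_00.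
by apply/funext => x; rewrite mul0r.
Qed.

Lemma rho_ip f u v : C_0 f ->
  ip (rho f u) v = ip u (rho (fun x => Num.conj (f x)) v).
Proof.
move=> f0; rewrite /ip -(rep_star rho_rep)//; last exact: C_0_conj.
by congr (complex.Re (dot (rho _ u) v)); apply/funext => x; rewrite conjCK.
Qed.

Let sqr_rho f u : C_0 f ->
  normR (rho f u) ^+ 2 = ip (rho (toC (fun x => normR (f x) ^+ 2)) u) u.
Proof.
move=> f0; rewrite -(ip_norm dotH) rho_ip// -rhoM//; last exact: C_0_conj.
rewrite (ipC dot u); congr (ip (rho _ u) u); apply/funext => x.
by rewrite /toC -conj_mul_normR mulrC.
Qed.

(* [k = 1 - sqrt (1 - |f|^2)] lies in C_0 and [(1 - k)^2 = 1 - |f|^2], whence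
   [|u|^2 - |rho f u|^2 = |u - rho k u|^2]. *)
Let rho_contractive1 f u : C_0 f -> (forall x, normR (f x) <= 1) ->
  normR (rho f u) <= normR u.
Proof.
move=> f0 f1; pose k x := 1 - Num.sqrt (1 - normR (f x) ^+ 2).
have f2_le1 x : 0 <= 1 - normR (f x) ^+ 2.
  by rewrite subr_ge0 expr_le1 ?normR_ge0.
have k_ge0 x : 0 <= k x.
  rewrite subr_ge0 -[leRHS]sqrtr1 ler_wsqrtr// gerBl sqr_ge0//.
(* [1 - |f| = sqrt ((1 - |f|) ^ 2) <= sqrt (1 - |f| ^ 2)] because [0 <= |f| <= 1]. So [k] vanishes
   at infinity along with [f]. *)
have k_le x : k x <= normR (f x).
  rewrite lerBlDl -lerBlDr -[leLHS]ger0_norm ?subr_ge0// -sqrtr_sqr.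
  apply: ler_wsqrtr; have := normR_ge0 (f x); have := f1 x; nra.
have bk : bounded_cont k.
  apply: bounded_contB; first exact: bounded_cont_cst.
  apply: bounded_cont_sqrt; apply: bounded_contB; first exact: bounded_cont_cst.
  have bf := bounded_cont_normR (C_0_C_b f0).
  exact: (bounded_contM bf bf).
have k0 : C_0 (toC k).
  apply/C_0P; split; first by have [] := bounded_cont_C_b bk.
  move=> e e0; have /C_0P[_ /(_ e e0)[K cK hK]] := f0; exists K => // x /hK fx.
  by rewrite normRC ger0_norm// (le_trans (k_le x)).
have f20 : C_0 (toC (fun x => normR (f x) ^+ 2)).
  rewrite (_ : toC _ = f \* (fun x => Num.conj (f x))).
    by apply: C_0Ml; [exact: C_0_C_b|exact: C_0_conj].
  by apply/funext => x; rewrite /= conj_mul_normR.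
have kk : toC (fun x => normR (toC k x) ^+ 2) =
    (fun x => 2%:R%:C * toC k x) \- toC (fun x => normR (f x) ^+ 2).
  apply/funext => x; rewrite {1}/toC normRC (ger0_norm (k_ge0 x)).
  rewrite [RHS](_ : _ = (2 * k x - normR (f x) ^+ 2)%:C); last first.
    by rewrite rmorphB rmorphM.
  congr (_%:C); rewrite /k; set s := Num.sqrt _.
  have : s ^+ 2 = 1 - normR (f x) ^+ 2 by rewrite sqr_sqrtr.
  by move=> hs; rewrite sqrrB hs; ring.
rewrite -ler_sqr ?nnegrE ?normR_ge0//.
have := sqr_ge0 (normR (u - rho (toC k) u)).
rewrite (sqr_normRB dotH) sqr_rho// kk rhoB ?rhoZ//; last exact: C_0Z.
by rewrite ipBl ipZl -sqr_rho// (ipC _ u); lra.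
Qed.

Lemma rho_contractive f (M : R) u : C_0 f -> 0 <= M ->
  (forall x, normR (f x) <= M) -> normR (rho f u) <= M * normR u.
Proof.
move=> f0 M0 hM; have [M_eq0|Mn0] := eqVneq M 0.
  rewrite (_ : f = cst 0) ?rho0 ?normR0 ?mulr_ge0 ?normR_ge0//.
  apply/funext => x; apply: normR0_eq0; apply/eqP.
  by rewrite eq_le normR_ge0 andbT -M_eq0 hM.
have M_gt0 : 0 < M by rewrite lt_neqAle eq_sym Mn0.
have g0 : C_0 (fun x => M^-1%:C * f x) by exact: C_0Z.
have := @rho_contractive1 _ u g0.
rewrite rhoZ// normRZ normRC ger0_norm ?invr_ge0// ler_pdivrMl//; apply=> x.
by rewrite normRM normRC ger0_norm ?invr_ge0// ler_pdivrMl// mulr1.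
Qed.

Lemma nondegenerate_approx u (e : R) : 0 < e ->
  exists (n : nat) (f : 'I_n -> X -> R[i]) (v : 'I_n -> H),
    (forall i, C_0 (f i)) /\ normR (u - \sum_(i < n) rho (f i) (v i)) <= e.
Proof.
move=> e0; have : [set: H] u by [].
rewrite -rho_nondeg => /(_ (ball u e%:C)); case.
  by apply: nbhsx_ballx; rewrite ltcR.
move=> _ [[n [f [v [f0 ->]]]]]; rewrite -ball_normE /= normRE ltcR => /ltW ue.
by exists n, f, v.
Qed.

(** Density of the span of the vectors [rho f u], as an induction principle; the last premise says
    that [P] is closed. *)
Lemma nondegenerate_ind (P : H -> Prop) : P 0 ->
  (forall u v, P u -> P v -> P (u + v)) ->
  (forall f u, C_0 f -> P (rho f u)) ->
  (forall u, (forall e : R, 0 < e -> exists2 v, P v & normR (u - v) <= e) -> P u) ->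
  forall u, P u.
Proof.
move=> P0 PD Prho Pcl u; apply: Pcl => e /(nondegenerate_approx u)[n [f [v [f0 h]]]].
exists (\sum_(i < n) rho (f i) (v i)) => //.
by elim/big_ind : _ => // i _; exact: Prho.
Qed.

Lemma bounded_op_ext (T S : H -> H) : bounded_op T -> bounded_op S ->
  (forall f u, C_0 f -> T (rho f u) = S (rho f u)) -> T = S.
Proof.
move=> bT bS TS; have bD := bounded_opB bT bS.
have [M M0 hM] := bounded_op_bound bD; apply/funext.
apply: nondegenerate_ind => [|u v hu hv|f u /TS//|u hu].
- by rewrite !linear_op0//; [exact: bS.1|exact: bT.1].
- by rewrite !linear_opD ?hu ?hv//; [exact: bS.1|exact: bT.1].
apply/eqP; rewrite -subr_eq0; apply/eqP/normR0_eq0/eqP.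
rewrite eq_le normR_ge0 andbT; apply/ler_addgt0Pl => e e0; rewrite addr0.
have e'0 : 0 < e / (M + 1) by rewrite divr_gt0// ltr_wpDl.
have [v vE uv] := hu _ e'0.
have -> : T u - S u = (T \- S) (u - v).
  by rewrite (linear_opB _ _ bD.1) /= vE subrr subr0.
rewrite (le_trans (hM _))// (le_trans (ler_wpM2l M0 uv))//.
by rewrite mulrCA ger_pMr// ler_pdivrMr ?ltr_wpDl// mul1r lerDl.
Qed.

(** These elements of [C_0] are bounded by the same constant as [g] and converge to it strictly:
    [Phi g] is built as the strong limit of their images. *)
Let trunc g (n : nat) := g \* (cutoffC n%:R : X -> R[i]).

Let C_0_trunc g n : C_b g -> C_0 (trunc g n).
Proof. by move=> bg; apply: C_0Ml => //; exact: C_0_cutoffC. Qed.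

Let trunc_le g (M : R) n : (forall x, normR (g x) <= M) ->
  forall x, normR (trunc g n x) <= M.
Proof.
move=> hM x; rewrite (normRM (g x)) normRC (ger0_norm (cutoff_ge0 _ _)).
by rewrite (le_trans _ (hM x))// ler_piMr ?normR_ge0 ?cutoff_le1.
Qed.

(** The difference is the image of [g (chi f - f)] for a cutoff [chi], uniformly small because the
    cutoffs form an approximate unit. *)
Let trunc_cvg_rho g f u (e : R) : C_b g -> C_0 f -> 0 < e ->
  exists N, forall n, (N <= n)%N -> normR (rho (trunc g n) (rho f u) - rho (g \* f) u) <= e.
Proof.
move=> bg f0 e0; have [M M0 hM] := C_b_bound bg.
have u0 := normR_ge0 u; have Mu0 : 0 <= M * normR u by rewrite mulr_ge0.
have e'0 : 0 < e / (M * normR u + 1) by rewrite divr_gt0// ltr_wpDl.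
have [r0 hr0] := cutoffC_approx f0 e'0.
exists (Num.bound `|r0|) => n Nn.
have r0n : r0 <= n%:R.
  rewrite (le_trans (ler_norm _))// ltW// (lt_le_trans (archi_boundP (normr_ge0 _)))//.
  by rewrite ler_nat.
have gf0 := C_0Ml bg f0; have bb : C_b (cutoffC n%:R : X -> R[i]) by exact: C_b_cutoffC.
have d0 : C_0 ((cutoffC n%:R : X -> R[i]) \* f \- f) by apply: C_0B => //; exact: C_0Ml.
have tf0 : C_0 (trunc g n \* f) by apply: C_0Ml f0; apply: C_0_C_b; exact: C_0_trunc.
rewrite -(rhoM u (C_0_trunc n bg) f0) -(rhoB u tf0 gf0).
rewrite (_ : _ \- _ = g \* (((cutoffC n%:R : X -> R[i]) \* f) \- f)); last first.
  by apply/funext => x; rewrite /trunc/= -mulrA mulrBr.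
rewrite (le_trans (@rho_contractive _ (M * (e / (M * normR u + 1))) _ _ _ _))//.
- exact: C_0Ml.
- by rewrite mulr_ge0// ltW.
- move=> x; rewrite (normRM (g x)) ler_pM ?normR_ge0//.
  exact: hr0.
rewrite mulrAC mulrCA ger_pMr// ler_pdivrMr ?ltr_wpDl// mul1r; lra.
Qed.

Let trunc_cauchy g : C_b g -> forall u (e : R), 0 < e -> exists N,
  forall n m, (N <= n)%N -> (N <= m)%N ->
    normR (rho (trunc g n) u - rho (trunc g m) u) <= e.
Proof.
move=> bg; have [M M0 hM] := C_b_bound bg.
have lin n := rho_linear (C_0_trunc n bg).
apply: nondegenerate_ind => [e e0|u v hu hv e e0|f u f0 e e0|u hu e e0].
- by exists 0%N => n m _ _; rewrite !(linear_op0 (lin _)) subrr normR0 ltW.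
- have e20 : 0 < e / 2 by rewrite divr_gt0.
  have [N hN] := hu _ e20; have [N' hN'] := hv _ e20.
  exists (maxn N N') => n m; rewrite !geq_max => /andP[? ?] /andP[? ?].
  rewrite !(linear_opD _ _ (lin _)) opprD addrACA (le_trans (normRD _ _))//.
  by rewrite (splitr e) lerD ?hN ?hN'.
- have e20 : 0 < e / 2 by rewrite divr_gt0.
  have [N hN] := trunc_cvg_rho u bg f0 e20; exists N => n m Nn Nm.
  rewrite (le_trans (normR_triangle (rho (g \* f) u) _ _))// (splitr e) lerD ?hN//.
  by rewrite normRBC hN.
(* The bound [M] is the same for all truncations, so one approximation [v] of [u] serves every
   [n]. *)
- have e30 : 0 < e / 3 by rewrite divr_gt0.
  have e'0 : 0 < e / 3 / (M + 1) by rewrite divr_gt0// ltr_wpDl.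
  have [v hv uv] := hu _ e'0; have [N hN] := hv _ e30; exists N => n m Nn Nm.
  have close (k : nat) : normR (rho (trunc g k) u - rho (trunc g k) v) <= e / 3.
    rewrite -(linear_opB _ _ (lin k)).
    rewrite (le_trans (rho_contractive _ (C_0_trunc k bg) M0 (trunc_le k hM)))//.
    rewrite (le_trans (ler_wpM2l M0 uv))//.
    by rewrite mulrCA ger_pMr// ler_pdivrMr ?ltr_wpDl// mul1r lerDl.
  have := hN _ _ Nn Nm; have := close n; have := close m.
  have := normR_triangle (rho (trunc g n) v) (rho (trunc g n) u) (rho (trunc g m) u).
  have := normR_triangle (rho (trunc g m) v) (rho (trunc g n) v) (rho (trunc g m) u).
  rewrite (normRBC (rho (trunc g m) v)); lra.
Qed.

Local Notation Phi := (rho_ext rho).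

Let rho_ext_exists g : C_b g -> exists S : H -> H, bounded_op S /\
  forall f, C_0 f -> S \o rho f = rho (g \* f).
Proof.
move=> bg; have [M M0 hM] := C_b_bound bg.
have lin n := rho_linear (C_0_trunc n bg).
pose s u n := rho (trunc g n) u.
have cs u : s u @ \oo --> lim (s u @ \oo).
  by have := normR_cauchy_cvg (trunc_cauchy bg u).
have lim_eq u l : s u @ \oo --> l -> lim (s u @ \oo) = l.
  by move=> h; apply: cvg_lim => //; exact: norm_hausdorff.
exists (fun u => lim (s u @ \oo)); split; [split|].
- move=> a u v; apply: lim_eq.
  rewrite (_ : s _ = (fun n => a *: s u n) \+ s v).
    by apply: cvgD => //; exact: cvgZr.
  by apply/funext => n; rewrite /s lin.
- exists M => u; apply/ler_addgt0Pl => e e0.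
  have /normR_cvgP/(_ e e0)/filter_ex[n hn] := cs u.
  rewrite -(subrK (s u n) (lim _)) (le_trans (normRD _ _))// lerD//.
  exact: rho_contractive (C_0_trunc n bg) M0 (trunc_le n hM).
- move=> f f0; apply/funext => u /=; apply: lim_eq.
  apply/normR_cvgP => e e0; have [N hN] := trunc_cvg_rho u bg f0 e0.
  by exists N => // n /= Nn; rewrite normRBC hN.
Qed.

Lemma rho_ext_spec g : C_b g -> bounded_op (Phi g) /\
  forall f, C_0 f -> Phi g \o rho f = rho (g \* f).
Proof.
by move=> bg; rewrite /rho_ext; apply: (getPex (P := fun S : H -> H => bounded_op S /\ _));
  exact: rho_ext_exists.
Qed.

Lemma rho_ext_bounded g : C_b g -> bounded_op (Phi g).
Proof. by move=> /rho_ext_spec[]. Qed.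

Lemma rho_ext_rho g f u : C_b g -> C_0 f -> Phi g (rho f u) = rho (g \* f) u.
Proof. by move=> /rho_ext_spec[_ h] /h <-. Qed.

(** Source of the algebraic laws below: a candidate for [Phi g] need only be tested on the vectors
    [rho f u], where it reduces to an identity in [C_0]. *)
Lemma rho_ext_unique g (S : H -> H) : C_b g -> bounded_op S ->
  (forall f u, C_0 f -> S (rho f u) = rho (g \* f) u) -> Phi g = S.
Proof.
move=> bg bS hS; apply: bounded_op_ext => // [|f u f0].
  exact: rho_ext_bounded.
by rewrite rho_ext_rho// hS.
Qed.

Lemma rho_ext_C_0 f : C_0 f -> Phi f = rho f.
Proof.
move=> f0; apply: rho_ext_unique; [exact: C_0_C_b|exact: (rep_bounded rho_rep)|].
by move=> g u g0; rewrite rhoM.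
Qed.

Lemma rho_ext1 : Phi (cst 1) = id.
Proof.
apply: rho_ext_unique; [exact: C_b_cst|exact: bounded_op_id|].
by move=> f u f0; congr (rho _ u); apply/funext => x; rewrite /= mul1r.
Qed.

Lemma rho_extD g g' u : C_b g -> C_b g' -> Phi (g \+ g') u = Phi g u + Phi g' u.
Proof.
move=> bg bg'; rewrite (@rho_ext_unique _ (Phi g \+ Phi g'))//; first exact: C_bD.
  by apply: bounded_opD; exact: rho_ext_bounded.
move=> f v f0; rewrite /= !rho_ext_rho// -rhoD; try exact: C_0Ml.
by congr (rho _ v); apply/funext => x; rewrite /= mulrDl.
Qed.

Lemma rho_extM g g' u : C_b g -> C_b g' -> Phi (g \* g') u = Phi g (Phi g' u).
Proof.
move=> bg bg'; rewrite (@rho_ext_unique _ (Phi g \o Phi g'))//; first exact: C_bM.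
  by apply: bounded_op_comp; exact: rho_ext_bounded.
move=> f v f0; rewrite /= !rho_ext_rho//; last exact: C_0Ml.
by congr (rho _ v); apply/funext => x; rewrite /= mulrA.
Qed.

Lemma rho_extZ (c : R[i]) g u : C_b g -> Phi (fun x => c * g x) u = c *: Phi g u.
Proof.
move=> bg; rewrite (@rho_ext_unique _ (fun v => c *: Phi g v))//; first exact: C_bZ.
  by apply: bounded_opZ; exact: rho_ext_bounded.
move=> f v f0; rewrite rho_ext_rho// -rhoZ; last exact: C_0Ml.
by congr (rho _ v); apply/funext => x; rewrite /= mulrA.
Qed.

Lemma rho_extB g g' u : C_b g -> C_b g' -> Phi (g \- g') u = Phi g u - Phi g' u.
Proof.
move=> bg bg'; rewrite (_ : g \- g' = g \+ (fun x => (-1) * g' x)); last first.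
  by apply/funext => x /=; rewrite mulN1r.
by rewrite rho_extD ?rho_extZ ?scaleN1r//; exact: C_bZ.
Qed.

Lemma rho_ext_cst (c : R[i]) u : Phi (cst c) u = c *: u.
Proof.
rewrite (_ : cst c = fun x => c * (cst 1 : X -> R[i]) x).
  by rewrite rho_extZ ?rho_ext1//; exact: C_b_cst.
by apply/funext => x; rewrite mulr1.
Qed.

Lemma rho_ext_ip g u v : C_b g ->
  ip (Phi g u) v = ip u (Phi (fun x => Num.conj (g x)) v).
Proof.
move=> bg; have bg' := C_b_conj bg.
have bP := rho_ext_bounded bg; have bP' := rho_ext_bounded bg'.
(* A bounded additive functional with zeros arbitrarily close to [u] vanishes at [u]: the closure
   premise of [nondegenerate_ind], used once in each variable. *)
have closed (F : H -> R) : (forall u v, F (u - v) = F u - F v) ->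
    (exists2 M, 0 <= M & forall u, `|F u| <= M * normR u) ->
    forall u, (forall e : R, 0 < e -> exists2 v, F v = 0 & normR (u - v) <= e) -> F u = 0.
  move=> FB [M M0 hM] {}u hu; apply/eqP; rewrite -normr_eq0; apply/eqP/le_anti.
  rewrite normr_ge0 andbT; apply/ler_addgt0Pl => e e0; rewrite addr0.
  have e'0 : 0 < e / (M + 1) by rewrite divr_gt0// ltr_wpDl.
  have [w Fw uw] := hu _ e'0; rewrite -[F u]subr0 -Fw -FB (le_trans (hM _))//.
  rewrite (le_trans (ler_wpM2l M0 uw))//.
  by rewrite mulrCA ger_pMr// ler_pdivrMr ?ltr_wpDl// mul1r lerDl.
have [M M0 hM] := bounded_op_bound bP; have [N N0 hN] := bounded_op_bound bP'.
apply/eqP; rewrite -subr_eq0; apply/eqP.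
(* The failure of adjointness. It is biadditive and bounded, so it is enough to see that it vanishes
   on pairs [rho f a], [rho f' b]. *)
pose F u v := ip (Phi g u) v - ip u (Phi (fun x => Num.conj (g x)) v).
have FBl a b c : F (a - b) c = F a c - F b c.
  by rewrite /F (linear_opB _ _ bP.1) !ipBl; ring.
have FBr a b c : F c (a - b) = F c a - F c b.
  by rewrite /F (linear_opB _ _ bP'.1) !ipBr; ring.
have FDl a b c : F (a + b) c = F a c + F b c.
  by rewrite /F (linear_opD _ _ bP.1) !ipDl; ring.
have FDr a b c : F c (a + b) = F c a + F c b.
  by rewrite /F (linear_opD _ _ bP'.1) !ipDr; ring.
have Fle a b : `|F a b| <= (M + N) * (normR a * normR b).
  rewrite /F (le_trans (ler_normB _ _))// mulrDl lerD//.
    rewrite (le_trans (ip_le_norm dotH _ _))// mulrA.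
    by rewrite ler_wpM2r ?normR_ge0.
  rewrite (le_trans (ip_le_norm dotH _ _))// mulrCA.
  by rewrite ler_wpM2l ?normR_ge0.
have MN0 : 0 <= M + N by rewrite addr_ge0.
rewrite -/(F u v); move: u; apply: nondegenerate_ind => [|a b ha hb|f a f0|a].
- by have := FBl 0 0 v; rewrite !subrr.
- by rewrite FDl ha hb addr0.
- move: v; apply: nondegenerate_ind => [|b c hb hc|f' b f'0|b].
  + by have := FBr 0 0 (rho f a); rewrite !subrr.
  + by rewrite FDr hb hc addr0.
  + have gf0 := C_0Ml bg f0; have gf'0 := C_0Ml bg' f'0.
    rewrite /F (rho_ext_rho a bg f0) (rho_ext_rho b bg' f'0).
    rewrite (rho_ip _ _ gf0) (rho_ip _ _ f0).
    rewrite -(rhoM _ (C_0_conj gf0) f'0) -(rhoM _ (C_0_conj f0) gf'0).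
    apply/eqP; rewrite subr_eq0; apply/eqP; congr (ip a (rho _ b)).
    by apply/funext => x /=; rewrite rmorphM mulrCA mulrA.
  + apply: (closed (F (rho f a))) => //; exists ((M + N) * normR (rho f a)).
      by rewrite mulr_ge0 ?normR_ge0.
    by move=> c; rewrite -mulrA.
- apply: (closed (F ^~ v)) => //; exists ((M + N) * normR v).
    by rewrite mulr_ge0 ?normR_ge0.
  by move=> c; rewrite -mulrA (mulrC (normR v)).
Qed.

Lemma sqr_rho_ext q u : C_b q ->
  normR (Phi q u) ^+ 2 = ip (Phi (toC (fun x => normR (q x) ^+ 2)) u) u.
Proof.
move=> bq; rewrite -(ip_norm dotH) rho_ext_ip// -rho_extM//; last exact: C_b_conj.
rewrite (ipC dot u); congr (ip (Phi _ u) u); apply/funext => x.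
by rewrite /toC -conj_mul_normR mulrC.
Qed.

Lemma rho_ext_self_adjoint h u v : bounded_cont h ->
  ip (Phi (toC h) u) v = ip u (Phi (toC h) v).
Proof.
move=> bh; rewrite rho_ext_ip; last exact: bounded_cont_C_b.
congr (ip u (Phi _ v)); apply/funext => x; rewrite /toC.
by apply/CrealP; rewrite complex_real.
Qed.

Lemma rho_ext_ge0 h u : bounded_cont h -> (forall x, 0 <= h x) ->
  0 <= ip (Phi (toC h) u) u.
Proof.
move=> bh h0; rewrite (_ : toC h =
  toC (fun x => normR (toC (fun y => Num.sqrt (h y)) x) ^+ 2)).
  by rewrite -sqr_rho_ext ?sqr_ge0//; apply/bounded_cont_C_b/bounded_cont_sqrt.
by apply/funext => x; rewrite /toC normRC ger0_norm ?sqrtr_ge0// sqr_sqrtr.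
Qed.

Lemma toCD h k : toC (h \+ k) = toC h \+ toC k.
Proof. by apply/funext => x; rewrite /toC /= rmorphD. Qed.

Lemma toCB h k : toC (h \- k) = toC h \- toC k.
Proof. by apply/funext => x; rewrite /toC /= rmorphB. Qed.

Lemma toCM h k : toC (h \* k) = toC h \* toC k.
Proof. by apply/funext => x; rewrite /toC /= rmorphM. Qed.

Lemma rho_ext_le h k u : bounded_cont h -> bounded_cont k ->
  (forall x, h x <= k x) -> ip (Phi (toC h) u) u <= ip (Phi (toC k) u) u.
Proof.
move=> bh bk hk; rewrite -subr_ge0 -ipBl -rho_extB; try exact: bounded_cont_C_b.
rewrite -toCB; apply: rho_ext_ge0; first exact: bounded_contB.
by move=> x; rewrite subr_ge0.
Qed.

(** Pointwise [|g q| ^ 2 <= c ^ 2 |q| ^ 2], and [Phi] preserves order. Only the values of [g] on the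
    support of [q] matter, which is how supports enter the operator estimates. *)
Lemma rho_ext_local g q (c : R) u : C_b g -> C_b q -> 0 <= c ->
  (forall x, q x != 0 -> normR (g x) <= c) ->
  normR (Phi g (Phi q u)) <= c * normR (Phi q u).
Proof.
move=> bg bq c0 hc.
rewrite -ler_sqr ?nnegrE ?mulr_ge0 ?normR_ge0// exprMn -rho_extM//.
rewrite !sqr_rho_ext//; last exact: C_bM.
have bn p : C_b p -> bounded_cont (fun x => normR (p x) ^+ 2).
  by move=> /bounded_cont_normR bp; exact: (bounded_contM bp bp).
rewrite -(ipZl dot) -rho_extZ; last by apply: bounded_cont_C_b; exact: bn.
rewrite (_ : (fun x => _ * _) = toC (fun x => c ^+ 2 * normR (q x) ^+ 2)); last first.
  by apply/funext => x; rewrite /toC -rmorphM.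
apply: rho_ext_le; first by apply: bn; exact: C_bM.
  by apply: (bounded_contM (bounded_cont_cst _)); exact: bn.
move=> x; rewrite (normRM (g x)) exprMn.
have [->|q0] := eqVneq (q x) 0; first by rewrite normR0 expr0n/= !mulr0.
by rewrite ler_wpM2r ?sqr_ge0// ler_sqr ?nnegrE ?normR_ge0// hc.
Qed.

Lemma rho_ext_contractive g (c : R) u : C_b g -> 0 <= c ->
  (forall x, normR (g x) <= c) -> normR (Phi g u) <= c * normR u.
Proof.
move=> bg c0 hc; have := @rho_ext_local g (cst 1) c u bg (C_b_cst 1) c0.
by rewrite rho_ext1; apply.
Qed.

End Representation.

(** * Spectral measures and supports *)

Lemma integrable_cst_lty d (T : measurableType d) (R : realType)
  (mu : {measure set T -> \bar R}) (B : set T) (a : R) : measurable B ->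
  (mu B < +oo)%E -> mu.-integrable B (cst a%:E).
Proof.
move=> mB muB; apply/integrableP; split; first exact: measurable_cst.
rewrite (eq_integral (cst `|a|%:E)) ?integral_cst//.
by rewrite lte_mul_pinfty// lee_fin.
Qed.

Section SpectralMeasure.
Context {R : realType} {H : completeNormedModType R[i]}.
Variable dot : {dot H for (@Num.conj R[i])}.
Hypothesis dotH : is_hilbert dot.
Implicit Types (u v w : H) (B : set R).
Local Notation ip := (ip dot).

(* If [C >= alpha] on the range of a projection [P] commuting with [C], the iterates
   of [C] on [P xi] grow at least like [alpha ^ n]. *)
Lemma projection_eq0 (P C : H -> H) (alpha beta K : R) xi :
  bounded_op P -> linear C -> (forall u, P (P u) = P u) ->
  (forall u, C (P u) = P (C u)) ->
  (forall w, P w = w -> alpha * normR w ^+ 2 <= ip (C w) w) ->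
  0 <= beta -> beta < alpha ->
  (forall n, normR (iter n C xi) <= beta ^+ n * K) -> P xi = 0.
Proof.
move=> bP lC PP CP Clow beta0 ab hxi.
have [M M0 hM] := bounded_op_bound bP.
have alpha0 : 0 < alpha by exact: le_lt_trans ab.
(* By Cauchy-Schwarz, [Clow] yields [|C w| >= alpha |w|] on the range of [P], which [C] preserves.
   Against the upper bound [beta ^ n * K] this leaves [|P xi| <= M K (beta / alpha) ^ n] for all
   [n]. *)
have grow n : alpha ^+ n * normR (P xi) <= normR (iter n C (P xi)) /\
    iter n C (P xi) = P (iter n C xi).
  elim: n => [|n [IH1 IH2]] /=; first by rewrite expr0 mul1r.
  split; last by rewrite IH2 CP.
  set w := iter n C (P xi); have Pw : P w = w by rewrite /w IH2 PP.
  rewrite exprS -mulrA (le_trans (ler_wpM2l (ltW alpha0) IH1))// -/w.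
  have [w0|w0] := eqVneq (normR w) 0; first by rewrite w0 mulr0 normR_ge0.
  have w_gt0 : 0 < normR w by rewrite lt_neqAle eq_sym w0 normR_ge0.
  rewrite -(ler_pM2r w_gt0) -mulrA -expr2 (le_trans (Clow _ Pw))//.
  by rewrite (le_trans (ler_norm _))// ip_le_norm.
have K0 : 0 <= K.
  by have := hxi 0%N; rewrite expr0 mul1r /=; apply: le_trans; exact: normR_ge0.
have bound n : normR (P xi) <= (M * K) * (beta / alpha) ^+ n.
  rewrite expr_div_n mulrA ler_pdivlMr ?exprn_gt0// mulrC.
  have [g1 g2] := grow n; rewrite (le_trans g1)// g2 (le_trans (hM _))//.
  by rewrite -mulrA ler_wpM2l// (le_trans (hxi n))// mulrC.
apply: normR0_eq0; apply/eqP; rewrite eq_le normR_ge0 andbT.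
have : (fun n => (M * K) * (beta / alpha) ^+ n) @ \oo --> (M * K) * 0.
  apply: cvgMr; apply: cvg_expr.
  by rewrite ger0_norm ?ltr_pdivrMr ?mul1r// divr_ge0// ltW.
rewrite mulr0 => h; rewrite -(cvg_lim _ h)//.
apply: limr_ge; first by apply/cvg_ex; exists 0.
exact: nearW.
Qed.

Variables (A : H -> H) (E : set R -> H -> H).
Hypothesis bA : bounded_op A.
Hypothesis selfA : forall u v, ip (A u) v = ip u (A v).
Hypothesis smE : is_spectral_measure dot A E.

Lemma spectral_linear B : measurable B -> linear (E B).
Proof. by move=> /(sm_bounded smE)[]. Qed.

Lemma spectral_self_adjoint B u v : measurable B -> ip (E B u) v = ip u (E B v).
Proof. by move=> mB; rewrite /ip (sm_self_adjoint smE). Qed.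

Lemma spectral_idem B u : measurable B -> E B (E B u) = E B u.
Proof.
by move=> mB; rewrite -{3}(setIid B) (sm_setI smE).
Qed.

(** [E set0] is a self-adjoint idempotent, so [|E set0 u| ^ 2] is the measure of the empty set. *)
Lemma spectral_set0 u : E set0 u = 0.
Proof.
have [mu [hmu _ _]] := sm_integral smE u.
apply: (ip_eq0 dotH); rewrite spectral_self_adjoint// spectral_idem//.
by have := hmu set0 measurable0; rewrite measure0 ipC => -[].
Qed.

Lemma spectral_measureE u : exists mu : {measure set (measurableTypeR R) -> \bar R},
  [/\ forall B, measurable B -> mu B = (ip (E B u) u)%:E,
      mu setT = (normR u ^+ 2)%:E,
      mu.-integrable setT (fun t : R => t%:E) &
      (ip (A u) u)%:E = \int[mu]_t t%:E]%E.
Proof.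
have [mu [hmu imu qmu]] := sm_integral smE u; exists mu; split=> //.
  by rewrite hmu// (sm_setT smE) -(ip_norm dotH).
rewrite /ip qmu /=.
by rewrite /Rintegral fineK//; exact: integrable_fin_num.
Qed.

(** Each [E B'] commutes with [E B], so [E B' u] is orthogonal to [v] and the measure of [u + v] is
    the sum of those of [u] and [v]. Integrating [t] makes the quadratic form of [A] additive on
    this pair: the cross term vanishes. *)
Lemma spectral_form_orthogonal B u v : measurable B -> E B u = u -> E B v = 0 ->
  ip (A u) v = 0.
Proof.
move=> mB Bu Bv.
have [mu [hmu tmu imu qmu]] := spectral_measureE u.
have [nu [hnu tnu inu qnu]] := spectral_measureE v.
have [la [hla tla ila qla]] := spectral_measureE (u + v).
have lE (B' : set R) : measurable B' -> la B' = measure_add mu nu B'.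
  move=> mB'; rewrite measure_addE hla// hmu// hnu// -EFinD; congr (_%:E).
  have uv : ip (E B' u) v = 0.
    rewrite -Bu -[E B' (E B u)]/((E B' \o E B) u) -(sm_setI smE)// setIC (sm_setI smE)//.
    by rewrite /= spectral_self_adjoint// Bv ip0r.
  rewrite (linear_opD _ _ (spectral_linear mB')) !(ipDl, ipDr) uv.
  by rewrite (spectral_self_adjoint v)// (ipC _ v) uv; ring.
have := qla; rewrite (eq_measure_integral (measure_add mu nu)); last first.
  by move=> B' mB' _; exact: lE.
rewrite integral_measure_add// -qmu -qnu -EFinD => -[].
rewrite (linear_opD _ _ bA.1) !(ipDl, ipDr) (selfA v u) (ipC _ v); lra.
Qed.

(** By the orthogonality just shown, [A] preserves both the range and the kernel of [E B]. *)
Lemma spectral_commute B u : measurable B -> A (E B u) = E B (A u).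
Proof.
move=> mB; have lB := spectral_linear mB.
have EBsub w : E B (w - E B w) = 0 by rewrite linear_opB// spectral_idem// subrr.
have inv w : E B w = w -> E B (A w) = A w.
  move=> Bw; apply/esym/eqP; rewrite -subr_eq0; apply/eqP/(ip_eq0 dotH).
  rewrite {1}ipBl (spectral_form_orthogonal mB Bw (EBsub _)).
  by rewrite spectral_self_adjoint// EBsub ip0r subrr.
have ker w : E B w = 0 -> E B (A w) = 0.
  move=> Bw; apply: (ip_ext dotH) => z; rewrite ip0l spectral_self_adjoint// selfA ipC.
  by apply: (spectral_form_orthogonal mB) => //; exact: spectral_idem.
rewrite -[in RHS](subrK (E B u) u) (linear_opD _ _ bA.1) linear_opD// ker// add0r.
by rewrite inv// spectral_idem.
Qed.

(** The spectral measure of a vector in the range of [E B] is carried by [B], where the integrand is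
    at least [a]. *)
Lemma spectral_lower B (a : R) w : measurable B -> (forall t, B t -> a <= t) ->
  E B w = w -> a * normR w ^+ 2 <= ip (A w) w.
Proof.
move=> mB Ba Bw; have [mu [hmu tmu imu qmu]] := spectral_measureE w.
have mBc : measurable (~` B) by exact: measurableC.
have mu0 : mu (~` B) = 0%E.
  rewrite hmu// -Bw -[E _ (E B w)]/((E (~` B) \o E B) w) -(sm_setI smE)// setICl.
  by rewrite spectral_set0 ip0l.
have muB : mu B = (normR w ^+ 2)%:E by rewrite hmu// Bw (ip_norm dotH).
rewrite -lee_fin qmu (@negligible_integral _ _ _ mu setT (~` B))//=.
rewrite setDE setCK setTI EFinM -muB -integral_cst//; apply: le_integral => //.
- by apply: integrable_cst_lty => //; rewrite muB ltry.
- exact: integrableS imu.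
- by move=> t; rewrite inE => /Ba; rewrite lee_fin.
Qed.

Lemma spectral_upper B (a : R) w : measurable B -> (forall t, B t -> t <= a) ->
  E B w = w -> ip (A w) w <= a * normR w ^+ 2.
Proof.
move=> mB Ba Bw; have [mu [hmu tmu imu qmu]] := spectral_measureE w.
have mBc : measurable (~` B) by exact: measurableC.
have mu0 : mu (~` B) = 0%E.
  rewrite hmu// -Bw -[E _ (E B w)]/((E (~` B) \o E B) w) -(sm_setI smE)// setICl.
  by rewrite spectral_set0 ip0l.
have muB : mu B = (normR w ^+ 2)%:E by rewrite hmu// Bw (ip_norm dotH).
rewrite -lee_fin qmu (@negligible_integral _ _ _ mu setT (~` B))//=.
rewrite setDE setCK setTI EFinM -muB -integral_cst//; apply: le_integral => //.
- exact: integrableS imu.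
- by apply: integrable_cst_lty => //; rewrite muB ltry.
- by move=> t; rewrite inE => /Ba; rewrite lee_fin.
Qed.

End SpectralMeasure.

Section SpectralSupport.
Context {R : realType} {X : metricType R} {H : completeNormedModType R[i]}.
Variable dot : {dot H for (@Num.conj R[i])}.
Variable rho : (X -> R[i]) -> H -> H.
Hypothesis dotH : is_hilbert dot.
Hypothesis properX : proper_metric (X := X).
Hypothesis rho_rep : is_representation dot rho.
Hypothesis rho_nondeg : nondegenerate_rep rho.
Implicit Types (p : X -> R[i]) (h k : X -> R) (u v w : H).
Local Notation ip := (ip dot).
Local Notation Phi := (rho_ext rho).

Let bPhi g : C_b g -> bounded_op (Phi g).
Proof. exact: rho_ext_bounded dotH properX rho_rep rho_nondeg g. Qed.

Lemma rho_ext_iter_bound k p (c : R) u n : bounded_cont k -> C_b p -> 0 <= c ->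
  (forall x, p x != 0 -> `|k x| <= c) ->
  normR (iter n (Phi (toC k)) (Phi p u)) <= c ^+ n * normR (Phi p u).
Proof.
move=> bk bp c0 kc; have bk' := bounded_cont_C_b bk.
(* The strengthened claim keeps the iterate of the form [Phi q u] with [q] supported in the support
   of [p], so that [rho_ext_local] applies again at the next step. *)
suff [q [_ _ _]] : exists q, [/\ C_b q, forall x, q x != 0 -> p x != 0,
    iter n (Phi (toC k)) (Phi p u) = Phi q u &
    normR (iter n (Phi (toC k)) (Phi p u)) <= c ^+ n * normR (Phi p u)] by [].
elim: n => [|n [q [bq qp IH1 IH2]]]; first by exists p; split=> //; rewrite expr0 mul1r.
exists (toC k \* q); split.
- exact: C_bM.
- by move=> x; rewrite mulf_eq0 negb_or => /andP[_ /qp].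
- by rewrite iterS IH1 (rho_extM dotH properX rho_rep rho_nondeg).
- rewrite iterS IH1 exprS -mulrA (le_trans _ (ler_wpM2l c0 IH2))// IH1.
  apply: (rho_ext_local dotH properX rho_rep rho_nondeg) => // x /qp/kc.
  by rewrite normRC.
Qed.

Lemma rho_ext_shift h (s c : R) u : bounded_cont h ->
  Phi (toC (cst s \* h \+ cst c)) u = s%:C *: Phi (toC h) u + c%:C *: u.
Proof.
move=> bh; have bs := bounded_contM (bounded_cont_cst (X := X) s) bh.
have bh' := bounded_cont_C_b bh.
rewrite toCD (rho_extD dotH properX rho_rep rho_nondeg); last 2 first.
- exact: bounded_cont_C_b.
- by apply: bounded_cont_C_b; exact: bounded_cont_cst.
rewrite [toC (cst c)](_ : _ = cst c%:C)// (rho_ext_cst dotH properX rho_rep rho_nondeg).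
rewrite -(rho_extZ dotH properX rho_rep rho_nondeg)//; congr (Phi _ u + _).
by rewrite toCM.
Qed.

Variable (h : X -> R) (E : set R -> H -> H).
Hypothesis bh : bounded_cont h.
Hypothesis smE : is_spectral_measure dot (Phi (toC h)) E.

Let self u v : ip (Phi (toC h) u) v = ip u (Phi (toC h) v).
Proof. exact: rho_ext_self_adjoint. Qed.

Let bA : bounded_op (Phi (toC h)).
Proof. by apply: bPhi; exact: bounded_cont_C_b. Qed.

(** [projection_eq0] for [C = s A + c] with [A = Phi (toC h)]: the form of [C] is at least [alpha]
    on the range of [E B], whereas [C] acts with norm at most [beta] over the support of [p]. The
    sign [s] selects the half-line. *)
Let spectral_support (s c alpha beta : R) p (B : set R) u : measurable B -> C_b p ->
  (forall w, E B w = w -> alpha * normR w ^+ 2 <= s * ip (Phi (toC h) w) w + c * normR w ^+ 2) ->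
  0 <= beta -> beta < alpha -> (forall x, p x != 0 -> `|s * h x + c| <= beta) ->
  E B (Phi p u) = 0.
Proof.
move=> mB bp low beta0 ab hp; set k := cst s \* h \+ cst c.
have bk : bounded_cont k.
  apply: bounded_contD; last exact: bounded_cont_cst.
  exact: (bounded_contM (bounded_cont_cst s) bh).
have bC : bounded_op (Phi (toC k)) by apply: bPhi; exact: bounded_cont_C_b.
have lE := spectral_linear smE mB.
apply: (projection_eq0 dotH (sm_bounded smE mB) bC.1) ab _ => //.
- by move=> w; exact: (spectral_idem smE).
- move=> w; rewrite !rho_ext_shift// (linear_opD _ _ lE) !(linear_opZ _ _ lE).
  by rewrite (spectral_commute dotH bA self smE).
- move=> w Ew; rewrite rho_ext_shift// ipDl !ipZl (ip_norm dotH); exact: low.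
- by move=> n; exact: rho_ext_iter_bound.
Qed.

Lemma spectral_above_support (a b : R) p (B : set R) u : measurable B -> C_b p ->
  (forall t, B t -> a <= t) -> b < a -> (forall x, p x != 0 -> h x <= b) ->
  E B (Phi p u) = 0.
Proof.
move=> mB bp Ba ba hb; have [_ [M hM]] := bh.
have M0 x : - M <= h x by have := hM x; rewrite ler_norml => /andP[].
have b0 := ler_norm (- b); rewrite normrN in b0.
have M1 := ler_norm M.
(* The shift by [|M| + |b|] makes both [h + c] and [beta] nonnegative, so the absolute value on the
   support drops out. *)
apply: (@spectral_support 1 (`|M| + `|b|) (a + (`|M| + `|b|)) (b + (`|M| + `|b|))) => //.
- move=> w Ew; rewrite mulrDl mul1r lerD2r.
  exact: (spectral_lower dotH smE mB Ba Ew).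
- by have := normr_ge0 M; lra.
- lra.
- move=> x /hb hx; rewrite mul1r ger0_norm; first lra.
  by have := M0 x; have := normr_ge0 b; lra.
Qed.

Lemma spectral_below_support (a b : R) p (B : set R) u : measurable B -> C_b p ->
  (forall t, B t -> t <= a) -> a < b -> (forall x, p x != 0 -> b <= h x) ->
  E B (Phi p u) = 0.
Proof.
move=> mB bp Ba ba hb; have [_ [M hM]] := bh.
have M0 x : h x <= M by have := hM x; rewrite ler_norml => /andP[].
have b0 := ler_norm b.
have M1 := ler_norm M.
apply: (@spectral_support (-1) (`|M| + `|b|) (- a + (`|M| + `|b|)) (- b + (`|M| + `|b|))) => //.
- move=> w Ew; rewrite mulrDl mulN1r lerD2r mulNr lerN2.
  exact: (spectral_upper dotH smE mB Ba Ew).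
- by have := normr_ge0 M; lra.
- lra.
- move=> x /hb hx; rewrite mulN1r ger0_norm; first lra.
  by have := M0 x; have := normr_ge0 b; lra.
Qed.

End SpectralSupport.

(** * Projection-valued measures from their tails *)

Section Projections.
Context {R : realType} {H : completeNormedModType R[i]}.
Variable dot : {dot H for (@Num.conj R[i])}.
Hypothesis dotH : is_hilbert dot.
Implicit Types (P S T : H -> H) (u v w : H).
Local Notation ip := (ip dot).

Definition self_adjoint_contraction P : Prop :=
  [/\ linear P, forall u, normR (P u) <= normR u & forall u v, ip (P u) v = ip u (P v)].

Definition projection P : Prop := self_adjoint_contraction P /\ forall u, P (P u) = P u.

Lemma contraction_bounded_op P : self_adjoint_contraction P -> bounded_op P.
Proof. by move=> [lP nP _]; split=> //; exists 1 => u; rewrite mul1r. Qed.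

Lemma projection_form P u : projection P -> ip (P u) u = normR (P u) ^+ 2.
Proof. by move=> [[_ _ sP] PP]; rewrite -(ip_norm dotH) [RHS]sP PP ipC. Qed.

Lemma projectionI P : linear P -> (forall u v, ip (P u) v = ip u (P v)) ->
  (forall u, P (P u) = P u) -> projection P.
Proof.
move=> lP sP PP; split=> //; split=> // u.
have [u0|u0] := eqVneq (normR (P u)) 0; first by rewrite u0 normR_ge0.
have u_gt0 : 0 < normR (P u) by rewrite lt_neqAle eq_sym u0 normR_ge0.
rewrite -(ler_pM2l u_gt0) -expr2 -(ip_norm dotH) sP PP ipC.
exact: le_trans (ler_norm _) (ip_le_norm dotH _ _).
Qed.

Lemma projection_id : projection id.
Proof. exact: projectionI. Qed.

Lemma projection_compl P : projection P -> projection (fun u => u - P u).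
Proof.
move=> [[lP nP sP] PP]; apply: projectionI => [a u v|u v|u].
- by rewrite lP opprD addrACA scalerBr.
- by rewrite ipBl ipBr sP.
- by rewrite linear_opB// PP subrr subr0.
Qed.

(** Polarisation: a self-adjoint operator with zero quadratic form is zero. *)
Lemma projection_ext P S : projection P -> projection S ->
  (forall u, ip (P u) u = ip (S u) u) -> P = S.
Proof.
move=> [[lP nP sP] PP] [[lS nS sS] SS] PS; apply/funext => u.
have D0 v w : ip (P v - S v) w = 0.
  have := PS (v + w); rewrite (linear_opD _ _ lP) (linear_opD _ _ lS).
  rewrite !(ipDl, ipDr, ipNl) !PS.
  rewrite (sP w v) (sS w v) (ipC _ w (P v)) (ipC _ w (S v)); lra.
by apply/eqP; rewrite -subr_eq0; apply/eqP/(ip_eq0 dotH); exact: D0.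
Qed.

(** [P] kills [v - P v], hence so does [S], which gives [S P = S]; the other identity is its
    adjoint. *)
Lemma projection_le P S u : projection P -> projection S ->
  (forall v, normR (S v) <= normR (P v)) -> S (P u) = S u /\ P (S u) = S u.
Proof.
move=> [[lP nP sP] PP] [[lS nS sS] SS] SP.
have SPu v : S (P v) = S v.
  apply/eqP; rewrite eq_sym -subr_eq0 -linear_opB//; apply/eqP/normR0_eq0/le_anti.
  rewrite normR_ge0 andbT (le_trans (SP _))// linear_opB// PP subrr normR0//.
split=> //; apply: (ip_ext dotH) => v; rewrite sP sS SPu.
by rewrite -sS.
Qed.

Lemma projection_sub_norm P S u : projection P -> projection S ->
  (forall v, normR (S v) <= normR (P v)) ->
  normR (P u - S u) ^+ 2 = normR (P u) ^+ 2 - normR (S u) ^+ 2.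
Proof.
move=> pP pS SP; rewrite (sqr_normRB dotH).
have -> : ip (P u) (S u) = normR (S u) ^+ 2.
  have [_ PS] := projection_le u pP pS SP.
  have [[_ _ sP] _] := pP; rewrite sP PS ipC; exact: projection_form.
by ring.
Qed.

Lemma projection_orthogonal P S u : projection P -> projection S ->
  (forall v, normR (P v) ^+ 2 + normR (S v) ^+ 2 <= normR v ^+ 2) -> P (S u) = 0.
Proof.
move=> pP [_ SS] PS; apply: normR0_eq0; apply/eqP; rewrite -sqrf_eq0.
have := PS (S u); rewrite SS gerDr => h.
by rewrite eq_le h sqr_ge0.
Qed.

Lemma projectionD P S : projection P -> projection S ->
  (forall v, normR (P v) ^+ 2 + normR (S v) ^+ 2 <= normR v ^+ 2) ->
  projection (P \+ S).
Proof.
move=> pP pS PS.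
have SP v : normR (S v) ^+ 2 + normR (P v) ^+ 2 <= normR v ^+ 2 by rewrite addrC.
have PS0 u := projection_orthogonal u pP pS PS.
have SP0 u := projection_orthogonal u pS pP SP.
move: pP pS => [[lP nP sP] PP] [[lS nS sS] SS]; apply: projectionI => [a u v|u v|u] /=.
- by rewrite lP lS scalerDr addrACA.
- by rewrite ipDl ipDr sP sS.
- by rewrite (linear_opD _ _ lP) (linear_opD _ _ lS) PP SS PS0 SP0 addr0 add0r.
Qed.

(** Monotone convergence in the strong topology: [a] is nondecreasing and bounded, hence Cauchy, and
    it dominates the increments of [s]. *)
Lemma cvg_of_sqr_increment (s : nat -> H) (a : nat -> R) (C : R) :
  (forall m n, (m <= n)%N -> normR (s n - s m) ^+ 2 <= a n - a m) ->
  (forall n, a n <= C) -> cvg (s @ \oo).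
Proof.
move=> hs aC.
have nda : nondecreasing_seq a.
  by move=> m n mn; rewrite -subr_ge0 (le_trans _ (hs m n mn))// sqr_ge0.
have ca : cvgn a by apply: nondecreasing_is_cvgn => //; exists C => _ [n _ <-].
apply: normR_cauchy_cvg => e e0.
have /cvgrPdist_le/(_ (e ^+ 2)) := ca; rewrite exprn_gt0// => /(_ isT)[N _ hN].
have key m n : (N <= m)%N -> (m <= n)%N -> normR (s n - s m) <= e.
  move=> Nm mn; rewrite -ler_sqr ?nnegrE ?normR_ge0// ?(ltW e0)//.
  rewrite (le_trans (hs m n mn))//.
  have := hN m Nm; rewrite /= => /(le_trans (ler_norm _)); apply: le_trans.
  by rewrite lerD2r; exact: nondecreasing_cvgn_le.
exists N => n m Nn Nm; have [mn|/ltnW nm] := leqP m n; first exact: key.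
by rewrite normRBC key.
Qed.

Lemma contraction_limit (P : nat -> H -> H) T :
  (forall n, self_adjoint_contraction (P n)) ->
  (forall u, (fun n => P n u) @ \oo --> T u) -> self_adjoint_contraction T.
Proof.
move=> cP PT; split.
- move=> a u v; have h := PT (a *: u + v).
  rewrite -(cvg_lim (@norm_hausdorff _ _) h).
  rewrite (_ : (fun n => _) = (fun n => a *: P n u) \+ (fun n => P n v)).
    apply: cvg_lim; first exact: norm_hausdorff.
    by apply: cvgD; [exact: cvgZr|].
  by apply/funext => n; have [-> _ _] := cP n.
- move=> u; apply: cvgr_to_le (cvg_normR (PT u)) _.
  by apply: nearW => n; have [_ + _] := cP n; apply.
- move=> u v; have h : (fun n => ip (P n u) v) @ \oo --> ip (T u) v by exact: cvg_ip.
  rewrite -(cvg_lim (@Rhausdorff R) h).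
  rewrite (_ : (fun n => _) = (fun n => ip (P n v) u)).
    apply: cvg_lim; first exact: Rhausdorff.
    by rewrite (ipC _ u); exact: cvg_ip.
  by apply/funext => n; have [_ _ ->] := cP n; rewrite ipC.
Qed.

(** Let [n] tend to infinity in [P n (T u) = P n u]. *)
Lemma contraction_limit_idem (P : nat -> H -> H) T :
  (forall n, self_adjoint_contraction (P n)) ->
  (forall u, (fun n => P n u) @ \oo --> T u) ->
  (forall n u, P n (T u) = P n u) -> forall u, T (T u) = T u.
Proof.
move=> cP PT PTP u; have h := PT (T u).
rewrite -(cvg_lim (@norm_hausdorff _ _) h).
rewrite (_ : (fun n => _) = fun n => P n u); last by apply/funext => n.
by apply: cvg_lim; [exact: norm_hausdorff|exact: PT].
Qed.

Lemma projection_limit (P : nat -> H -> H) : (forall n, projection (P n)) ->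
  (forall m n u, (m <= n)%N -> normR (P m u) <= normR (P n u)) ->
  exists2 T, projection T & forall u, (fun n => P n u) @ \oo --> T u.
Proof.
move=> pP ndP.
have cP u : cvg ((fun n => P n u) @ \oo).
  apply: (@cvg_of_sqr_increment _ (fun n => normR (P n u) ^+ 2) (normR u ^+ 2)).
    move=> m n mn; rewrite projection_sub_norm// => v; exact: ndP.
  move=> n; rewrite ler_sqr ?nnegrE ?normR_ge0//.
  by have [[_ + _] _] := pP n; apply.
pose T u := lim ((fun n => P n u) @ \oo).
have PT u : (fun n => P n u) @ \oo --> T u by exact: cP.
have cT := contraction_limit (fun n => (pP n).1) PT.
exists T => //; split=> //.
apply: (contraction_limit_idem (fun n => (pP n).1) PT) => n u.
have [[ln nn sn] _] := pP n.
apply/eqP; rewrite -subr_eq0 -linear_opB//; apply/eqP/normR0_eq0/le_anti.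
rewrite normR_ge0 andbT; apply/ler_addgt0Pl => e e0; rewrite addr0.
have /normR_cvgP/(_ e e0)[N _ hN] := PT u.
(* For [m >= n] the projection [P n] absorbs [P m], so in [P n (T u - u)] the vector [u] may be
   replaced by [P m u], which is close to [T u]. *)
pose m := maxn N n; have := hN m (leq_maxl _ _) => h.
have -> : P n (T u - u) = P n (T u - P m u).
  by rewrite !linear_opB//; have [-> _] := projection_le u (pP m) (pP n)
    (fun v => ndP n m v (leq_maxr _ _)).
exact: le_trans (nn _) h.
Qed.

End Projections.

Lemma lebesgue_stieltjes_oc (R : realType) (G : cumulative R R) (a b : R) : a <= b ->
  lebesgue_stieltjes_measure G `]a, b]%classic = (G b - G a)%:E.
Proof.
move=> ab; rewrite /lebesgue_stieltjes_measure /measure_extension.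
by rewrite measurable_mu_extE/= ?wlength_itv_bnd//; exact: is_ocitv.
Qed.

(** The Stieltjes measure of [F]. Since [F] is constant near both ends, the mass of a tail, and then
    of the line, is the value at which an increasing sequence of intervals becomes stationary. *)
Lemma cumulative_measure (R : realType) (F : R -> R) (M c : R) :
  nondecreasing F -> right_continuous F ->
  (forall t, t <= - M -> F t = 0) -> (forall t, M <= t -> F t = c) ->
  exists mu : {measure set (measurableTypeR R) -> \bar R},
    mu setT = c%:E /\ forall t, mu `]t, +oo[%classic = (c - F t)%:E.
Proof.
move=> ndF rcF F0 F1.
pose G : cumulative R R := HB.pack F (isCumulative.Build R _ R F ndF rcF).
have [mu mu_oc] : exists mu : {measure set (measurableTypeR R) -> \bar R},
    forall a b, a <= b -> mu `]a, b]%classic = (F b - F a)%:E.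
  by exists (lebesgue_stieltjes_measure G) => a b; exact: lebesgue_stieltjes_oc.
have mu_tail t : mu `]t, +oo[%classic = (c - F t)%:E.
  pose B (n : nat) := `]t, t + n%:R]%classic : set (measurableTypeR R).
  have BE : \bigcup_n B n = `]t, +oo[%classic.
    apply/seteqP; split=> x.
      by move=> [n _]; rewrite /B /= !in_itv/= andbT => /andP[].
    rewrite /= in_itv/= andbT => tx; exists (Num.bound (x - t)) => //.
    rewrite /B /= in_itv/= tx/= -lerBlDl ltW//.
    by apply: archi_boundP; rewrite subr_ge0 ltW.
  have ndB : nondecreasing_seq B.
    move=> m n mn; apply/subsetPset => x; rewrite /B/= !in_itv/= => /andP[-> /le_trans].
    by apply; rewrite lerD2l ler_nat.
  have mB n : measurable (B n) by exact: measurable_itv.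
  have := @nondecreasing_cvg_mu _ _ _ mu B mB (bigcup_measurable (fun n _ => mB n)) ndB.
  rewrite BE => h; apply: (cvg_unique _ h); first exact: ereal_hausdorff.
  apply: cvg_near_cst; near=> n.
  rewrite /= mu_oc ?lerDl// F1// -lerBlDl.
  near: n; exact: nbhs_infty_ger.
exists mu; split=> //.
pose B (n : nat) := `](- n%:R), +oo[%classic : set (measurableTypeR R).
have BE : \bigcup_n B n = setT.
  apply/seteqP; split=> // x _; exists (Num.bound (- x)) => //.
  rewrite /B /= in_itv/= andbT ltrNl.
  have [x0|x0] := leP 0 (- x); first exact: archi_boundP.
  by rewrite (lt_le_trans x0).
have ndB : nondecreasing_seq B.
  move=> m n mn; apply/subsetPset => x; rewrite /B/= !in_itv/= !andbT; apply: le_lt_trans.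
  by rewrite lerN2 ler_nat.
have mB n : measurable (B n) by exact: measurable_itv.
have := @nondecreasing_cvg_mu _ _ _ mu B mB (bigcup_measurable (fun n _ => mB n)) ndB.
rewrite BE => h; apply: (cvg_unique _ h); first exact: ereal_hausdorff.
apply: cvg_near_cst; near=> n.
rewrite /= mu_tail F0 ?subr0// lerN2.
near: n; exact: nbhs_infty_ger.
Unshelve. all: by end_near.
Qed.

Lemma line_measureU (R : realType) (mu : {measure set (measurableTypeR R) -> \bar R})
    (A B : set (measurableTypeR R)) : measurable A -> measurable B -> A `&` B = set0 ->
  mu (A `|` B) = (mu A + mu B)%E.
Proof. exact: measureU. Qed.

Section Resolution.
Context {R : realType} {H : completeNormedModType R[i]}.
Variable dot : {dot H for (@Num.conj R[i])}.
Hypothesis dotH : is_hilbert dot.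
Local Notation ip := (ip dot).
Local Notation measR := {measure set (measurableTypeR R) -> \bar R}.
Implicit Types (A B : set (measurableTypeR R)) (u v : H).
Variables (mu : H -> measR) (Q : R -> H -> H).
Hypothesis muT : forall u, mu u setT = (normR u ^+ 2)%:E.
Hypothesis muQ : forall u t, mu u `]t, +oo[%classic = (normR (Q t u) ^+ 2)%:E.
Hypothesis pQ : forall t, projection dot (Q t).

(** [P] is to be the value at [B] of the projection-valued measure. As [|P u| ^ 2 = <P u, u>], the
    scalar measures prescribe its quadratic form, and therefore [P] itself. *)
Definition represents (P : H -> H) B : Prop :=
  projection dot P /\ forall u, mu u B = (normR (P u) ^+ 2)%:E.

Lemma represents_unique P S B : represents P B -> represents S B -> P = S.
Proof.
move=> [pP hP] [pS hS]; apply: (projection_ext dotH pP pS) => u.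
by rewrite !(projection_form dotH)//; apply: EFin_inj; rewrite -hP -hS.
Qed.

Lemma representsT : represents id setT.
Proof. by split=> //; exact: projection_id. Qed.

Lemma represents_le P S A B u : measurable A -> measurable B -> A `<=` B ->
  represents P A -> represents S B -> normR (P u) <= normR (S u).
Proof.
move=> mA mB AB [_ hP] [_ hS]; rewrite -ler_sqr ?nnegrE ?normR_ge0//.
by rewrite -lee_fin -hP -hS le_measure// inE.
Qed.

Lemma representsC P B : measurable B -> represents P B ->
  represents (fun u => u - P u) (~` B).
Proof.
move=> mB [pP hP]; split; first exact: projection_compl.
move=> u; have pu : forall v, normR (P v) <= normR (id v) by have [[_ + _] _] := pP.
rewrite (projection_sub_norm dotH u (projection_id dotH) pP pu) EFinB -hP -muT.
have := line_measureU (mu u) mB (measurableC mB) (setICr B); rewrite setUv => ->.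
by rewrite hP addeAC subee// add0e.
Qed.

Lemma represents_orthogonal P S A B u : measurable A -> measurable B ->
  A `&` B = set0 -> represents P A -> represents S B -> P (S u) = 0.
Proof.
move=> mA mB AB [pP hP] [pS hS]; apply: (projection_orthogonal _ pP pS) => v.
rewrite -lee_fin EFinD -hP -hS -line_measureU// -muT le_measure// inE//.
exact: measurableU.
Qed.

Lemma representsU P S A B : measurable A -> measurable B -> A `&` B = set0 ->
  represents P A -> represents S B -> represents (P \+ S) (A `|` B).
Proof.
move=> mA mB AB rP rS.
have PS0 u := represents_orthogonal u mA mB AB rP rS.
have [[pP hP] [pS hS]] := (rP, rS); split.
  apply: (projectionD dotH) => // v.
  rewrite -lee_fin EFinD -hP -hS -line_measureU// -muT le_measure// inE//.
  exact: measurableU.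
move=> u; rewrite line_measureU// hP hS -EFinD (sqr_normRD dotH).
have -> : ip (P u) (S u) = 0 by have [[_ _ sP] _] := pP; rewrite sP PS0 ip0r.
by congr (_%:E); ring.
Qed.

Lemma represents_bigcup (F : nat -> set (measurableTypeR R)) (P : nat -> H -> H) :
  (forall n, measurable (F n)) -> nondecreasing_seq F ->
  (forall n, represents (P n) (F n)) ->
  exists T, represents T (\bigcup_n F n) /\ forall u, (fun n => P n u) @ \oo --> T u.
Proof.
move=> mF ndF rP.
have ndP m n u : (m <= n)%N -> normR (P m u) <= normR (P n u).
  by move=> mn; apply: (represents_le u (mF m) (mF n)) => //; apply/subsetPset; exact: ndF.
have [T pT PT] := projection_limit dotH (fun n => (rP n).1) ndP.
exists T; split=> //; split=> // u.
have := @nondecreasing_cvg_mu _ _ _ (mu u) F mF (bigcup_measurable (fun n _ => mF n)) ndF.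
move=> h; apply: (cvg_unique _ h); first exact: ereal_hausdorff.
rewrite (_ : _ \o _ = EFin \o (fun n => normR (P n u) ^+ 2)); last first.
  by apply/funext => n /=; rewrite (rP n).2.
apply: cvg_EFin; first exact: nearW.
rewrite (_ : _ \o _ = fun n => normR (P n u) ^+ 2); last exact/funext.
by under eq_fun do rewrite expr2; rewrite expr2; apply: cvgM; exact: cvg_normR.
Qed.

(** The representable sets form a Dynkin system: complements give [1 - P], disjoint unions give
    sums, increasing unions give strong limits. It contains the half-lines []t, +oo[], a generating
    family stable under intersection. *)
Lemma represents_measurable B : measurable B -> exists P, represents P B.
Proof.
pose D B := measurable B -> exists P, represents P B.
move=> mB; suff : D B by apply.
have GE : @measurable _ (measurableTypeR R) = <<s @RGenOInfty.G R >>.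
  exact: RGenOInfty.measurableE.
move: (mB); rewrite GE => sB.
apply: (@dynkin_induction _ (measurableTypeR R) (@RGenOInfty.G R) D GE) sB.
- move=> _ _ [x ->] [y ->]; exists (Num.max x y); apply/seteqP; split => z /=;
    rewrite !in_itv/= !andbT gt_max; first by move=> [-> ->].
  by move/andP.
- by move=> _; exists id; exact: representsT.
- by move=> _ [x ->] _; exists (Q x); split=> // u; rewrite muQ.
- by move=> S mS /(_ mS)[P rP] _; exists (fun u => u - P u); exact: representsC.
- move=> F mF tF dF _.
  have /choice[P rP] : forall n, exists P, represents P (F n) by move=> n; exact: dF.
  pose U n := \big[setU/set0]_(i < n.+1) F i.
  have mU n : measurable (U n) by exact: bigsetU_measurable.
  have UE n : U n.+1 = U n `|` F n.+1 by rewrite /U big_ord_recr.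
  have UF n : U n `&` F n.+1 = set0.
    rewrite /U -bigcup_mkord setI_bigcupl bigcup0// => i /= ni.
    have /trivIsetP/(_ i n.+1 I I) := tF; apply; by rewrite ltn_eqF.
  have rU n : exists P, represents P (U n).
    elim: n => [|n [S rS]]; first by exists (P 0%N); rewrite /U big_ord1.
    by exists (S \+ P n.+1); rewrite UE; exact: representsU.
  have /choice[S rS] := rU.
  have ndU : nondecreasing_seq U.
    by apply/nondecreasing_seqP => n; apply/subsetPset; rewrite UE; exact: subsetUl.
  have [T [rT _]] := represents_bigcup mU ndU rS.
  exists T; rewrite (_ : \bigcup_k F k = \bigcup_n U n)//.
  by rewrite /U -(bigcup_bigsetU_bigcup F).
Qed.

Lemma spectral_resolution : exists E : set R -> H -> H,
  [/\ forall B, measurable B -> represents (E B) B,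
      E setT = id,
      forall B B', measurable B -> measurable B' -> E (B `&` B') = E B \o E B' &
      forall F : nat -> set R, (forall n, measurable (F n)) -> trivIset setT F ->
        forall u, series (fun n => E (F n) u) @ \oo --> E (\bigcup_n F n) u].
Proof.
have /choice[E rE] : forall B, exists P, measurable B -> represents P B.
  move=> B; have [mB|nB] := pselect (measurable B).
    by have [P rP] := represents_measurable mB; exists P.
  (* An arbitrary value off the Borel sets. *)
  by exists id.
exists E; split=> //.
- exact: represents_unique (rE _ measurableT) representsT.
- move=> B B' mB mB'.
  have mI : measurable (B `&` B') by exact: measurableI.
  have m1 : measurable (B `\` B') by exact: measurableD.
  have m2 : measurable (B' `\` B) by exact: measurableD.
  (* Both sets are cut along their intersection. In the product of the two sums, all terms but the
     square of [E (B & B')] vanish because their sets are disjoint. *)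
  have EB : E B = E (B `&` B') \+ E (B `\` B').
    apply: represents_unique (rE _ mB) _; rewrite -[X in represents _ X](setUIDK B B').
    apply: (representsU mI m1) (rE _ mI) (rE _ m1).
    by apply/seteqP; split=> // x; rewrite /setI/setD/=; tauto.
  have EB' : E B' = E (B `&` B') \+ E (B' `\` B).
    apply: represents_unique (rE _ mB') _; rewrite -[X in represents _ X](setUIDK B' B).
    rewrite (setIC B'); apply: (representsU mI m2) (rE _ mI) (rE _ m2).
    by apply/seteqP; split=> // x; rewrite /setI/setD/=; tauto.
  apply/funext => u /=; rewrite EB EB' /=.
  have l1 : linear (E (B `&` B')) by have [[[]]] := rE _ mI.
  have l2 : linear (E (B `\` B')) by have [[[]]] := rE _ m1.
  rewrite (linear_opD _ _ l1) (linear_opD _ _ l2).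
  have [[_ ->] _] := rE _ mI.
  rewrite (represents_orthogonal _ mI m2 _ (rE _ mI) (rE _ m2)); last first.
    by apply/seteqP; split=> // x; rewrite /setI/setD/=; tauto.
  rewrite (represents_orthogonal _ m1 mI _ (rE _ m1) (rE _ mI)); last first.
    by apply/seteqP; split=> // x; rewrite /setI/setD/=; tauto.
  rewrite (represents_orthogonal _ m1 m2 _ (rE _ m1) (rE _ m2)) ?addr0//.
  by apply/seteqP; split=> // x; rewrite /setI/setD/=; tauto.
- move=> F mF tF u.
  (* Union of the first [n] sets, with [U 0] empty, so that [E (U n) u] is exactly the partial sum
     [series _ n]. *)
  pose U n := \big[setU/set0]_(i < n) F i.
  have mU n : measurable (U n) by exact: bigsetU_measurable.
  have UE n : U n.+1 = U n `|` F n by rewrite /U big_ord_recr.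
  have UF n : U n `&` F n = set0.
    rewrite /U -bigcup_mkord setI_bigcupl bigcup0// => i /= ni.
    have /trivIsetP/(_ i n I I) := tF; apply; by rewrite ltn_eqF.
  have EU n : E (U n) u = series (fun n => E (F n) u) n.
    elim: n => [|n IH].
      rewrite /series/= big_geq// /U big_ord0; apply: normR0_eq0; apply/eqP.
      have [_ /(_ u)] := rE _ measurable0.
      by rewrite measure0 => -[/esym/eqP]; rewrite sqrf_eq0.
    rewrite seriesSr -IH UE -[RHS]/((E (U n) \+ E (F n)) u); congr (_ u).
    have mUF : measurable (U n `|` F n) by exact: measurableU.
    apply: (represents_unique (rE _ mUF)).
    exact: (representsU (mU n) (mF n) (UF n) (rE _ (mU n)) (rE _ (mF n))).
  have ndU : nondecreasing_seq U.
    by apply/nondecreasing_seqP => n; apply/subsetPset; rewrite UE; exact: subsetUl.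
  have [T [rT hT]] := represents_bigcup mU ndU (fun n => rE _ (mU n)).
  have <- : T = E (\bigcup_n F n).
    have mUF : measurable (\bigcup_n F n) by exact: bigcup_measurable.
    apply: represents_unique (rE _ mUF).
    rewrite (_ : \bigcup_k F k = \bigcup_n U n)//.
    apply/seteqP; split=> x [n _ xn].
      by exists n.+1 => //; rewrite UE; right.
    by move: xn; rewrite /U -bigcup_mkord => -[k /= kn Fk]; exists k.
  rewrite (_ : series _ = fun n => E (U n) u); first exact: hT.
  by apply/funext => n; rewrite EU.
Qed.

End Resolution.

(** * Existence of the spectral measure *)

Section Ramp.
Context {R : realType}.
Implicit Types (n m : nat) (s t : R).

Lemma clampP (a b s : R) : a <= b ->
  [\/ s <= a /\ clamp a b s = a, a <= s <= b /\ clamp a b s = s |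
      b <= s /\ clamp a b s = b].
Proof.
move=> ab; rewrite /clamp; have [bs|bs] := leP b s.
  by constructor 3; rewrite max_r.
have [sa|sa] := leP a s; first by constructor 2; rewrite ?sa (ltW bs).
by constructor 1; rewrite ltW.
Qed.

(* Continuous approximation from below of the indicator of [t < s]. *)
Definition ramp n t s : R := clamp 0 1 (n%:R * (s - t)).

Lemma ramp_ge0 n t s : 0 <= ramp n t s.
Proof. by rewrite /ramp /clamp le_max lexx. Qed.

Lemma ramp_le1 n t s : ramp n t s <= 1.
Proof. by rewrite /ramp /clamp ge_max ler01/= ge_min lexx. Qed.

Lemma ramp_eq1 n t s : 1 <= n%:R * (s - t) -> ramp n t s = 1.
Proof. by rewrite /ramp; case: (clampP (n%:R * (s - t)) ler01) => -[]; lra. Qed.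

Lemma ramp_eq0 n t s : s <= t -> ramp n t s = 0.
Proof.
move=> st; have : n%:R * (s - t) <= 0 by rewrite mulr_ge0_le0// subr_le0.
by rewrite /ramp; case: (clampP (n%:R * (s - t)) ler01) => -[]; lra.
Qed.

(** The second alternative serves [ramp_mono]: left of [t] the argument of the ramp decreases with
    [n], but there the clamp is already 0. *)
Lemma clamp01_mono (x y : R) : x <= y \/ x <= 0 -> clamp 0 1 x <= clamp 0 1 y.
Proof.
by case: (clampP x ler01) => -[]; case: (clampP y ler01) => -[]; lra.
Qed.

Lemma ramp_mono n m t s : (n <= m)%N -> ramp n t s <= ramp m t s.
Proof.
move=> nm; apply: clamp01_mono; have [ts|ts] := leP 0 (s - t).
  by left; rewrite ler_wpM2r// ler_nat.
by right; rewrite mulr_ge0_le0// ltW.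
Qed.

Lemma ramp_anti n t t' s : t <= t' -> ramp n t' s <= ramp n t s.
Proof. by move=> tt'; apply: clamp01_mono; left; rewrite ler_wpM2l// lerD2l lerN2. Qed.

Lemma ramp_lip n t s s' : `|ramp n t s - ramp n t s'| <= n%:R * `|s - s'|.
Proof.
rewrite (le_trans (clamp_lip _ _ _ _))// -mulrBr normrM ger0_norm//.
by rewrite ler_wpM2l// le_eqVlt; apply/orP; left; apply/eqP; congr `|_|; ring.
Qed.

Lemma ramp_shift n t t' s : t <= t' -> ramp n t s <= ramp n t' s + n%:R * (t' - t).
Proof.
move=> tt'; rewrite -lerBlDl (le_trans (ler_norm _))// (le_trans (clamp_lip _ _ _ _))//.
rewrite -mulrBr normrM ger0_norm// ler_wpM2l// (_ : s - t - _ = t' - t) ?ger0_norm ?subr_ge0//.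
by ring.
Qed.

(** The steeper ramp differs from 1 only where [s - t < 1 / (m + 1)], and on that range the flatter
    ramp is at most [n / (m + 1)]. As [m] grows, the limit absorbs each ramp, which makes it
    idempotent. *)
Lemma ramp_prod n m t s : `|ramp n t s * ramp m.+1 t s - ramp n t s| <= n%:R / m.+1%:R.
Proof.
have r0 := ramp_ge0 n t s; have r1 := ramp_le1 n t s.
have m0 : 0 < m.+1%:R :> R by [].
have nm0 : 0 <= n%:R / m.+1%:R :> R by rewrite divr_ge0.
have [st|ts] := leP s t; first by rewrite !ramp_eq0// mul0r subrr normr0.
have [h|h] := leP 1 (m.+1%:R * (s - t)).
  by rewrite (ramp_eq1 h) mulr1 subrr normr0.
have s_le : s - t <= m.+1%:R^-1.
  by rewrite -[m.+1%:R^-1]mul1r ler_pdivlMr// mulrC ltW.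
have rn : ramp n t s <= n%:R / m.+1%:R.
  have : n%:R * (s - t) <= n%:R / m.+1%:R by rewrite ler_wpM2l.
  have : 0 <= n%:R * (s - t) by rewrite mulr_ge0// subr_ge0 ltW.
  move: nm0; set q := n%:R / m.+1%:R.
  by rewrite /ramp; case: (clampP (n%:R * (s - t)) ler01) => -[]; lra.
rewrite -[X in _ - X]mulr1 -mulrBr normrM ger0_norm//.
rewrite -[leRHS]mulr1 ler_pM// ler_norml.
by have := ramp_ge0 m.+1 t s; have := ramp_le1 m.+1 t s; lra.
Qed.

(** With the next lemma, this replaces by ramps the two indicators in [(b - a) 1_(s > b) <= clamp 0
    (b - a) (s - a) <= (b - a) 1_(s > a)]. The upper bound needs a ramp of slope at least
    [1 / (b - a)]. *)
Lemma clamp_le_ramp (a b s : R) n : a < b -> 1 <= n%:R * (b - a) ->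
  clamp 0 (b - a) (s - a) <= (b - a) * ramp n a s.
Proof.
move=> ab n1; have ba : 0 < b - a by rewrite subr_gt0.
have r0 := ramp_ge0 n a s.
case: (clampP (s - a) (ltW ba)) => -[h ->]; first by rewrite mulr_ge0// ltW.
  have hn : s - a <= (b - a) * (n%:R * (s - a)).
    by rewrite mulrA (mulrC (b - a)) ler_peMl//; case/andP: h.
  rewrite /ramp; case: (clampP (n%:R * (s - a)) ler01) => -[h' ->].
  - have : (b - a) * (n%:R * (s - a)) <= 0 by rewrite mulr_ge0_le0// ltW.
    lra.
  - by [].
  - by rewrite mulr1; case/andP: h.
rewrite ramp_eq1 ?mulr1// (le_trans n1)// ler_wpM2l//.
Qed.

Lemma ramp_le_clamp (a b s : R) n : a < b ->
  (b - a) * ramp n b s <= clamp 0 (b - a) (s - a).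
Proof.
move=> ab; have ba : 0 < b - a by rewrite subr_gt0.
have r1 := ramp_le1 n b s.
have [sb|bs] := leP s b.
  by rewrite ramp_eq0// mulr0; case: (clampP (s - a) (ltW ba)) => -[h ->]; lra.
have -> : clamp 0 (b - a) (s - a) = b - a.
  by case: (clampP (s - a) (ltW ba)) => -[h ->]; lra.
by rewrite ger_pMr.
Qed.

End Ramp.

Section IntervalFunctional.
Context {R : realType}.

(** After [n] halvings each piece has length [(b - a) / 2 ^ n] while the increments of [g]
    telescope, so [|D a b| <= (b - a) / 2 ^ n * (g a - g b)]. *)
Lemma interval_additive_eq0 (D : R -> R -> R) (g : R -> R) :
  (forall a b c, a < b -> b < c -> D a c = D a b + D b c) ->
  (forall a b, a < b -> `|D a b| <= (b - a) * (g a - g b)) ->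
  forall a b, a < b -> D a b = 0.
Proof.
move=> Dadd Dle a b ab.
have halve n : forall a b, a < b -> `|D a b| <= (b - a) / 2 ^+ n * (g a - g b).
  elim: n => [|n IH] {}a {}b {}ab; first by rewrite expr0 divr1 Dle.
  have am : a < (a + b) / 2 by rewrite midf_lt.
  have mb : (a + b) / 2 < b by rewrite midf_lt.
  rewrite (Dadd _ _ _ am mb) (le_trans (ler_normD _ _))//.
  rewrite (le_trans (lerD (IH _ _ am) (IH _ _ mb)))// exprS invfM.
  by rewrite le_eqVlt; apply/orP; left; apply/eqP; field.
apply/eqP; rewrite -normr_eq0 eq_le normr_ge0 andbT.
have : (fun n => (b - a) * (g a - g b) * (2^-1) ^+ n) @ \oo --> (b - a) * (g a - g b) * 0.
  by apply: cvgMr; apply: cvg_expr; rewrite ger0_norm// invf_lt1// ltr1n.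
rewrite mulr0 => h; apply: (cvgr_to_ge h); apply: nearW => n.
by rewrite (le_trans (halve n _ _ ab))// exprVn mulrAC.
Qed.

Variables (mu : {measure set (measurableTypeR R) -> \bar R}) (c : R) (q : R -> R).
Hypothesis muT : mu setT = c%:E.
Hypothesis muq : forall t, mu `]t, +oo[%classic = (q t)%:E.

(** The length of the part of [[a, b]] below [t], that is, the integral over [s] in [[a, b]] of the
    indicator of [s < t]. This makes it additive in the interval. *)
Definition ramp_cst (a b t : R) : R := clamp 0 (b - a) (t - a).

Lemma measurable_ramp_cst a b : measurable_fun (setT : set (measurableTypeR R))
  (ramp_cst a b : measurableTypeR R -> measurableTypeR R).
Proof.
apply: (@continuous_measurable_fun R) => t; apply/cvgrPdist_le => e e0.
have /cvgrPdist_le/(_ e e0) : (s : R) @[s --> (t : R)] --> t by exact: cvg_id.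
apply: filterS => s; apply: le_trans; rewrite (le_trans (clamp_lip _ _ _ _))//.
by rewrite opprB addrA subrK.
Qed.

Let mu_lty B : measurable B -> (mu B < +oo)%E.
Proof.
move=> mB; have : (mu B <= mu setT)%E by rewrite le_measure// inE.
by rewrite muT => /le_lt_trans; apply; rewrite ltry.
Qed.

Lemma integrable_ramp_cst a b : a <= b -> mu.-integrable setT (EFin \o ramp_cst a b).
Proof.
move=> ab; apply: (@le_integrable _ _ _ mu setT measurableT _ (cst (b - a)%:E)).
- by apply/measurable_EFinP; exact: measurable_ramp_cst.
- move=> t _ /=; rewrite lee_fin !ger0_norm ?subr_ge0//; rewrite /ramp_cst /clamp.
    by rewrite ge_max subr_ge0 ab ge_min lexx.
  by rewrite le_max lexx.
- by apply: integrable_cst_lty => //; exact: mu_lty.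
Qed.

Let integrable_patch (r t : R) :
  mu.-integrable setT (EFin \o ((fun=> r) \_ `]t, +oo[%classic)).
Proof.
rewrite -restrict_EFin -integrable_mkcond//; apply: integrable_cst_lty => //.
exact: mu_lty.
Qed.

Let integral_patch (r t : R) : \int[mu]_x ((fun=> r) \_ `]t, +oo[%classic) x = r * q t.
Proof. by rewrite -Rintegral_mkcond Rintegral_cst// muq. Qed.

Lemma integral_ramp_cst_le a b : a < b ->
  (b - a) * q b <= \int[mu]_t ramp_cst a b t <= (b - a) * q a.
Proof.
move=> ab; have ba : 0 < b - a by rewrite subr_gt0.
have ib := integrable_ramp_cst (ltW ab).
(* Off its set a patched function takes the default value [point], which is 0 in [R]; so the bounds
   are multiples of indicators of tails. *)
rewrite -!integral_patch; apply/andP; split; apply: le_Rintegral => // t _;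
  rewrite patchE mem_setE in_itv/= andbT /ramp_cst -[point]/(0 : R).
  by case: ifP; case: (clampP (t - a) (ltW ba)) => -[+ ->]; lra.
by case: ifP; case: (clampP (t - a) (ltW ba)) => -[+ ->]; lra.
Qed.

Lemma ramp_cstD a b d t : a < b -> b < d ->
  ramp_cst a d t = ramp_cst a b t + ramp_cst b d t.
Proof.
move=> ab bd; have ba : 0 <= b - a by lra.
have db : 0 <= d - b by lra.
have da : 0 <= d - a by lra.
rewrite /ramp_cst.
case: (clampP (t - a) ba) => -[+ ->]; case: (clampP (t - b) db) => -[+ ->];
  case: (clampP (t - a) da) => -[+ ->]; lra.
Qed.

(** The values of [q] at the ends show that [mu] is carried by []a, b]], where
    [t = ramp_cst a b t + a]. *)
Lemma measure_support_integral a b : a < b -> q a = c -> q b = 0 ->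
  mu.-integrable setT (EFin : R -> \bar R) /\
  \int[mu]_t (t : R) = \int[mu]_t ramp_cst a b t + a * c.
Proof.
move=> ab qa qb; pose N := ~` `]a, b]%classic : set (measurableTypeR R).
have mI : measurable (`]a, b]%classic : set (measurableTypeR R)) by exact: measurable_itv.
have mN : measurable N by exact: measurableC.
have muI : mu `]a, b]%classic = c%:E.
  have : mu (`]a, b]%classic `|` `]b, +oo[%classic) = c%:E.
    rewrite (_ : _ `|` _ = `]a, +oo[%classic) ?muq ?qa//.
    apply/seteqP; split=> t /=; rewrite !in_itv/= !andbT.
      by case=> [/andP[]//|]; apply: lt_trans.
    by move=> at_; have [tb|bt] := leP t b; [left; rewrite at_|right].
  rewrite line_measureU//; last first.
    apply/seteqP; split=> // t [] /=; rewrite !in_itv/= andbT => /andP[_ tb].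
    by rewrite ltNge tb.
  by rewrite muq qb adde0.
have mu0 : mu N = 0%E.
  have := line_measureU mu mI mN (setICr _); rewrite setUv muT muI => /eqP.
  rewrite -{1}(adde0 c%:E) eq_sym => /eqP h.
  by move: h; rewrite -!(addeC _ c%:E) => /(congr1 (fun x => x - c%:E)%E); rewrite !addeK// add0e.
have NE : setT `\` N = `]a, b]%classic by rewrite setTD setCK.
have iF : mu.-integrable setT (EFin \o (fun t => ramp_cst a b t + a)).
  rewrite (_ : _ \o _ = fun t => ((EFin \o ramp_cst a b) t + cst a%:E t)%E)//.
  apply: integrableD => //; first exact: integrable_ramp_cst (ltW ab).
  by apply: integrable_cst_lty => //; exact: mu_lty.
have eqI t : `]a, b]%classic t -> ramp_cst a b t + a = t.
  rewrite /= in_itv/= /ramp_cst => atb; have ba : 0 <= b - a by lra.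
  by case: (clampP (t - a) ba) => -[+ ->]; lra.
have iE : mu.-integrable setT (EFin : R -> \bar R).
  apply/(@negligible_integrable _ _ _ mu setT N) => //.
  rewrite NE; apply: (@eq_integrable _ _ _ mu _ mI (EFin \o (fun t => ramp_cst a b t + a))).
    by move=> t; rewrite inE => /eqI /= ->.
  exact: integrableS iF.
split=> //; rewrite -[c]/(fine c%:E) -muT -(Rintegral_cst mu measurableT a).
rewrite -RintegralD//; last 2 first.
- exact: integrable_ramp_cst (ltW ab).
- by apply: integrable_cst_lty => //; exact: mu_lty.
rewrite /Rintegral; congr fine.
rewrite (@negligible_integral _ _ _ mu setT N)// NE.
rewrite [RHS](@negligible_integral _ _ _ mu setT N)// NE.
by apply: eq_integral => t; rewrite inE => /eqI ->.
Qed.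

End IntervalFunctional.

Section Existence.
Context {R : realType} {X : metricType R} {H : completeNormedModType R[i]}.
Variable dot : {dot H for (@Num.conj R[i])}.
Variable rho : (X -> R[i]) -> H -> H.
Hypothesis dotH : is_hilbert dot.
Hypothesis properX : proper_metric (X := X).
Hypothesis rho_rep : is_representation dot rho.
Hypothesis rho_nondeg : nondegenerate_rep rho.
Implicit Types (k : X -> R) (u v w : H).
Local Notation ip := (ip dot).
Local Notation Phi := (rho_ext rho).

Variable h : X -> R.
Hypothesis bh : bounded_cont h.

(** Increases with [n]; its strong limit will be the spectral projection of [Phi (toC h)] for []t,
    +oo[]. *)
Let T n t := Phi (toC (fun x => ramp n t (h x))).

Let bramp n t : bounded_cont (fun x => ramp n t (h x)).
Proof. by apply: (bounded_cont_lip (c := n%:R)) => //; exact: ramp_lip. Qed.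

Let T_contraction n t : self_adjoint_contraction dot (T n t).
Proof.
have bC := bounded_cont_C_b (bramp n t).
split=> [|u|u v].
- by have [] := rho_ext_bounded dotH properX rho_rep rho_nondeg bC.
- rewrite -[leRHS]mul1r; apply: (rho_ext_contractive dotH properX rho_rep rho_nondeg) => // x.
  by rewrite normRC ger0_norm ?ramp_ge0 ?ramp_le1.
- exact: (rho_ext_self_adjoint dotH properX rho_rep rho_nondeg).
Qed.

Let T_le n m t t' u : (forall x, ramp n t (h x) <= ramp m t' (h x)) ->
  ip (T n t u) u <= ip (T m t' u) u.
Proof. exact: (rho_ext_le dotH properX rho_rep rho_nondeg). Qed.

Let T_le_norm n t u : ip (T n t u) u <= normR u ^+ 2.
Proof.
rewrite (le_trans (ler_norm _))// (le_trans (ip_le_norm dotH _ _))// expr2.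
by rewrite ler_wpM2r ?normR_ge0//; have [_ + _] := T_contraction n t; apply.
Qed.

(** The difference [d] of the two ramps takes values in [[0, 1]], hence [d ^ 2 <= d]. *)
Let T_sqr m n t u : (m <= n)%N ->
  normR (T n t u - T m t u) ^+ 2 <= ip (T n t u) u - ip (T m t u) u.
Proof.
move=> mn; have bn := bounded_cont_C_b (bramp n t); have bm := bounded_cont_C_b (bramp m t).
have bd := bounded_contB (bramp n t) (bramp m t).
rewrite -ipBl -(rho_extB dotH properX rho_rep rho_nondeg u bn bm) -toCB.
rewrite (sqr_rho_ext dotH properX rho_rep rho_nondeg); last exact: bounded_cont_C_b.
apply: (rho_ext_le dotH properX rho_rep rho_nondeg) => //.
  have bN := bounded_cont_normR (bounded_cont_C_b bd).
  exact: (bounded_contM bN bN).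
move=> x; have := ramp_mono t (h x) mn; have := ramp_ge0 m t (h x).
have := ramp_le1 n t (h x); rewrite /toC normRC /= => r1 r0 rmn.
rewrite ger0_norm ?subr_ge0// expr2 ler_piMr ?subr_ge0//; lra.
Qed.

Lemma tail_projection : exists Q : R -> H -> H,
  (forall t, projection dot (Q t)) /\ forall t u, (fun n => T n t u) @ \oo --> Q t u.
Proof.
have cT t u : cvg ((fun n => T n t u) @ \oo).
  by apply: (cvg_of_sqr_increment (a := fun n => ip (T n t u) u) (C := normR u ^+ 2)) => // m n;
    exact: T_sqr.
exists (fun t u => lim ((fun n => T n t u) @ \oo)); split=> // t.
have cQ := contraction_limit dotH (fun n => T_contraction n t) (cT t).
split=> //; apply: (contraction_limit_idem (fun n => T_contraction n t) (cT t)) => n u.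
have [ln nn _] := T_contraction n t.
apply/eqP; rewrite -subr_eq0 -linear_opB//; apply/eqP/normR0_eq0/le_anti.
rewrite normR_ge0 andbT; apply/ler_addgt0Pl => e e0; rewrite addr0.
have e20 : 0 < e / 2 by rewrite divr_gt0.
have /normR_cvgP/(_ _ e20)[N _ hN] := cT t u.
have u1 : 0 < normR u + 1 by rewrite ltr_wpDl ?normR_ge0.
have nu0 : 0 <= n%:R * (normR u + 1) / (e / 2).
  by apply: divr_ge0; [rewrite mulr_ge0// ltW|exact: ltW].
(* Large enough for two errors of at most [e / 2]: the distance from [T m.+1 t u] to its limit, and
   the defect [n / m.+1] of [ramp_prod] times [|u|]. *)
pose m := maxn N (Num.bound (n%:R * (normR u + 1) / (e / 2))).
have nm : n%:R / m.+1%:R * normR u <= e / 2.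
  have : n%:R * (normR u + 1) / (e / 2) <= m.+1%:R.
    rewrite (le_trans (ltW (archi_boundP nu0)))// ler_nat (leq_trans (leq_maxr N _))//.
  rewrite ler_pdivrMr// mulrAC ler_pdivrMr// mulrC => h1; rewrite mulrC (mulrC (e / 2)).
  by apply: le_trans h1; rewrite ler_wpM2r// lerDl.
have := hN m.+1 (leq_trans (leq_maxl _ _) (leqnSn _)) => hm.
have -> : T n t (lim ((fun n => T n t u) @ \oo) - u) =
    T n t (lim ((fun n => T n t u) @ \oo) - T m.+1 t u) + (T n t (T m.+1 t u) - T n t u).
  by rewrite !(linear_opB _ _ ln) addrA subrK.
rewrite (le_trans (normRD _ _))// (splitr e) lerD//; first exact: le_trans (nn _) hm.
have bn := bounded_cont_C_b (bramp n t); have bm := bounded_cont_C_b (bramp m.+1 t).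
rewrite /T -(rho_extM dotH properX rho_rep rho_nondeg u bn bm).
rewrite -(rho_extB dotH properX rho_rep rho_nondeg u (C_bM bn bm) bn) -toCM -toCB.
apply: le_trans nm; apply: (rho_ext_contractive dotH properX rho_rep rho_nondeg).
- apply: bounded_cont_C_b; apply: bounded_contB => //.
  exact: (bounded_contM (bramp n t) (bramp m.+1 t)).
- by rewrite divr_ge0.
- by move=> x; rewrite normRC ramp_prod.
Qed.

Let T_scale (c : R) k u : bounded_cont k ->
  ip (Phi (toC (cst c \* k)) u) u = c * ip (Phi (toC k) u) u.
Proof.
move=> bk; rewrite -(ipZl dot) -(rho_extZ dotH properX rho_rep rho_nondeg).
  by rewrite toCM.
exact: bounded_cont_C_b.
Qed.

Let T_cst (c : R) u : ip (Phi (toC (cst c)) u) u = c * normR u ^+ 2.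
Proof.
rewrite [toC _](_ : _ = cst c%:C)// (rho_ext_cst dotH properX rho_rep rho_nondeg).
by rewrite ipZl (ip_norm dotH).
Qed.

Let bramp_cst a b : bounded_cont (fun x => ramp_cst a b (h x)).
Proof.
apply: (bounded_cont_lip (c := 1) (F := ramp_cst a b)) => // s t.
rewrite mul1r (le_trans (clamp_lip _ _ _ _))//.
by rewrite le_eqVlt; apply/orP; left; apply/eqP; congr `|_|; ring.
Qed.

Section Tail.
Variables (M : R) (Q : R -> H -> H).
Hypothesis hM : forall x, `|h x| <= M.
Hypothesis TQ : forall t u, (fun n => T n t u) @ \oo --> Q t u.

Let q u t := ip (Q t u) u.

(** The forms increase with [n], so [q u t] is their supremum. This lemma and the next are the two
    halves of that statement. *)
Let T_le_q n t u : ip (T n t u) u <= q u t.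
Proof.
have h1 : (fun m => ip (T m t u) u) @ \oo --> q u t by exact: cvg_ip.
apply: (cvgr_to_ge h1); exists n => // m /= nm.
by apply: T_le => x; exact: ramp_mono.
Qed.

Let q_le t u (c : R) : (forall n, ip (T n t u) u <= c) -> q u t <= c.
Proof.
move=> hc; have h1 : (fun m => ip (T m t u) u) @ \oo --> q u t by exact: cvg_ip.
by apply: (cvgr_to_le h1); exact: nearW.
Qed.

Let q_anti u t t' : t <= t' -> q u t' <= q u t.
Proof.
move=> tt'; apply: q_le => n; apply: le_trans (T_le_q n t u).
by apply: T_le => x; exact: ramp_anti.
Qed.

Let q_high u t : M <= t -> q u t = 0.
Proof.
move=> Mt; have T0 n : ip (T n t u) u = 0.
  rewrite /T (_ : (fun x => _) = cst 0) ?T_cst ?mul0r//.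
  apply/funext => x; apply: ramp_eq0; apply: le_trans Mt.
  by rewrite (le_trans (ler_norm _)).
apply/eqP; rewrite eq_le q_le => [|n]; last by rewrite T0.
by rewrite -(T0 0%N) T_le_q.
Qed.

(** One unit below the range of [h], already the ramp with [n = 1] is constantly 1. *)
Let q_low u t : t <= - (M + 1) -> q u t = normR u ^+ 2.
Proof.
move=> tM; apply/eqP; rewrite eq_le q_le//=; apply: le_trans (T_le_q 1 t u).
rewrite /T (_ : (fun x => _) = cst 1) ?T_cst ?mul1r//.
apply/funext => x; apply: ramp_eq1; rewrite mul1r.
have := hM x; rewrite ler_norml; lra.
Qed.

(** A supremum of functions Lipschitz in [t] is lower semicontinuous; as [q u] is also
    nonincreasing, it is right continuous. *)
Let q_right_continuous u : right_continuous (q u).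
Proof.
move=> t; apply/cvgrPdist_le => e e0; have e20 : 0 < e / 2 by rewrite divr_gt0.
have h1 : (fun m => ip (T m t u) u) @ \oo --> q u t by exact: cvg_ip.
have /cvgrPdist_le/(_ _ e20)[n _ /(_ n (leqnn n))] := h1.
move=> /(le_trans (ler_norm _)) /= hn.
have c0 : 0 < n%:R * normR u ^+ 2 + 1 by rewrite ltr_wpDl// mulr_ge0 ?sqr_ge0.
near=> s; have ts : t <= s by near: s; exact: nbhs_right_ge.
rewrite ger0_norm ?subr_ge0 ?q_anti//.
have sh : ip (T n t u) u <= ip (T n s u) u + n%:R * (s - t) * normR u ^+ 2.
  have bs := bounded_contD (bramp n s) (bounded_cont_cst (n%:R * (s - t))).
  have := rho_ext_le dotH properX rho_rep rho_nondeg u (bramp n t) bs.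
  rewrite toCD (rho_extD dotH properX rho_rep rho_nondeg); last 2 first.
  - exact: bounded_cont_C_b.
  - by apply: bounded_cont_C_b; exact: bounded_cont_cst.
  by rewrite ipDl T_cst; apply=> x; exact: ramp_shift.
have := T_le_q n s u.
have : n%:R * (s - t) * normR u ^+ 2 <= e / 2.
  have st0 : 0 <= s - t by rewrite subr_ge0.
  have st : s - t <= e / 2 / (n%:R * normR u ^+ 2 + 1).
    rewrite lerBlDl; near: s; apply: nbhs_right_le.
    by rewrite ltrDl divr_gt0.
  move: st; rewrite ler_pdivlMr//; apply: le_trans.
  by rewrite mulrAC mulrC ler_wpM2l// lerDl.
lra.
Unshelve. all: by end_near.
Qed.

Lemma spectral_tail_measure u : exists mu : {measure set (measurableTypeR R) -> \bar R},
  mu setT = (normR u ^+ 2)%:E /\ forall t, mu `]t, +oo[%classic = (ip (Q t u) u)%:E.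
Proof.
pose F t := normR u ^+ 2 - q u t.
have ndF : nondecreasing F by move=> s t st; rewrite lerD2l lerN2; exact: q_anti.
have rcF : right_continuous F.
  by move=> t; apply: cvgB; [exact: cvg_cst|exact: q_right_continuous].
have F0 t : t <= - (M + 1) -> F t = 0 by move=> tM; rewrite /F q_low// subrr.
have F1 t : M + 1 <= t -> F t = normR u ^+ 2.
  by move=> tM; rewrite /F q_high ?subr0//; lra.
have [mu [muT muF]] := cumulative_measure ndF rcF F0 F1.
by exists mu; split=> // t; rewrite muF /F subKr.
Qed.

(** The form of [Phi] at [ramp_cst a b] of [h] and the integral of [ramp_cst a b] are additive in
    the interval and both lie between [(b - a) q b] and [(b - a) q a]. By [interval_additive_eq0]
    they agree, and on an interval around the range of [h] the first is the form of [h - a]. *)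
Lemma spectral_integral u (mu : {measure set (measurableTypeR R) -> \bar R}) :
  mu setT = (normR u ^+ 2)%:E -> (forall t, mu `]t, +oo[%classic = (ip (Q t u) u)%:E) ->
  mu.-integrable setT (EFin : R -> \bar R) /\
  ip (Phi (toC h) u) u = \int[mu]_t (t : R).
Proof.
(* The absolute value secures [a < b] even for empty [X], where [M] may be negative. *)
move=> muT muq; pose a := - (`|M| + 1); pose b := `|M| + 1.
have M0 := ler_norm M; have M1 := normr_ge0 M.
have ab : a < b by rewrite /a /b; lra.
pose J a b := ip (Phi (toC (fun x => ramp_cst a b (h x))) u) u.
pose D a b := J a b - \int[mu]_t ramp_cst a b t.
have [||imu ->] := measure_support_integral muT muq ab.
- by apply: q_low; rewrite /a; lra.
- by apply: q_high; rewrite /b; lra.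
split=> //.
have Dab : D a b = 0.
  apply: (@interval_additive_eq0 _ D (q u)) ab => {a b}.
    move=> a b c ab bc; rewrite /D.
    have -> : J a c = J a b + J b c.
      rewrite /J -ipDl -(rho_extD dotH properX rho_rep rho_nondeg); try exact: bounded_cont_C_b.
      rewrite -toCD; congr (ip (Phi (toC _) u) u); apply/funext => x /=.
      exact: ramp_cstD.
    have -> : \int[mu]_t ramp_cst a c t = \int[mu]_t ramp_cst a b t + \int[mu]_t ramp_cst b c t.
      rewrite -RintegralD//; [|exact: integrable_ramp_cst muT _ _ (ltW ab)
                              |exact: integrable_ramp_cst muT _ _ (ltW bc)].
      by apply: eq_Rintegral => t _; exact: ramp_cstD.
    by ring.
  move=> a b ab; have ba : 0 < b - a by rewrite subr_gt0.
  have /andP[I1 I2] := integral_ramp_cst_le muT muq ab.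
  have bk n t := bounded_contM (bounded_cont_cst (X := X) (b - a)) (bramp n t).
  have J1 : (b - a) * q u b <= J a b.
    rewrite -ler_pdivlMl//; apply: q_le => n; rewrite ler_pdivlMl// -T_scale//.
    apply: (rho_ext_le dotH properX rho_rep rho_nondeg) => // x.
    exact: ramp_le_clamp.
  have J2 : J a b <= (b - a) * q u a.
    pose n := Num.bound (b - a)^-1.
    have n1 : 1 <= n%:R * (b - a).
      rewrite -ler_pdivrMr// mul1r ltW//; apply: archi_boundP.
      by rewrite invr_ge0 ltW.
    rewrite (le_trans _ (ler_wpM2l (ltW ba) (T_le_q n a u)))// -T_scale//.
    apply: (rho_ext_le dotH properX rho_rep rho_nondeg) => // x.
    exact: clamp_le_ramp.
  rewrite /D ler_norml mulrBr; move: I1 I2 J1 J2; rewrite /q; lra.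
have -> : \int[mu]_t ramp_cst a b t = J a b by apply/eqP; rewrite eq_sym -subr_eq0 -/(D a b) Dab.
rewrite /J (_ : toC (fun x => ramp_cst a b (h x)) = toC (h \- cst a)).
  rewrite toCB (rho_extB dotH properX rho_rep rho_nondeg).
  - by rewrite ipBl T_cst; ring.
  - exact: bounded_cont_C_b.
  - by apply: bounded_cont_C_b; exact: bounded_cont_cst.
apply/funext => x; congr (_%:C); rewrite /ramp_cst /=.
have := hM x; rewrite ler_norml => /andP[hx1 hx2].
have ba : 0 <= b - a by rewrite subr_ge0 ltW.
case: (clampP (h x - a) ba) => -[+ ->]; rewrite /a /b; lra.
Qed.

End Tail.

Lemma spectral_measure_exists : exists E, is_spectral_measure dot (Phi (toC h)) E.
Proof.
have [Q [pQ TQ]] := tail_projection.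
have [_ [M hM]] := bh.
have /choice[mu hmu] := spectral_tail_measure hM TQ.
have [||E [rE ET EI Es]] := spectral_resolution dotH (mu := mu) (Q := Q) _ _ pQ.
- by move=> u; have [] := hmu u.
- by move=> u t; have [_ ->] := hmu u; rewrite (projection_form dotH).
have lE B : measurable B -> linear (E B) by move=> /rE[[[]]].
have sE B u v : measurable B -> ip (E B u) v = ip u (E B v).
  by move=> /rE[[[_ _ +] _] _]; apply.
exists E; split=> //.
- by move=> B /rE[[+ _] _]; exact: contraction_bounded_op.
- move=> B u v mB; apply: ip_adjoint; first exact: lE.
  by move=> {}u {}v; exact: sE.
- move=> u; have [muT muq] := hmu u; exists (mu u).
  have [imu qmu] := spectral_integral hM TQ muT muq; split=> //.
    by move=> B mB; have [pB ->] := rE B mB; rewrite -(projection_form dotH u pB).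
  have bA := bounded_cont_C_b bh.
  have lA : linear (Phi (toC h)) by have [] := rho_ext_bounded dotH properX rho_rep rho_nondeg bA.
  have dreal : dot (Phi (toC h) u) u \is Num.real.
    apply/CrealP; rewrite {2}(hermC dot) /= expr0 mul1r; congr (Num.conj _).
    apply: ip_adjoint => // v w; exact: (rho_ext_self_adjoint dotH properX rho_rep rho_nondeg).
  by rewrite -(RRe_real dreal) -qmu.
Qed.

End Existence.

(** * Slow oscillation and propagation *)

Section SlowlyOscillating.
Context {R : realType} {X : metricType R}.
Implicit Types (f g : X -> R[i]) (x y : X).

Lemma oscillation_bound f (M r : R) x y : (forall z, normR (f z) <= M) ->
  mdist x y <= r -> normR (f x - f y) <= oscillation r f x.
Proof.
move=> hM xy; apply: ub_le_sup; last by exists y.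
exists (M + M) => _ [z _ <-]; rewrite (le_trans (normRB _ _))// lerD//.
Qed.

Lemma slowly_oscillatingP f : slowly_oscillating f <-> C_b f /\
  forall r e : R, 0 < r -> 0 < e -> exists2 K, compact K &
    forall x y, ~ K x -> mdist x y <= r -> normR (f x - f y) <= e.
Proof.
split=> -[bf hf]; split=> // r.
  move=> e r0 e0; have [M M0 hM] := C_b_bound bf.
  have /cvgrPdist_le/(_ e e0) h1 := hf r r0; have [K cK hK] := (at_infinityP _).1 h1.
  exists K => // x y /hK; rewrite sub0r normrN => h xy.
  rewrite (le_trans _ h)// (le_trans (oscillation_bound hM xy))// ler_norm//.
move=> r0; apply/cvgrPdist_le => e e0; have [K cK hK] := hf r e r0 e0.
apply/at_infinityP; exists K => // x Kx; rewrite sub0r normrN.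
have xx : mdist x x <= r by rewrite mdistxx ltW.
have [M M0 hM] := C_b_bound bf.
rewrite ger0_norm; last by rewrite (le_trans _ (oscillation_bound hM xx))// normR_ge0.
apply: ge_sup; first by exists (normR (f x - f x)); exists x.
by move=> _ [y /= xy <-]; exact: hK.
Qed.

(** Generating an algebra therefore adds nothing, and [C_h] can be handled through slow oscillation
    alone. *)
Lemma slowly_oscillating_Cstar : unital_Cstar_subalgebra (slowly_oscillating (X := X)).
Proof.
have soC f : slowly_oscillating f -> C_b f by case.
split.
- by [].
- apply/slowly_oscillatingP; split; first exact: C_b_cst.
  move=> r e r0 e0; exists set0; first exact: compact0.
  by move=> x y _ _; rewrite subrr normR0 ltW.
- move=> f g sf sg; apply/slowly_oscillatingP; split; first by apply: C_bD; exact: soC.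
  move=> r e r0 e0; have e20 : 0 < e / 2 by rewrite divr_gt0.
  have /slowly_oscillatingP[_ /(_ r _ r0 e20)[K cK hK]] := sf.
  have /slowly_oscillatingP[_ /(_ r _ r0 e20)[L cL hL]] := sg.
  exists (K `|` L); first exact: compactU.
  move=> x y /not_orP[nK nL] xy; rewrite opprD addrACA (le_trans (normRD _ _))//.
  by rewrite (splitr e) lerD ?hK ?hL.
- move=> c f sf; apply/slowly_oscillatingP; split; first by apply: C_bZ; exact: soC.
  move=> r e r0 e0.
  have c0 : 0 < normR c + 1 by rewrite ltr_wpDl ?normR_ge0.
  have e'0 : 0 < e / (normR c + 1) by rewrite divr_gt0.
  have /slowly_oscillatingP[_ /(_ r _ r0 e'0)[K cK hK]] := sf.
  exists K => // x y nK xy; rewrite -mulrBr normRM.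
  rewrite (le_trans (ler_wpM2l (normR_ge0 _) (hK x y nK xy)))//.
  by rewrite mulrCA ger_pMr// ler_pdivrMr// mul1r lerDl.
- move=> f g sf sg; apply/slowly_oscillatingP; split; first by apply: C_bM; exact: soC.
  move=> r e r0 e0; have [M M0 hM] := C_b_bound (soC _ sf).
  have [N N0 hN] := C_b_bound (soC _ sg).
  have MN0 : 0 < M + N + 1 by rewrite ltr_wpDl// addr_ge0.
  have e'0 : 0 < e / (M + N + 1) by rewrite divr_gt0.
  have /slowly_oscillatingP[_ /(_ r _ r0 e'0)[K cK hK]] := sf.
  have /slowly_oscillatingP[_ /(_ r _ r0 e'0)[L cL hL]] := sg.
  exists (K `|` L); first exact: compactU.
  move=> x y /not_orP[nK nL] xy.
  have -> : (f \* g) x - (f \* g) y = f x * (g x - g y) + (f x - f y) * g y.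
    by rewrite /=; ring.
  rewrite (le_trans (normRD _ _))// !normRM.
  have h1 := ler_pM (normR_ge0 _) (normR_ge0 _) (hM x) (hL x y nL xy).
  have h2 := ler_pM (normR_ge0 _) (normR_ge0 _) (hK x y nK xy) (hN y).
  rewrite (le_trans (lerD h1 h2))// (mulrC _ N) -mulrDl mulrCA ger_pMr//.
  by rewrite ler_pdivrMr// mul1r lerDl.
- move=> f sf; apply/slowly_oscillatingP; split; first by apply: C_b_conj; exact: soC.
  move=> r e r0 e0; have /slowly_oscillatingP[_ /(_ r e r0 e0)[K cK hK]] := sf.
  by exists K => // x y nK xy; rewrite -rmorphB normR_conj hK.
- move=> f bf hf; apply/slowly_oscillatingP; split=> // r e r0 e0.
  have e30 : 0 < e / 3 by rewrite divr_gt0.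
  have [g sg fg] := hf _ e30.
  have /slowly_oscillatingP[_ /(_ r _ r0 e30)[K cK hK]] := sg.
  exists K => // x y nK xy; have := hK x y nK xy; have := fg x; have := fg y.
  have := normR_triangle (g x) (f x) (f y); have := normR_triangle (g y) (g x) (f y).
  rewrite (normRBC (g y)); lra.
Qed.

Lemma C_hE : C_h (X := X) = slowly_oscillating.
Proof.
apply/seteqP; split; last exact: sub_smallest.
by apply: smallest_sub => //; exact: slowly_oscillating_Cstar.
Qed.

Lemma lip_seminormP f : (lip_seminorm f <= 1)%E <->
  forall x y, normR (f x - f y) <= mdist x y.
Proof.
rewrite /lip_seminorm; split=> [|hf].
  rewrite ge_max => /andP[_ hs] x y.
  have [->|xy] := eqVneq x y; first by rewrite subrr normR0 mdist_ge0.
  have d0 : 0 < mdist x y by rewrite mdist_gt0.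
  rewrite -[leRHS]mul1r -ler_pdivrMr// -lee_fin (le_trans _ hs)//.
  by apply: ereal_sup_ubound; exists (x, y) => //=; exact/eqP.
rewrite ge_max lee_fin ler01/=; apply: ge_ereal_sup => _ [[x y] xy <-]; have /eqP xy' := xy.
by rewrite lee_fin ler_pdivrMr ?mdist_gt0// mul1r; exact: hf.
Qed.

Lemma unitization_C_b f : unitization_C_0 f -> C_b f.
Proof. by move=> [g g0 [c ->]]; apply: C_bD; [exact: C_0_C_b|exact: C_b_cst]. Qed.

Lemma self_adjoint_toC f : self_adjoint_fun f -> f = toC (fun x => complex.Re (f x)).
Proof. by move=> sf; apply/funext => x; rewrite /toC RRe_real//; apply/CrealP. Qed.

End SlowlyOscillating.

Section Propagation.
Context {R : realType} {X : metricType R} {H : completeNormedModType R[i]}.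
Variable dot : {dot H for (@Num.conj R[i])}.
Variable rho : (X -> R[i]) -> H -> H.
Hypothesis dotH : is_hilbert dot.
Hypothesis properX : proper_metric (X := X).
Hypothesis rho_rep : is_representation dot rho.
Hypothesis rho_nondeg : nondegenerate_rep rho.
Implicit Types (f g p q : X -> R[i]) (h : X -> R) (u v w : H) (x y z : X).
Local Notation ip := (ip dot).
Local Notation Phi := (rho_ext rho).

(** Existence turns the default-valued choice [get] into a genuine spectral measure; this is what
    the propagation condition rests on. *)
Lemma spectral_projectionP h : bounded_cont h ->
  is_spectral_measure dot (Phi (toC h)) (spectral_projection dot (Phi (toC h))).
Proof.
move=> bh; rewrite /spectral_projection; apply: (getPex (P := is_spectral_measure dot _)).
exact: (spectral_measure_exists dotH properX rho_rep rho_nondeg bh).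
Qed.

Lemma spectral_compl (A : H -> H) E (B : set R) u : is_spectral_measure dot A E ->
  measurable B -> E (~` B) u = u - E B u.
Proof.
move=> smE mB; have mBc : measurable (~` B) by exact: measurableC.
have pE C : measurable C -> projection dot (E C).
  move=> mC; apply: (projectionI dotH).
  - exact: (spectral_linear smE mC).
  - by move=> v w; exact: (spectral_self_adjoint smE).
  - by move=> v; exact: (spectral_idem smE).
suff -> : E (~` B) = (fun v => v - E B v) by [].
apply: (projection_ext dotH (pE _ mBc) (projection_compl dotH (pE _ mB))) => v.
have [mu [hmu muT _ _]] := spectral_measureE dotH smE v.
have := line_measureU mu mB mBc (setICr _).
rewrite setUv muT !hmu// -EFinD => -[]; rewrite ipBl (ip_norm dotH) => ->; lra.
Qed.

Lemma spectral_above_fix h p (a b : R) u : bounded_cont h -> C_b p -> a < b ->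
  (forall x, p x != 0 -> b <= h x) ->
  spectral_projection dot (Phi (toC h)) `]a, +oo[ (Phi p u) = Phi p u.
Proof.
move=> bh bp ab hb; have smE := spectral_projectionP bh.
have mI : measurable (`]-oo, a]%classic : set R) by exact: measurable_itv.
rewrite -setCitvl (spectral_compl _ smE mI).
rewrite (spectral_below_support dotH properX rho_rep rho_nondeg bh smE u mI bp _ ab hb) ?subr0//.
Qed.

Lemma spectral_below_fix h p (a b : R) u : bounded_cont h -> C_b p -> b < a ->
  (forall x, p x != 0 -> h x <= b) ->
  spectral_projection dot (Phi (toC h)) `]-oo, a] (Phi p u) = Phi p u.
Proof.
move=> bh bp ab hb; have smE := spectral_projectionP bh.
have mI : measurable (`]a, +oo[%classic : set R) by exact: measurable_itv.
rewrite -setCitvr (spectral_compl _ smE mI).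
rewrite (spectral_above_support dotH properX rho_rep rho_nondeg bh smE u mI bp _ ab hb) ?subr0//.
by move=> t; rewrite /= in_itv/= andbT => /ltW.
Qed.

Definition set_dist (P : set X) x : R := inf [set mdist y x | y in P].

Lemma set_dist_has_inf P x : P !=set0 -> has_inf [set mdist y x | y in P].
Proof.
move=> [y Py]; split; first by exists (mdist y x); exists y.
by exists 0 => _ [z _ <-]; exact: mdist_ge0.
Qed.

Lemma set_dist_le (P : set X) x y : P y -> set_dist P x <= mdist y x.
Proof.
move=> Py; apply: ge_inf; last by exists y.
by have [] := @set_dist_has_inf P x (ex_intro _ y Py).
Qed.

Lemma set_dist_ge (P : set X) x (r : R) : P !=set0 -> (forall y, P y -> r <= mdist y x) ->
  r <= set_dist P x.
Proof.
move=> [y Py] h; apply: lb_le_inf; first by exists (mdist y x); exists y.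
by move=> _ [z Pz <-]; exact: h.
Qed.

Lemma set_dist_lip P x y : P !=set0 -> `|set_dist P x - set_dist P y| <= mdist x y.
Proof.
move=> P0; have le a b : set_dist P a - mdist a b <= set_dist P b.
  apply: set_dist_ge => // z Pz; rewrite lerBlDr.
  by rewrite (le_trans (set_dist_le a Pz))// (metric_sym a) metric_triangle.
by rewrite ler_norml; have := le x y; have := le y x; rewrite (metric_sym y); lra.
Qed.

(** For [f] in [C_0] and cutoffs [chi], [<u, rho f v>] is approached by [<u, rho (chi f) v> = <Phi
    chi u, rho f v> = 0]; nondegeneracy does the rest. *)
Lemma cutoff_dense u : (forall n : nat, Phi (cutoffC n%:R) u = 0) -> u = 0.
Proof.
move=> hu; apply: (ip_ext dotH) => v; rewrite ip0l; move: v.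
apply: (nondegenerate_ind rho_nondeg) => [|v w hv hw|f v f0|v hv].
- exact: ip0r.
- by rewrite ipDr hv hw addr0.
- apply/eqP; rewrite -normr_eq0; apply/eqP/le_anti; rewrite normr_ge0 andbT.
  apply/ler_addgt0Pl => e e0; rewrite addr0.
  have c0 : 0 <= normR u * normR v by rewrite mulr_ge0 ?normR_ge0.
  have e'0 : 0 < e / (normR u * normR v + 1) by rewrite divr_gt0// ltr_wpDl.
  have [r0 hr0] := cutoffC_approx f0 e'0.
  pose n := Num.bound `|r0|.
  have r0n : r0 <= n%:R.
    by rewrite (le_trans (ler_norm _))// ltW//; exact: archi_boundP.
  have bn : C_b (cutoffC n%:R : X -> R[i]) by exact: C_b_cutoffC.
  have cf0 := C_0Ml bn f0.
  have -> : ip u (rho f v) = - ip u (rho (cutoffC n%:R \* f \- f) v).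
    rewrite (rhoB rho_rep)// ipBr -(rho_ext_rho dotH properX rho_rep rho_nondeg)//.
    by rewrite -(rho_ext_self_adjoint dotH properX rho_rep rho_nondeg)
      ?hu ?ip0l ?sub0r ?opprK//; split; [exact: continuous_lip1 (cutoff_lip _)|
      exists 1 => x; rewrite ger0_norm ?cutoff_ge0 ?cutoff_le1].
  rewrite normrN (le_trans (ip_le_norm dotH _ _))//.
  have := rho_contractive dotH rho_rep v (C_0B cf0 f0) (ltW e'0) (hr0 _ r0n).
  move=> /(ler_wpM2l (normR_ge0 u))/le_trans; apply.
  by rewrite mulrCA mulrAC ler_pdivrMr ?ltr_wpDl// ler_wpM2l ?(ltW e0)// lerDl.
- apply/eqP; rewrite -normr_eq0; apply/eqP/le_anti; rewrite normr_ge0 andbT.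
  apply/ler_addgt0Pl => e e0; rewrite addr0.
  have e'0 : 0 < e / (normR u + 1) by rewrite divr_gt0// ltr_wpDl ?normR_ge0.
  have [w hw vw] := hv _ e'0.
  rewrite -[ip u v]subr0 -hw -ipBr (le_trans (ip_le_norm dotH _ _))//.
  rewrite (le_trans (ler_wpM2l (normR_ge0 _) vw))// mulrCA ger_pMr//.
  by rewrite ler_pdivrMr ?ltr_wpDl ?normR_ge0// mul1r lerDl.
Qed.

(** The test function is at most [- 1/2] on the support of [p] and at least [r + 1/2] on that of
    [q]. The half units are the strict gaps at 0 and [r] that let the two spectral projections fix
    the vectors. The bound [n] on the support of [p] is what makes the function constant near
    infinity. *)
Lemma propagation_compact_separated (r n : R) (T : H -> H) p q u : 0 < r ->
  spectral_propagation_le dot rho r T -> C_b p -> C_b q ->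
  (forall x, p x != 0 -> base_dist x <= n) ->
  (forall x y, p x != 0 -> q y != 0 -> r + 1 <= mdist x y) ->
  Phi p (T (Phi q u)) = 0.
Proof.
move=> r0 [bT hT] bp bq pn pq.
have [P0|] := pselect ([set x | p x != 0] !=set0); last first.
  move=> nP; rewrite (_ : p = cst 0) ?(rho_ext_cst dotH properX rho_rep rho_nondeg) ?scale0r//.
  apply/funext => x; apply/eqP/negPn/negP => px; apply: nP; by exists x.
pose D := set_dist [set x | p x != 0].
(* constant outside a compact set, hence [toC k] lies in the unitization of C_0 *)
pose k x := Num.min (D x) (r + 1) - 2^-1.
have klip x y : `|k x - k y| <= mdist x y.
  have := set_dist_lip x y P0; rewrite -/D /k !ler_norml.
  by have [Dx|Dx] := leP (D x) (r + 1); have [Dy|Dy] := leP (D y) (r + 1); lra.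
have D0 x : 0 <= D x by apply: set_dist_ge => // y _; exact: mdist_ge0.
have kbd x : - 2^-1 <= k x <= r + 2^-1.
  by have := D0 x; rewrite /k; have [Dx|Dx] := leP (D x) (r + 1); lra.
have bk : bounded_cont k.
  split; first exact: continuous_lip1.
  by exists (r + 2^-1) => x; have := kbd x; rewrite ler_norml; lra.
have kp x : p x != 0 -> k x <= - 2^-1.
  move=> px; have Dx : D x = 0.
    apply/eqP; rewrite eq_le D0 andbT -(mdistxx x).
    by apply: set_dist_le.
  by rewrite /k Dx; have [] := leP 0 (r + 1); lra.
have kq x : q x != 0 -> r + 2^-1 <= k x.
  move=> qx; have Dx : r + 1 <= D x by apply: set_dist_ge => // y py; exact: pq.
  by rewrite /k min_r//; lra.
have uk : unitization_C_0 (toC k).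
  exists (toC (fun x => k x - (r + 2^-1))).
    apply: (compact_supp_C_0 (K := [set x | base_dist x <= n + (r + 1)])).
    - exact: base_dist_compact.
    - have [] // := bounded_cont_C_b (bounded_contB bk (bounded_cont_cst (r + 2^-1))).
    - move=> x /negP; rewrite -ltNge => nx; rewrite /toC.
      have Dx : r + 1 <= D x.
        apply: set_dist_ge => // y py; have := pn y py.
        by have := base_dist_le_mdist y x; lra.
      by rewrite /k min_r// (_ : _ - _ - _ = 0)//; lra.
  by exists (r + 2^-1)%:C; apply/funext => x; rewrite /toC /= -rmorphD subrK.
have sk : self_adjoint_fun (toC k).
  by move=> x; apply/CrealP; rewrite complex_real.
have lk : (lip_seminorm (toC k) <= 1)%E.
  by apply/lip_seminormP => x y; rewrite -rmorphB normRC.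
have := hT _ uk sk lk; set E := spectral_projection dot _ => hE.
have E0 v : E `]-oo, 0]%classic (T (E `]r, +oo[%classic v)) = 0.
  by have := congr1 (fun F => F v) hE.
have Eq : E `]r, +oo[%classic (Phi q u) = Phi q u.
  by apply: (spectral_above_fix (b := r + 2^-1)) => //; rewrite ltrDl.
(* [Phi p] moves to the other side as its adjoint, whose range is fixed by the projection of []-oo,
   0]]; that projection moves back and meets [T]. *)
apply: (ip_ext dotH) => v; rewrite ip0l (rho_ext_ip dotH properX rho_rep rho_nondeg)//.
have <- : E `]-oo, 0]%classic (Phi (fun x => Num.conj (p x)) v) = Phi (fun x => Num.conj (p x)) v.
  apply: (spectral_below_fix (b := - 2^-1)) => //; first exact: C_b_conj.
  by move=> x; rewrite conjC_eq0; exact: kp.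
have mI : measurable (`]-oo, 0]%classic : set R) by exact: measurable_itv.
rewrite -(spectral_self_adjoint (spectral_projectionP bk) _ _ mI) -/E -Eq E0.
by rewrite ip0l.
Qed.

(** Multiplying [p] by a cutoff makes its support bounded; the bound is [n + 1] because the cutoff
    of parameter [n] vanishes from there on. *)
Lemma propagation_separated (r : R) (T : H -> H) p q u : 0 < r ->
  spectral_propagation_le dot rho r T -> C_b p -> C_b q ->
  (forall x y, p x != 0 -> q y != 0 -> r + 1 <= mdist x y) ->
  Phi p (T (Phi q u)) = 0.
Proof.
move=> r0 hT bp bq pq; apply: cutoff_dense => n.
have bn : C_b (cutoffC n%:R : X -> R[i]) by exact: C_b_cutoffC.
rewrite -(rho_extM dotH properX rho_rep rho_nondeg)//.
apply: (propagation_compact_separated (r := r) (n := n%:R + 1)) => //.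
- exact: C_bM.
- move=> x; rewrite mulf_eq0 negb_or => /andP[+ _]; rewrite leNgt => cx.
  apply/negP => /ltW/cutoff0; rewrite /cutoffC in cx *.
  by move=> c0; move: cx; rewrite c0 eqxx.
- by move=> x y; rewrite mulf_eq0 negb_or => /andP[_ px] qy; exact: pq.
Qed.

End Propagation.

(** * The commutator estimate *)

Section Tent.
Context {R : realType}.
Implicit Types (n i j : nat) (x y : R).

(** Written as a difference of two translates of one ramp so that sums over [i] telescope. *)
Definition tent i x : R := clamp 0 1 (x - i%:R + 1) - clamp 0 1 (x - i%:R).

Lemma tent_ge0 i x : 0 <= tent i x.
Proof. by rewrite subr_ge0; apply: clamp01_mono; left; rewrite lerDl. Qed.

Lemma tent_le1 i x : tent i x <= 1.
Proof.
rewrite /tent; case: (clampP (x - i%:R + 1) ler01) => -[+ ->];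
  case: (clampP (x - i%:R) ler01) => -[+ ->]; lra.
Qed.

Lemma tent_support i x : tent i x != 0 -> `|x - i%:R| < 1.
Proof.
rewrite /tent; case: (clampP (x - i%:R + 1) ler01) => -[+ ->];
  case: (clampP (x - i%:R) ler01) => -[+ ->]; rewrite ?subrr ?eqxx// => h1 h2 /eqP h3;
  rewrite ltr_norml; lra.
Qed.

Lemma tent_lip i x y : `|tent i x - tent i y| <= 2 * `|x - y|.
Proof.
have h1 := clamp_lip 0 1 (x - i%:R + 1) (y - i%:R + 1).
have h2 := clamp_lip 0 1 (x - i%:R) (y - i%:R).
have e1 : x - i%:R + 1 - (y - i%:R + 1) = x - y by ring.
have e2 : x - i%:R - (y - i%:R) = x - y by ring.
rewrite e1 in h1; rewrite e2 in h2.
rewrite /tent (_ : _ - _ - _ = (clamp 0 1 (x - i%:R + 1) - clamp 0 1 (y - i%:R + 1)) -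
  (clamp 0 1 (x - i%:R) - clamp 0 1 (y - i%:R))); last by ring.
by rewrite (le_trans (ler_normB _ _))// mulr_natl mulr2n lerD.
Qed.

Lemma sum_tent n x : 0 <= x <= n%:R -> \sum_(i < n.+1) tent i x = 1.
Proof.
move=> xn.
have h m : \sum_(i < m.+1) tent i x = clamp 0 1 (x + 1) - clamp 0 1 (x - m%:R).
  elim: m => [|m IH]; first by rewrite big_ord1 /tent subr0.
  rewrite big_ord_recr/= IH /tent (_ : x - m.+1%:R + 1 = x - m%:R); first by ring.
  by rewrite -natr1; ring.
rewrite h; case: (clampP (x + 1) ler01) => -[+ ->];
  case: (clampP (x - n%:R) ler01) => -[+ ->]; lra.
Qed.

Lemma sum_index_tent n x : 0 <= x <= n%:R -> \sum_(i < n.+1) i%:R * tent i x = x.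
Proof.
move=> xn.
have h m : \sum_(i < m.+1) i%:R * tent i x = clamp 0 m%:R x - m%:R * clamp 0 1 (x - m%:R).
  elim: m => [|m IH].
    rewrite big_ord1 !mul0r subr0; have := @clampP R 0 0 x (lexx 0).
    by case=> -[+ ->]; lra.
  rewrite big_ord_recr/= IH /tent (_ : x - m.+1%:R + 1 = x - m%:R); last first.
    by rewrite -natr1; ring.
  have m0 : 0 <= m%:R :> R by [].
  have m1 : 0 <= m.+1%:R :> R by [].
  suff : clamp 0 m.+1%:R x = clamp 0 m%:R x + clamp 0 1 (x - m%:R).
    by move=> ->; rewrite -natr1; ring.
  have mE : m.+1%:R = m%:R + 1 :> R by rewrite natr1.
  rewrite mE in m1 *; case: (clampP x m1) => -[+ ->]; case: (clampP x m0) => -[+ ->];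
    case: (clampP (x - m%:R) ler01) => -[+ ->]; lra.
rewrite h; have n0 : 0 <= n%:R :> R by [].
have -> : clamp 0 1 (x - n%:R) = 0.
  by case: (clampP (x - n%:R) ler01) => -[+ ->]; lra.
by rewrite mulr0 subr0; case: (clampP x n0) => -[+ ->]; lra.
Qed.

(* [|i - j|] truncated to 0 as soon as it exceeds 2. *)
Definition band_weight i j : nat :=
  ((i == j.+2) + (i == j.+2) + (i == j.+1) + (j == i.+1) + (j == i.+2) + (j == i.+2))%N.

Lemma band_weightC i j : band_weight i j = band_weight j i.
Proof. by rewrite /band_weight; lia. Qed.

Lemma sum_eq_le1 n (f : nat -> nat) c : injective f ->
  (\sum_(i < n) (f i == c) <= 1)%N.
Proof.
move=> fI; have [/existsP[i0 /eqP i0c]|/existsPn h] := boolP [exists i : 'I_n, f i == c].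
  rewrite (bigD1 i0)//= i0c eqxx big1 ?addn0// => i ii0.
  apply/eqP; rewrite eqb0 -i0c; apply: contra ii0 => /eqP/fI ii0; exact/eqP/val_inj.
by rewrite big1// => i _; apply/eqP; rewrite eqb0.
Qed.

(** A column meets offsets 1 and 2 at most once on each side: [2 + 1 + 1 + 2]. *)
Lemma sum_band_weight n j : (\sum_(i < n) band_weight i j <= 6)%N.
Proof.
rewrite /band_weight !big_split/=.
have h1 c : (\sum_(i < n) (nat_of_ord i == c) <= 1)%N by exact: (sum_eq_le1 n c (@inj_id nat)).
have h2 : (\sum_(i < n) (j == i.+1) <= 1)%N.
  under eq_bigr do rewrite eq_sym; exact: (sum_eq_le1 n j succn_inj).
have h3 : (\sum_(i < n) (j == i.+2) <= 1)%N.
  under eq_bigr do rewrite eq_sym.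
  by apply: (sum_eq_le1 n j (f := fun i => i.+2)) => a b [].
by apply: (@leq_trans (1 + 1 + 1 + 1 + 1 + 1)%N) => //; rewrite !leq_add.
Qed.

Lemma band_weight_dist i j : (i <= j.+2)%N -> (j <= i.+2)%N ->
  `|j%:R - i%:R| <= (band_weight i j)%:R :> R.
Proof.
wlog ij : i j / (i <= j)%N => [hw h1 h2|].
  by have [/hw|/ltnW/hw] := leqP i j; [exact|rewrite distrC band_weightC; exact].
move=> _ ji; rewrite -natrB// ger0_norm// ler_nat /band_weight; lia.
Qed.

End Tent.

Section Commutator.
Context {R : realType} {X : metricType R} {H : completeNormedModType R[i]}.
Variable dot : {dot H for (@Num.conj R[i])}.
Variable rho : (X -> R[i]) -> H -> H.
Hypothesis dotH : is_hilbert dot.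
Hypothesis properX : proper_metric (X := X).
Hypothesis rho_rep : is_representation dot rho.
Hypothesis rho_nondeg : nondegenerate_rep rho.
Implicit Types (f g p q : X -> R[i]) (h k : X -> R) (u v w : H) (x y z : X).
Local Notation ip := (ip dot).
Local Notation Phi := (rho_ext rho).

Lemma rho_ext_sum n (F : nat -> X -> R) u : (forall i, bounded_cont (F i)) ->
  Phi (toC (fun x => \sum_(i < n) F i x)) u = \sum_(i < n) Phi (toC (F i)) u.
Proof.
move=> bF; suff [] : bounded_cont (fun x => \sum_(i < n) F i x) /\
  Phi (toC (fun x => \sum_(i < n) F i x)) u = \sum_(i < n) Phi (toC (F i)) u by [].
elim: n => [|n [IH1 IH2]].
  rewrite big_ord0 (_ : (fun x => _) = cst 0); last by apply/funext => x; rewrite big_ord0.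
  split; first exact: bounded_cont_cst.
  by rewrite [toC _](_ : _ = cst 0)// (rho_ext_cst dotH properX rho_rep rho_nondeg) scale0r.
rewrite big_ord_recr/= -IH2.
rewrite (_ : (fun x => _) = (fun x => \sum_(i < n) F i x) \+ F n); last first.
  by apply/funext => x; rewrite big_ord_recr.
split; first exact: bounded_contD.
by rewrite toCD (rho_extD dotH properX rho_rep rho_nondeg)//; exact: bounded_cont_C_b.
Qed.

Section Tents.
Variables (k : X -> R) (N : nat).
Hypothesis bk : bounded_cont k.
Hypothesis kN : forall x, 0 <= k x <= N%:R.

Let psi i := toC (fun x => tent i (k x)).

Let bpsi i : bounded_cont (fun x => tent i (k x)).
Proof. by apply: (bounded_cont_lip (c := 2)) => //; exact: tent_lip. Qed.

Let bpsi' i : C_b (psi i). Proof. exact: bounded_cont_C_b. Qed.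

Lemma tent_partition u : \sum_(i < N.+1) Phi (psi i) u = u.
Proof.
rewrite -(rho_ext_sum N.+1 u bpsi) [toC _](_ : _ = cst 1).
  by rewrite (rho_ext1 dotH properX rho_rep rho_nondeg).
by apply/funext => x; rewrite /toC sum_tent.
Qed.

Lemma tent_index u : \sum_(i < N.+1) (i%:R)%:C *: Phi (psi i) u = Phi (toC k) u.
Proof.
have bF i := bounded_contM (bounded_cont_cst (X := X) i%:R) (bpsi i).
rewrite [in RHS](_ : k = fun x => \sum_(i < N.+1) (cst i%:R \* (fun x => tent i (k x))) x).
  rewrite (rho_ext_sum N.+1 u bF); apply: eq_bigr => i _.
  by rewrite -(rho_extZ dotH properX rho_rep rho_nondeg)// toCM.
by apply/funext => x /=; rewrite sum_index_tent.
Qed.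

(** Tents take values in [[0, 1]], so their squares sum to at most the partition of unity. *)
Lemma tent_sqr_sum u : \sum_(i < N.+1) normR (Phi (psi i) u) ^+ 2 <= normR u ^+ 2.
Proof.
rewrite -(ip_norm dotH) -{2}(tent_partition u) ip_suml; apply: ler_sum => i _.
rewrite (sqr_rho_ext dotH properX rho_rep rho_nondeg)//.
apply: (rho_ext_le dotH properX rho_rep rho_nondeg) => //.
  have bN := bounded_cont_normR (bpsi' i); exact: (bounded_contM bN bN).
move=> x; rewrite normRC ger0_norm ?tent_ge0// expr2 ler_piMr ?tent_ge0 ?tent_le1//.
Qed.

Variables (r : R) (T : H -> H) (p q : X -> R[i]).
Hypothesis r0 : 0 < r.
Hypothesis hT : spectral_propagation_le dot rho r T.
Hypothesis T1 : opnorm T <= 1.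
Hypothesis bp : C_b p.
Hypothesis bq : C_b q.
Hypothesis pqk : forall x y, p x != 0 -> q y != 0 -> mdist x y <= r + 1 ->
  `|k x - k y| <= 1.

(** Each tent confines [k] to within 1 of its index. For indices at least 3 apart the values of [k]
    differ by more than 1, so by [pqk] the supports are more than [r + 1] apart and [T] cannot
    connect them. *)
Lemma tent_far i j u v : (j.+2 < i)%N \/ (i.+2 < j)%N ->
  ip (T (Phi (psi j) (Phi q u))) (Phi (psi i) (Phi (fun x => Num.conj (p x)) v)) = 0.
Proof.
move=> ij.
rewrite -(rho_ext_self_adjoint dotH properX rho_rep rho_nondeg)//.
have -> : ip (Phi (psi i) (T (Phi (psi j) (Phi q u)))) (Phi (fun x => Num.conj (p x)) v) =
    ip (Phi p (Phi (psi i) (T (Phi (psi j) (Phi q u))))) v.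
  by rewrite [RHS](rho_ext_ip dotH properX rho_rep rho_nondeg).
rewrite -!(rho_extM dotH properX rho_rep rho_nondeg)//.
rewrite (propagation_separated dotH properX rho_rep rho_nondeg u r0 hT) ?ip0l//;
  try exact: C_bM.
move=> x y; rewrite !mulf_eq0 !negb_or => /andP[px ix] /andP[jy qy].
rewrite leNgt; apply/negP => /ltW/(pqk px qy).
have /tent_support : tent i (k x) != 0 by apply: contra ix => /eqP h; rewrite /psi /toC h.
have /tent_support : tent j (k y) != 0 by apply: contra jy => /eqP h; rewrite /psi /toC h.
rewrite !ltr_norml ler_norml => h1 h2 h3.
by case: ij; rewrite -(ler_nat R) -!natr1; lra.
Qed.

(** In the partition of unity the commutator has coefficients [(j - i) b i j], zero for
    [|i - j| > 2]. The Schur test with row sums 6 and [|b i j| <= (a j + c i) / 2] gives the factor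
    3. *)
Lemma tent_commutator_form u v :
  `|ip (Phi p (op_commutator T (Phi (toC k)) (Phi q u))) v| <=
  3 * (normR (Phi q u) ^+ 2 + normR (Phi (fun x => Num.conj (p x)) v) ^+ 2).
Proof.
have [bT _] := hT.
set z := Phi q u; set w := Phi (fun x => Num.conj (p x)) v.
pose b (i j : 'I_N.+1) := ip (T (Phi (psi j) z)) (Phi (psi i) w).
have e1 : ip (T (Phi (toC k) z)) w = \sum_(i < N.+1) \sum_(j < N.+1) j%:R * b i j.
  rewrite exchange_big/= -tent_index (linear_op_sum _ _ _ bT.1) ip_suml.
  apply: eq_bigr => j _; rewrite (linear_opZ _ _ bT.1) ipZl -mulr_sumr.
  by congr (_ * _); rewrite -[w in LHS]tent_partition ip_sumr.
have e2 : ip (Phi (toC k) (T z)) w = \sum_(i < N.+1) \sum_(j < N.+1) i%:R * b i j.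
  rewrite (rho_ext_self_adjoint dotH properX rho_rep rho_nondeg)// -tent_index ip_sumr.
  apply: eq_bigr => i _; rewrite ipZr -mulr_sumr; congr (_ * _).
  by rewrite -[z in LHS]tent_partition (linear_op_sum _ _ _ bT.1) ip_suml.
rewrite (rho_ext_ip dotH properX rho_rep rho_nondeg)// -/w /op_commutator /= ipBl e1 e2.
rewrite -sumrB (le_trans (ler_norm_sum _ _ _))//.
pose a (j : 'I_N.+1) := normR (Phi (psi j) z) ^+ 2.
pose c (i : 'I_N.+1) := normR (Phi (psi i) w) ^+ 2.
have term (i j : 'I_N.+1) : `|j%:R * b i j - i%:R * b i j| <=
    (band_weight i j)%:R * ((a j + c i) / 2).
  (* Cauchy-Schwarz with [|T| <= 1], then [x y <= (x ^ 2 + y ^ 2) / 2]. *)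
  have bij : `|b i j| <= (a j + c i) / 2.
    rewrite (le_trans (ip_le_norm dotH _ _))//.
    have := opnorm_bound (Phi (psi j) z) bT => h.
    have h2 : normR (T (Phi (psi j) z)) <= normR (Phi (psi j) z).
      by rewrite (le_trans h)// ler_piMl ?normR_ge0.
    rewrite (le_trans (ler_wpM2r (normR_ge0 _) h2))// /a /c.
    have := sqr_ge0 (normR (Phi (psi j) z) - normR (Phi (psi i) w)).
    by rewrite sqrrB; lra.
  have ac0 : 0 <= (a j + c i) / 2 by exact: le_trans bij.
  rewrite -mulrBl normrM.
  have [h1|h1] := leqP i j.+2; have [h2|h2] := leqP j i.+2.
  - by rewrite ler_pM// band_weight_dist.
  - have -> : b i j = 0 by apply: tent_far; right.
    by rewrite normr0 mulr0 mulr_ge0.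
  - have -> : b i j = 0 by apply: tent_far; left.
    by rewrite normr0 mulr0 mulr_ge0.
  - have -> : b i j = 0 by apply: tent_far; left.
    by rewrite normr0 mulr0 mulr_ge0.
have sum6 (i : 'I_N.+1) : \sum_(j < N.+1) (band_weight i j)%:R <= 6 :> R.
  under eq_bigr do rewrite band_weightC.
  by rewrite -natr_sum ler_nat sum_band_weight.
have -> : 3 * (normR z ^+ 2 + normR w ^+ 2) = 6 * normR z ^+ 2 / 2 + 6 * normR w ^+ 2 / 2.
  by field.
have sumle : \sum_(i < N.+1) \sum_(j < N.+1) (band_weight i j)%:R * ((a j + c i) / 2) <=
    6 * normR z ^+ 2 / 2 + 6 * normR w ^+ 2 / 2.
  under eq_bigr do under eq_bigr do rewrite mulrDl mulrDr.
  under eq_bigr do rewrite big_split/=.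
  rewrite big_split/= lerD//.
    rewrite exchange_big/= -mulrA mulrCA mulrC -mulrA.
    apply: (@le_trans _ _ (\sum_(j < N.+1) 6 * (a j / 2))).
      apply: ler_sum => j _; rewrite -mulr_suml ler_wpM2r ?divr_ge0 ?sqr_ge0//.
      by under eq_bigr do rewrite band_weightC; exact: sum6.
    by have := tent_sqr_sum z; rewrite -mulr_sumr -mulr_suml; rewrite -/a; lra.
  apply: (@le_trans _ _ (\sum_(i < N.+1) 6 * (c i / 2))).
    apply: ler_sum => i _; rewrite -mulr_suml ler_wpM2r ?divr_ge0 ?sqr_ge0//.
  by have := tent_sqr_sum w; rewrite -mulr_sumr -mulr_suml; rewrite -/c; lra.
apply: le_trans sumle; apply: ler_sum => i _; rewrite -sumrB.
rewrite (le_trans (ler_norm_sum _ _ _))//; apply: ler_sum => j _; exact: term.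
Qed.

End Tents.

Variables (r : R) (T : H -> H) (p q : X -> R[i]).
Hypothesis r0 : 0 < r.
Hypothesis hT : spectral_propagation_le dot rho r T.
Hypothesis T1 : opnorm T <= 1.
Hypothesis bp : C_b p.
Hypothesis bq : C_b q.
Hypothesis p1 : forall x, normR (p x) <= 1.
Hypothesis q1 : forall x, normR (q x) <= 1.

Let bPhi g : C_b g -> bounded_op (Phi g).
Proof. exact: (rho_ext_bounded dotH properX rho_rep rho_nondeg). Qed.

Let bound1 g u : C_b g -> (forall x, normR (g x) <= 1) -> normR u <= 1 ->
  normR (Phi g u) ^+ 2 <= 1.
Proof.
move=> bg g1 u1; rewrite expr_le1 ?normR_ge0// (le_trans _ u1)// -[leRHS]mul1r.
exact: (rho_ext_contractive dotH properX rho_rep rho_nondeg).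
Qed.

Lemma commutator_bound_real h (d : R) u : bounded_cont h -> 0 < d ->
  (forall x y, p x != 0 -> q y != 0 -> mdist x y <= r + 1 -> `|h x - h y| <= d) ->
  normR u <= 1 ->
  normR (Phi p (op_commutator T (Phi (toC h)) (Phi q u))) <= 6 * d.
Proof.
move=> bh d0 hd u1; have [_ [M hM]] := bh; have [bT _] := hT.
(* Dividing by [d] brings the variation down to 1, and adding [M / d] makes the function
   nonnegative; constants commute with [T], so the commutator is merely divided by [d]. *)
pose k := cst d^-1 \* h \+ cst (M / d).
have bk : bounded_cont k.
  apply: bounded_contD; last exact: bounded_cont_cst.
  exact: (bounded_contM (bounded_cont_cst _) bh).
have kE x : k x = (h x + M) / d by rewrite /k /=; field; exact: lt0r_neq0.
pose N := Num.bound ((M + M) / d).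
have kN x : 0 <= k x <= N%:R.
  have := hM x; rewrite ler_norml kE => /andP[h1 h2].
  have hx0 : 0 <= h x + M by lra.
  rewrite divr_ge0 ?(ltW d0)//=; apply: (@le_trans _ _ ((M + M) / d)).
    by rewrite ler_wpM2r ?invr_ge0 ?(ltW d0)// lerD2r.
  apply/ltW/archi_boundP; apply: divr_ge0 (ltW d0); lra.
have pqk x y : p x != 0 -> q y != 0 -> mdist x y <= r + 1 -> `|k x - k y| <= 1.
  move=> px qy xy; rewrite !kE -mulrBl opprD addrACA subrr addr0 normrM.
  have -> : `|d^-1| = d^-1 by rewrite ger0_norm// invr_ge0 ltW.
  by rewrite ler_pdivrMr// mul1r hd.
set w := Phi p _; set w' := Phi p (op_commutator T (Phi (toC k)) (Phi q u)).
have wE : w = d%:C *: w'.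
  have [lp _] := bPhi bp.
  rewrite /w' /op_commutator /= !(rho_ext_shift dotH properX rho_rep rho_nondeg)//.
  rewrite (linear_opD _ _ bT.1) !(linear_opZ _ _ bT.1) opprD addrACA subrr addr0.
  rewrite -scalerBr (linear_opZ _ _ lp) scalerA -rmorphM mulfV ?lt0r_neq0//.
  by rewrite rmorph1 scale1r.
have [w0|w0] := eqVneq (normR w') 0.
  by rewrite wE normRZ w0 mulr0 mulr_ge0 ?ltW.
have w_gt0 : 0 < normR w' by rewrite lt_neqAle eq_sym w0 normR_ge0.
rewrite wE normRZ normRC (ger0_norm (ltW d0)) mulrC ler_wpM2r ?(ltW d0)//.
(* Pairing with the unit vector along [w'] recovers its norm; both squared norms in the form bound
   are at most 1, whence [3 * 2 = 6]. *)
pose v := (normR w')^-1%:C *: w'.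
have v1 : normR v <= 1.
  by rewrite normRZ normRC ger0_norm ?invr_ge0 ?normR_ge0// mulVf.
have := tent_commutator_form bk kN r0 hT T1 bp bq pqk u v.
rewrite -/w' /v ipZr (ip_norm dotH) expr2 mulKf// ger0_norm ?normR_ge0//.
move=> /le_trans; apply; rewrite -/v.
have h1 := bound1 bq q1 u1.
have h2 : normR (Phi (fun x => Num.conj (p x)) v) ^+ 2 <= 1.
  by apply: bound1 => //; [exact: C_b_conj|move=> x; rewrite normR_conj].
lra.
Qed.

(** Real and imaginary parts contribute [6 d] each; the imaginary part is handled as the real part
    of [- 'i * g]. *)
Lemma commutator_bound g (d : R) u : C_b g -> 0 < d ->
  (forall x y, p x != 0 -> q y != 0 -> mdist x y <= r + 1 -> normR (g x - g y) <= d) ->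
  normR u <= 1 ->
  normR (Phi p (op_commutator T (Phi g) (Phi q u))) <= 12 * d.
Proof.
move=> bg d0 hd u1; have [bT _] := hT.
have big : C_b (fun x => - 'i * g x) by exact: C_bZ.
pose h1 x := complex.Re (g x); pose h2 x := complex.Re (- 'i * g x).
have bh1 : bounded_cont h1 by exact: bounded_cont_Re.
have bh2 : bounded_cont h2 by exact: (bounded_cont_Re big).
have gE : g = toC h1 \+ (fun x => 'i * toC h2 x).
  apply/funext => x; rewrite /toC /h1 /h2 /= -complexiE; case: (g x) => a b.
  by rewrite /=; simpc; congr (_ +i* _); ring.
have b1 := bounded_cont_C_b bh1; have b2 := bounded_cont_C_b bh2.
have PhiE v : Phi g v = Phi (toC h1) v + 'i *: Phi (toC h2) v.
  rewrite {1}gE (rho_extD dotH properX rho_rep rho_nondeg)//; last exact: C_bZ.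
  by rewrite (rho_extZ dotH properX rho_rep rho_nondeg).
have cE v : op_commutator T (Phi g) v =
    op_commutator T (Phi (toC h1)) v + 'i *: op_commutator T (Phi (toC h2)) v.
  rewrite /op_commutator /= !PhiE (linear_opD _ _ bT.1) (linear_opZ _ _ bT.1).
  by rewrite scalerBr opprD addrACA.
have [lp _] := bPhi bp.
rewrite cE (linear_opD _ _ lp) (linear_opZ _ _ lp) (le_trans (normRD _ _))//.
rewrite normRZ (_ : normR 'i = 1) ?mul1r; last by rewrite normCi.
have hd1 x y : p x != 0 -> q y != 0 -> mdist x y <= r + 1 -> `|h1 x - h1 y| <= d.
  by move=> px qy xy; rewrite -raddfB (le_trans (Re_le_normR _))// hd.
have hd2 x y : p x != 0 -> q y != 0 -> mdist x y <= r + 1 -> `|h2 x - h2 y| <= d.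
  move=> px qy xy; rewrite -raddfB (le_trans (Re_le_normR _))// -mulrBr normRM normRN.
  by rewrite normCi mul1r hd.
have := commutator_bound_real bh1 d0 hd1 u1; have := commutator_bound_real bh2 d0 hd2 u1.
lra.
Qed.

End Commutator.

(** * The generalized Higson compactification *)

Section Higson.
Context {R : realType} {X : metricType R} {H : completeNormedModType R[i]}.
Variable dot : {dot H for (@Num.conj R[i])}.
Variable rho : (X -> R[i]) -> H -> H.
Hypothesis dotH : is_hilbert dot.
Hypothesis properX : proper_metric (X := X).
Hypothesis rho_rep : is_representation dot rho.
Hypothesis rho_nondeg : nondegenerate_rep rho.
Implicit Types (f g p q : X -> R[i]) (h k : X -> R) (v w : H) (x y z : X).
Local Notation ip := (ip dot).
Local Notation Phi := (rho_ext rho).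

Let bPhi g : C_b g -> bounded_op (Phi g).
Proof. exact: (rho_ext_bounded dotH properX rho_rep rho_nondeg). Qed.

Lemma normR_1B_le1 (c : R[i]) : 0 <= c -> c <= 1 -> normR (1 - c) <= 1.
Proof.
move=> c0 c1; rewrite ger0_norm ?subr_ge0// raddfB /= gerBl.
by rewrite -ler0c RRe_real// ger0_real.
Qed.

Lemma opnorm_commutator_le (T : H -> H) g (M : R) v : bounded_op T -> opnorm T <= 1 ->
  C_b g -> 0 <= M -> (forall x, normR (g x) <= M) ->
  normR (op_commutator T (Phi g) v) <= 2 * M * normR v.
Proof.
move=> bT T1 bg M0 hM.
have Tle w : normR (T w) <= normR w.
  by rewrite (le_trans (opnorm_bound w bT))// ler_piMl ?normR_ge0.
have gle w : normR (Phi g w) <= M * normR w.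
  exact: (rho_ext_contractive dotH properX rho_rep rho_nondeg).
rewrite (le_trans (normRB _ _))// -mulrA mulr_natl mulr2n lerD//=.
  exact: le_trans (Tle _) (gle _).
by rewrite (le_trans (gle _))// ler_wpM2l.
Qed.

Section ApproximateUnit.
Variables (I : Type) (le : I -> I -> Prop) (u : I -> X -> R[i]).
Hypothesis hu : approximate_unit le u.

Let a i := cst 1 \- u i.

Let ba i : C_b (a i).
Proof. by apply: C_bB; [exact: C_b_cst|apply: C_0_C_b; exact: (au_C_0 hu)]. Qed.

Let aE i : id \- rho (u i) = Phi (a i).
Proof.
apply/funext => v; rewrite (rho_extB dotH properX rho_rep rho_nondeg).
- rewrite (rho_ext1 dotH properX rho_rep rho_nondeg).
  by rewrite (rho_ext_C_0 dotH properX rho_rep rho_nondeg (au_C_0 hu i)).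
- exact: C_b_cst.
- by apply: C_0_C_b; exact: (au_C_0 hu).
Qed.

Let a_le1 i x : normR (a i x) <= 1.
Proof. by apply: normR_1B_le1; [exact: (au_ge0 hu)|exact: (au_le1 hu)]. Qed.

Let Phi_a_le i v : normR (Phi (a i) v) <= normR v.
Proof.
rewrite -[leRHS]mul1r.
exact: (rho_ext_contractive dotH properX rho_rep rho_nondeg).
Qed.

Lemma slowly_oscillating_higson g : slowly_oscillating g ->
  generalized_higson dot rho le u (Phi g).
Proof.
move=> sg; have /slowly_oscillatingP[bg osc] := sg; split; first by exists g.
move=> r e r0 e0; have [M M0 hM] := C_b_bound bg.
(* [commutator_bound] multiplies by 12, leaving [e / 2] for the part far away. *)
have d0 : 0 < e / 24 by rewrite divr_gt0.
have r10 : 0 < r + 1 by rewrite addr_gt0.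
have [K cK hK] := osc _ _ r10 d0; have [n hn] := compact_base_dist cK.
pose chi := cutoffC n : X -> R[i]; have chi0 : C_0 chi by exact: C_0_cutoffC.
have bchi := C_0_C_b chi0.
have M20 : 0 < 2 * (2 * M + 1) by rewrite mulr_gt0// ltr_wpDl// mulr_ge0.
have e'0 : 0 < e / (2 * (2 * M + 1)) by rewrite divr_gt0.
(* The commutator has norm at most [2 M], so the compact part costs [e' * (2 M) <= e / 2]; the added
   1 keeps the denominator positive. *)
set e' := e / _ in e'0; have e'M : e' * (2 * M) <= e / 2.
  rewrite /e' mulrAC ler_pdivrMr// (_ : e / 2 * _ = e * (2 * M + 1)); last by field.
  by rewrite ler_wpM2l ?(ltW e0)// lerDl.
have [i0 hi0] := au_cvg hu chi0 e'0; exists i0 => i ii T hT T1.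
have [bT _] := hT.
pose p : X -> R[i] := cst 1 \- chi.
have bp : C_b p by apply: C_bB => //; exact: C_b_cst.
have p1 x : normR (p x) <= 1.
  apply: normR_1B_le1; first by rewrite /chi /cutoffC ler0c cutoff_ge0.
  by rewrite /chi /cutoffC -(rmorph1 (real_complex R)) lecR cutoff_le1.
have pK x : p x != 0 -> ~ K x.
  move=> px Kx; case/eqP: px; rewrite /p /chi /cutoffC /=.
  by rewrite cutoff1 ?subrr//; exact: hn.
(* The part under [p] lies off [K], where [g] oscillates little; the part under [chi] is nearly
   annihilated by [1 - u i], uniformly in [T]. *)
have split1 v : v = Phi p v + Phi chi v.
  rewrite (rho_extB dotH properX rho_rep rho_nondeg)//; last exact: C_b_cst.
  by rewrite (rho_ext1 dotH properX rho_rep rho_nondeg) subrK.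
have b1 := C_b_cst (1 : R[i]) : C_b (cst 1 : X -> R[i]).
have n1 x : normR ((cst 1 : X -> R[i]) x) <= 1 by rewrite normR1.
(* Oscillation is controlled as soon as one of the two points is off [K]. A cutoff on one side of
   the commutator suffices, and the other function is 1; [c2] is the mirror image. *)
have c1 v : normR v <= 1 -> normR (Phi p (op_commutator T (Phi g) v)) <= e / 2.
  move=> v1.
  have := commutator_bound dotH properX rho_rep rho_nondeg r0 hT T1 bp b1 p1 n1 bg d0 _ v1.
  rewrite (rho_ext1 dotH properX rho_rep rho_nondeg) => h; apply: (le_trans (h _)); last lra.
  by move=> x y px _ xy; apply: hK => //; exact: pK.
have c2 v : normR v <= 1 -> normR (op_commutator T (Phi g) (Phi p v)) <= e / 2.
  move=> v1.
  have := commutator_bound dotH properX rho_rep rho_nondeg r0 hT T1 b1 bp n1 p1 bg d0 _ v1.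
  rewrite (rho_ext1 dotH properX rho_rep rho_nondeg) => h; apply: (le_trans (h _)); last lra.
  move=> x y _ py xy; rewrite normRBC; apply: hK; first exact: pK.
  by rewrite metric_sym.
have small v : normR (Phi (a i) (Phi chi v)) <= e' * normR v /\
    normR (Phi chi (Phi (a i) v)) <= e' * normR v.
  rewrite -!(rho_extM dotH properX rho_rep rho_nondeg)//.
  have h x : normR (a i x * chi x) <= e'.
    by have := hi0 i ii x; rewrite normRBC /a /= mulrBl mul1r.
  split; apply: (rho_ext_contractive dotH properX rho_rep rho_nondeg); rewrite ?ltW//;
    try exact: C_bM.
  by move=> x; have := h x; rewrite mulrC.
have cle v := opnorm_commutator_le v bT T1 bg M0 hM.
have lg := (bPhi bg).1.
have cD v w : op_commutator T (Phi g) (v + w) =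
    op_commutator T (Phi g) v + op_commutator T (Phi g) w.
  rewrite /op_commutator /= (linear_opD _ _ lg) !(linear_opD _ _ bT.1).
  by rewrite (linear_opD _ _ lg) opprD addrACA.
have la := (bPhi (ba i)).1.
split; apply: opnorm_le => v v1; rewrite aE /=.
  rewrite [X in Phi (a i) X]split1 (linear_opD _ _ la) (le_trans (normRD _ _))//.
  rewrite (splitr e) lerD//; first exact: le_trans (Phi_a_le _ _) (c1 _ v1).
  rewrite (le_trans (small _).1)// (le_trans _ e'M)// ler_wpM2l ?(ltW e'0)//.
  by rewrite (le_trans (cle _))// ler_piMr// mulr_ge0.
have w1 : normR (Phi (a i) v) <= 1 by exact: le_trans (Phi_a_le _ _) v1.
rewrite (split1 (Phi (a i) v)) cD (le_trans (normRD _ _))// (splitr e) lerD//.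
  exact: c2.
rewrite (le_trans (cle _))// (le_trans _ e'M)// mulrC ler_wpM2r ?mulr_ge0//.
by rewrite (le_trans (small v).2)// ler_piMr// (ltW e'0).
Qed.

Hypothesis rho_faithful : faithful_rep rho.

(** By faithfulness a nonzero bump at [x] acts nontrivially on some vector, which can be
    normalised. *)
Lemma local_unit_vector x (d : R) : 0 < d -> exists p v,
  [/\ C_b p, forall z, p z != 0 -> mdist x z < d & normR (Phi p v) = 1].
Proof.
move=> d0; pose k z := clamp 0 1 (1 - mdist x z / d).
have bk : bounded_cont k.
  split; last first.
    exists 1 => z; rewrite /k ger0_norm /clamp; last by rewrite le_max lexx.
    by rewrite ge_max ler01 ge_min lexx.
  apply/continuousRP => z e e0; apply/near_mdistP; exists (e * d); first exact: mulr_gt0.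
  move=> y zy; rewrite (le_trans (clamp_lip _ _ _ _))// opprB addrC addrA subrK.
  rewrite -mulrBl normrM (gtr0_norm (x := d^-1)) ?invr_gt0// ler_pdivrMr//.
  by rewrite (le_trans (mdist_lip _ _ _))// metric_sym ltW.
have kd z : k z != 0 -> mdist x z < d.
  apply: contraNT; rewrite -leNgt => dz; apply/eqP; rewrite /k.
  have : 1 <= mdist x z / d by rewrite ler_pdivlMr// mul1r.
  by case: (clampP (1 - mdist x z / d) ler01) => -[]; lra.
have k0 : C_0 (toC k).
  apply: (compact_supp_C_0 (K := [set z | mdist x z <= d])); first exact: properX.
    by have [] := bounded_cont_C_b bk.
  move=> z /negP; rewrite -ltNge => dz; rewrite /toC; have [->//|/kd] := eqVneq (k z) 0.
  by rewrite ltNge ltW.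
have [v rv] : exists v, rho (toC k) v != 0.
  apply: contrapT => nv; have : toC k = cst 0.
    apply: rho_faithful => //; first exact: C_00.
    apply/funext => v; rewrite (rho0 rho_rep); apply/eqP/negPn/negP => kv.
    by apply: nv; exists v.
  move/(congr1 (fun F => complex.Re (F x))); rewrite /toC /= /k mdistxx mul0r subr0.
  by rewrite /clamp minxx max_r//; exact/eqP/oner_neq0.
exists (toC k), ((normR (rho (toC k) v))^-1%:C *: v); split.
- exact: bounded_cont_C_b.
- move=> z kz; apply: kd; apply: contra kz => /eqP h; by rewrite /toC h.
- rewrite (rho_ext_C_0 dotH properX rho_rep rho_nondeg k0).
  rewrite (linear_opZ _ _ (rho_linear rho_rep k0)) normRZ normRC.
  rewrite ger0_norm ?invr_ge0 ?normR_ge0// mulVf//.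
  by apply: contra rv => /eqP/normR0_eq0 ->.
Qed.

(** One of the two projections kills its vector. If [h >= 1/2] on the support of [p], it is the one
    of []-oo, 0]]. Otherwise [h] is below [1/2] somewhere on that support, and being 1-Lipschitz it
    is at most [1/2 + (r + 2)] on the support of [q], still [1/2] short of [r + 3]. *)
Lemma rank_one_propagation (r : R) x y p q v w : 0 < r -> mdist x y <= r ->
  C_b p -> C_b q ->
  (forall z, p z != 0 -> mdist x z < 1) -> (forall z, q z != 0 -> mdist y z < 1) ->
  bounded_op (fun t => dot t (Phi q w) *: Phi p v) ->
  spectral_propagation_le dot rho (r + 3) (fun t => dot t (Phi q w) *: Phi p v).
Proof.
move=> r0 xy bp bq hp hq bT; split=> // f uf sf lf.
have bf := unitization_C_b uf.
have fE := self_adjoint_toC sf; set h := (fun x => complex.Re (f x)) in fE.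
have bh : bounded_cont h by exact: bounded_cont_Re.
have hlip z t : h z <= h t + mdist z t.
  have /lip_seminormP/(_ z t) := lf; rewrite fE -rmorphB normRC ler_norml; lra.
rewrite fE; set E := spectral_projection _ _.
have smE : is_spectral_measure dot (Phi (toC h)) E.
  exact: (spectral_projectionP dotH properX rho_rep rho_nondeg bh).
have m1 : measurable (`]-oo, 0]%classic : set R) by exact: measurable_itv.
have m2 : measurable (`]r + 3, +oo[%classic : set R) by exact: measurable_itv.
apply/funext => t /=; rewrite (linear_opZ _ _ (spectral_linear smE m1)).
have [ph|/existsNP[z /not_implyP[pz /negP]]] :=
    pselect (forall z, p z != 0 -> 2^-1 <= h z).
  have -> : E `]-oo, 0]%classic (Phi p v) = 0; last by rewrite scaler0.
  apply: (spectral_below_support dotH properX rho_rep rho_nondeg bh smE (a := 0)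
    (b := 2^-1)) => //.
rewrite -ltNge => hz.
have qh s : q s != 0 -> h s <= r + 5 / 2.
  move=> qs; have := hlip s z; have := hp z pz; have := hq s qs.
  have := metric_triangle s y z; have := metric_triangle y x z.
  rewrite (metric_sym s y) (metric_sym y x); lra.
rewrite (sm_self_adjoint smE _ _ m2).
have -> : E `]r + 3, +oo[%classic (Phi q w) = 0; last by rewrite linear0r scale0r.
apply: (spectral_above_support dotH properX rho_rep rho_nondeg bh smE (a := r + 3)
  (b := r + 5 / 2)) => //.
- by move=> s; rewrite /= in_itv/= andbT => /ltW.
- lra.
Qed.

Lemma rank_one_bounded v w : normR v = 1 -> normR w = 1 ->
  bounded_op (fun t => dot t w *: v) /\ opnorm (fun t => dot t w *: v) <= 1.
Proof.
move=> v1 w1; have Tle t : normR (dot t w *: v) <= normR t.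
  by rewrite normRZ v1 mulr1 (le_trans (dot_le_norm dotH _ _))// w1 mulr1.
split; last by apply: opnorm_le => t; exact: le_trans (Tle t).
split; last by exists 1 => t; rewrite mul1r.
by move=> c s t; rewrite linearDl /= dotZl scalerDl scalerA.
Qed.

Lemma higson_slowly_oscillating g : C_b g ->
  generalized_higson dot rho le u (Phi g) -> slowly_oscillating g.
Proof.
move=> bg [_ hg]; apply/slowly_oscillatingP; split=> // r e r0 e0.
have r30 : 0 < r + 3 by rewrite addr_gt0.
have e80 : 0 < e / 8 by rewrite divr_gt0.
have [i0 hi0] := hg _ _ r30 e80.
have q0 : 0 < 4^-1 :> R by rewrite invr_gt0.
have u0 := au_C_0 hu i0; have bu := C_0_C_b u0.
(* Off [K] the function [u i0] is at most [1/4]; a bump small enough for it to vary by [1/4] keeps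
   it below [1/2], so [1 - u i0] retains at least half of [xi]. *)
have /C_0P[cu /(_ _ q0)[K cK hK]] := u0.
exists K => // x y nK xy; rewrite leNgt; apply/negP => gxy.
have cg := bg.1.
have /near_mdistP[d1 d10 h1] := (continuousCP g).1 cg x _ e80.
have /near_mdistP[d2 d20 h2] := (continuousCP g).1 cg y _ e80.
have /near_mdistP[d3 d30 h3] := (continuousCP (u i0)).1 cu x _ q0.
pose d := Num.min (Num.min d1 d2) (Num.min d3 1).
have d0 : 0 < d by rewrite !lt_min d10 d20 d30 ltr01.
have [p [v [bp pd v1]]] := local_unit_vector x d0.
have [q [w [bq qd w1]]] := local_unit_vector y d0.
have pd' z : p z != 0 -> [/\ mdist x z < d1, mdist x z < d3 & mdist x z < 1].
  by move=> /pd; rewrite !lt_min => /andP[/andP[-> _] /andP[-> ->]].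
have qd' z : q z != 0 -> mdist y z < d2 /\ mdist y z < 1.
  by move=> /qd; rewrite !lt_min => /andP[/andP[_ ->] /andP[_ ->]].
set xi := Phi p v in v1; set eta := Phi q w in w1.
have [bT T1] := rank_one_bounded v1 w1; set T := (fun t => _) in bT T1.
have hT : spectral_propagation_le dot rho (r + 3) T.
  apply: (rank_one_propagation r0 xy bp bq) => // z; first by move=> /pd'[].
  by move=> /qd'[].
(* The single index [i0] and the left-hand estimate are enough; [K] was chosen from [u i0]. *)
have [hA _] := hi0 i0 (directed_refl (au_directed hu) i0) T hT T1.
have bg' := bPhi bg.
have bC : bounded_op (op_commutator T (Phi g)).
  by apply: bounded_opB; exact: bounded_op_comp.
have := opnorm_bound eta (bounded_op_comp (bPhi (ba i0)) bC).
rewrite -aE w1 mulr1 => /le_trans/(_ hA); rewrite aE /= => {hA} hA.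
have bx := C_bB bg (C_b_cst (g x)); have by_ := C_bB bg (C_b_cst (g y)).
have gxi : normR (Phi g xi - g x *: xi) <= e / 8.
  rewrite -(rho_ext_cst dotH properX rho_rep rho_nondeg).
  rewrite -(rho_extB dotH properX rho_rep rho_nondeg xi bg (C_b_cst (g x))).
  rewrite -[leRHS]mulr1 -[X in _ * X]v1.
  apply: (rho_ext_local dotH properX rho_rep rho_nondeg v bx bp (ltW e80)) => z /pd'[/h1 + _ _].
  by rewrite normRBC.
have geta : normR (Phi g eta - g y *: eta) <= e / 8.
  rewrite -(rho_ext_cst dotH properX rho_rep rho_nondeg).
  rewrite -(rho_extB dotH properX rho_rep rho_nondeg eta bg (C_b_cst (g y))).
  rewrite -[leRHS]mulr1 -[X in _ * X]w1.
  apply: (rho_ext_local dotH properX rho_rep rho_nondeg w by_ bq (ltW e80)) => z /qd'[/h2 + _].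
  by rewrite normRBC.
have uxi : normR (Phi (u i0) xi) <= 2^-1.
  rewrite -[leRHS]mulr1 -[X in _ * X]v1.
  apply: (rho_ext_local dotH properX rho_rep rho_nondeg v bu bp) => // z /pd'[_ /h3 uz _].
  have := hK x nK; have := normR_sub_ge (u i0 z) (u i0 x); rewrite (normRBC (u i0 z)); lra.
have axi : 2^-1 <= normR (Phi (a i0) xi).
  rewrite (rho_extB dotH properX rho_rep rho_nondeg xi (C_b_cst 1) bu).
  rewrite (rho_ext1 dotH properX rho_rep rho_nondeg).
  by have := normR_sub_ge xi (Phi (u i0) xi); rewrite v1; lra.
have etaeta : dot eta eta = 1.
  by rewrite -dotH normRE w1 rmorph1 expr1n.
(* [xi] and [eta] are approximate eigenvectors of [Phi g] for [g x] and [g y], each within [e / 8];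
   this collects both deviations. *)
pose err := dot (Phi g eta - g y *: eta) eta *: xi - (Phi g xi - g x *: xi).
have cE : op_commutator T (Phi g) eta = (g y - g x) *: xi + err.
  rewrite /op_commutator /T /= etaeta scale1r /err linearBl /= dotZl etaeta mulr1.
  by rewrite !scalerBl opprB addrA (addrC (_ - g x *: _)) !subrKA.
have herr : normR err <= e / 4.
  rewrite (le_trans (normRB _ _))// normRZ v1 mulr1.
  have := dot_le_norm dotH (Phi g eta - g y *: eta) eta; rewrite w1 mulr1.
  move: gxi geta; lra.
have la := (bPhi (ba i0)).1.
move: hA; rewrite cE (linear_opD _ _ la) (linear_opZ _ _ la) => hA.
have h4 := normR_sub_ge ((g y - g x) *: Phi (a i0) xi) (- Phi (a i0) err).
rewrite opprK normRN normRZ normRBC in h4.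
have h5 := Phi_a_le i0 err.
(* The contradiction: [e / 2] would be at most [e / 8] from the hypothesis on [g] plus [e / 4] from
   [err]. *)
have : e * 2^-1 <= normR (g x - g y) * normR (Phi (a i0) xi).
  by apply: ler_pM => //; exact: ltW.
lra.
Qed.

End ApproximateUnit.

End Higson.

Theorem theorem5p5 (R : realType) (X : metricType R)
    (H : completeNormedModType R[i]) (dot : {dot H for (@Num.conj R[i])})
    (rho : (X -> R[i]) -> H -> H)
    (I : Type) (le : I -> I -> Prop) (u : I -> X -> R[i]) :
  proper_metric (X := X) ->
  is_hilbert dot ->
  is_representation dot rho ->
  faithful_rep rho ->
  nondegenerate_rep rho ->
  approximate_unit le u ->
  generalized_higson dot rho le u = rho_ext rho @` C_h.
Proof.
move=> properX dotH rep faith nondeg au; rewrite C_hE; apply/seteqP; split=> S.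
  move=> hS; have [[g bg gS] _] := hS; exists g => //.
  apply: (higson_slowly_oscillating dotH properX rep nondeg au faith bg).
  by rewrite gS.
by move=> [g sg <-]; exact: (slowly_oscillating_higson dotH properX rep nondeg au sg).
Qed.
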